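(* Let $\mathbb P=\mathbb P_{\vec U,\vec\eta}$ be a generalized Prikry forcing of length $\alpha$ with $\eta_i=1$ for all $i<\alpha$, and let $\mathbb B$ be the Boolean algebra of $\mathbb P$. Let $\vec M=\langle M_i\mid i\le\tilde\alpha\rangle$ be the imitation iteration of $\mathbb P$ with embeddings $\vec\pi=\langle\pi_{i,j}\mid i\le j\le\tilde\alpha\rangle$ and critical sequence $\vec\lambda=\langle\lambda_i\mid i<\tilde\alpha\rangle$. Let $U=\pi_{0,\tilde\alpha}^{-1}[G_{\vec\lambda}]$ be the pullback of the filter $G_{\vec\lambda}$ on $\pi_{0,\tilde\alpha}(\mathbb B)$ generated by the critical sequence, and let $j:\mathrm V\to\check{\mathrm V}_U$ be the Boolean ultrapower embedding. Then \begin{itemize} \item $j=\pi_{0,\tilde\alpha}$, \item $M_{\tilde\alpha}=\check{\mathrm V}_U$, and \item $M_{\tilde\alpha}[\vec\lambda]=\mathrm V^{\mathbb B}/U$. \end{itemize}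
   Context: Generalized Prikry forcing (case $\eta_i=1$): let $D$ be a discrete set of measurable cardinals (no element of $D$ is a limit point of $D$) with monotone enumeration $\vec\kappa=\langle\kappa_i\mid i<\alpha\rangle$, and let $\vec U=\langle U_i\mid i<\alpha\rangle$ where $U_i$ is a normal ultrafilter on $\kappa_i$. Conditions in $\mathbb P$ are pairs $\langle s,T\rangle$ where $s$ is a function whose domain is a finite subset of $\alpha$, with $s(i)$ an ordinal in $[\sup_{j<i}\kappa_j,\kappa_i)$ for $i\in\mathrm{dom}(s)$, and $T$ is a function with domain $\alpha\setminus\mathrm{dom}(s)$ with $T(i)\in U_i$ for all $i\in\mathrm{dom}(T)$. Order: $\langle s',T'\rangle\le\langle s,T\rangle$ iff $s\subseteq s'$, $s'(i)\in T(i)$ for $i\in\mathrm{dom}(s')\setminus\mathrm{dom}(s)$, and $T'(i)\subseteq T(i)$ for $i\in\mathrm{dom}(T')$. The Boolean algebra $\mathbb B$ of $\mathbb P$ is its complete Boolean algebra, in which $\mathbb P$ densely embeds. Imitation iteration: $M_0=\mathrm V$, $\pi_{0,0}=\mathrm{id}$; given $M_i$, if $i<\pi_{0,i}(\alpha)$ let $W_i=\pi_{0,i}(\vec U)_i$ and let $\pi_{i,i+1}:M_i\to M_{i+1}$ be the ultrapower embedding of $M_i$ by $W_i$ ($M_{i+1}$ transitive), $\pi_{\gamma,i+1}=\pi_{i,i+1}\circ\pi_{\gamma,i}$; at limits take transitivized direct limits. The construction stops at the least $i$ with $i=\pi_{0,i}(\alpha)$, which is called $\tilde\alpha$. Put $\lambda_i=\pi_{0,i}(\vec\kappa)_i$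 for $i<\tilde\alpha$, the critical point of $\pi_{i,i+1}$. It is a known fact (which may be assumed) that $\vec\lambda$ gives rise to an $M_{\tilde\alpha}$-generic filter on $\pi_{0,\tilde\alpha}(\mathbb P)$, namely the set of $\langle s,T\rangle\in\pi_{0,\tilde\alpha}(\mathbb P)$ with $s(i)=\lambda_i$ for $i\in\mathrm{dom}(s)$ and $\lambda_i\in T(i)$ for $i\in\tilde\alpha\setminus\mathrm{dom}(s)$; $G_{\vec\lambda}$ is the ultrafilter it generates on $\pi_{0,\tilde\alpha}(\mathbb B)$. Boolean ultrapower: for a complete Boolean algebra $\mathbb B$ and an ultrafilter $U\in\mathrm V$ on $\mathbb B$, $\mathrm V^{\mathbb B}/U$ consists of the classes $[\sigma]_U$ of $\mathbb B$-names under $\sigma\sim\tau$ iff $[\![\sigma=\tau]\!]\in U$, with $[\sigma]_U\,E\,[\tau]_U$ iff $[\![\sigma\in\tau]\!]\in U$. $\check{\mathrm V}_U\subseteq\mathrm V^{\mathbb B}/U$ consists of the classes of names with $[\![\sigma\in\check{\mathrm V}]\!]=\bigvee_{x\in\mathrm V}[\![\sigma=\check x]\!]\in U$, and $j(x)=[\check x]_U$. When well-founded, $\mathrm V^{\mathbb B}/U$ (and with it $\check{\mathrm V}_U$) is identified with its transitive collapse. *)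

(* Defs.v *)
From Stdlib Require Import Classical ClassicalEpsilon FunctionalExtensionality
  PropExtensionality List Wellfounded.

Set Implicit Arguments.
Unset Strict Implicit.
Unset Printing Implicit Defensive.

(** * The universe of sets

    [V] is a full (second-order) model of ZFC: sets are the elements of [V],
    and classes are arbitrary predicates on [V].  Equality of sets is [=]. *)

Record zfc_universe : Type := ZFCUniverse {
  sort :> Type;
  mem : sort -> sort -> Prop;
  ax_extensionality : forall x y, (forall z, mem z x <-> mem z y) -> x = y;
  ax_foundation : forall C : sort -> Prop, (exists x, C x) ->
    exists x, C x /\ forall y, mem y x -> ~ C y;
  ax_pairing : forall a b, exists c, forall x, mem x c <-> x = a \/ x = b;
  ax_union : forall a, exists u, forall x, mem x u <-> exists y, mem y a /\ mem x y;
  ax_power : forall a, exists p, forall x, mem x p <-> forall z, mem z x -> mem z a;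
  ax_infinity : exists w,
    (exists e, mem e w /\ forall z, ~ mem z e) /\
    (forall x, mem x w -> exists y, mem y w /\ forall z, mem z y <-> mem z x \/ z = x);
  ax_replacement : forall (R : sort -> sort -> Prop) a,
    (forall x y y', mem x a -> R x y -> R x y' -> y = y') ->
    exists b, forall y, mem y b <-> exists x, mem x a /\ R x y;
  ax_choice : forall a,
    (forall x, mem x a -> exists y, mem y x) ->
    (forall x x' y, mem x a -> mem x' a -> mem y x -> mem y x' -> x = x') ->
    exists c, forall x, mem x a -> exists! y, mem y x /\ mem y c
}.

Declare Scope zf_scope.
Delimit Scope zf_scope with zf.
Open Scope zf_scope.

Notation "x ∈ y" := (mem x y) (at level 70, no associativity) : zf_scope.
Notation "x ∉ y" := (~ mem x y) (at level 70, no associativity) : zf_scope.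
Definition subset (V : zfc_universe) (x y : V) : Prop := forall z, z ∈ x -> z ∈ y.
Notation "x ⊆ y" := (subset x y)
  (at level 70, no associativity) : zf_scope.

Section SetTheory.
Context {V : zfc_universe}.
Implicit Types (a b c f p q s t x y z σ τ ρ : V) (φ ψ : V -> Prop).

Lemma V_inhabited : inhabited V.
Proof. destruct (ax_infinity V) as [w _]; exact (inhabits w). Qed.

(** [{: x | φ}] is the set of all [x] with [φ x], and an unspecified set when
    these [x] form a proper class. *)
Definition compr φ : V :=
  epsilon V_inhabited (fun y : V => forall x, x ∈ y <-> φ x).

(** The unique [x] with [φ x], if there is one. *)
Definition the φ : V := epsilon V_inhabited φ.

End SetTheory.

Notation "{: x | φ }" := (compr (fun x => φ))
  (at level 0, x at level 99, φ at level 200) : zf_scope.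

Section Basics.
Context {V : zfc_universe}.
Implicit Types (a b c f p q s t x y z σ τ ρ : V) (φ ψ : V -> Prop).

Definition emptyset : V := {: z | False }.
Definition sep a φ : V := {: z | z ∈ a /\ φ z }.
Definition inter a b : V := {: z | z ∈ a /\ z ∈ b }.
Definition setminus a b : V := {: z | z ∈ a /\ z ∉ b }.
Definition upair a b : V := {: z | z = a \/ z = b }.
Definition singleton a : V := upair a a.
Definition opair a b : V := upair (singleton a) (upair a b).
Definition succ a : V := {: z | z ∈ a \/ z = a }.

Definition is_function f : Prop :=
  (forall z, z ∈ f -> exists x y, z = opair x y) /\
  (forall x y y', opair x y ∈ f -> opair x y' ∈ f -> y = y').
Definition in_dom f x : Prop := exists y, opair x y ∈ f.
Definition fun_on f a : Prop := is_function f /\ forall x, in_dom f x <-> x ∈ a.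
Definition app f x : V := the (fun y => opair x y ∈ f).
Definition const_fun a x : V := {: z | exists u, u ∈ a /\ z = opair u x }.

Definition finite_class φ : Prop := exists l : list V, forall x, φ x -> In x l.

Definition transitive_class (M : V -> Prop) : Prop :=
  forall x y, M x -> y ∈ x -> M y.
Definition ordinal a : Prop :=
  transitive_class (fun x => x ∈ a) /\
  forall x, x ∈ a -> transitive_class (fun y => y ∈ x).
Definition ole a b : Prop := a ∈ b \/ a = b.
Definition limit_ordinal a : Prop :=
  ordinal a /\ (exists x, x ∈ a) /\ forall x, x ∈ a -> succ x ∈ a.

Fixpoint numeral (n : nat) : V :=
  match n with O => emptyset | S m => succ (numeral m) end.
Definition omega : V := {: x | exists n, x = numeral n }.

Definition cardinal k : Prop :=
  ordinal k /\
  forall b, b ∈ k -> ~ exists f : V -> V,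
    (forall x, x ∈ k -> f x ∈ b) /\
    (forall x y, x ∈ k -> y ∈ k -> f x = f y -> x = y).

(** ** Measurable cardinals *)

Definition ultrafilter_on (k u : V) : Prop :=
  (forall x, x ∈ u -> x ⊆ k) /\
  k ∈ u /\ emptyset ∉ u /\
  (forall x y, x ∈ u -> x ⊆ y -> y ⊆ k -> y ∈ u) /\
  (forall x y, x ∈ u -> y ∈ u -> inter x y ∈ u) /\
  (forall x, x ⊆ k -> x ∈ u \/ setminus k x ∈ u).

Definition nonprincipal (k u : V) : Prop := forall x, x ∈ k -> singleton x ∉ u.

Definition complete_ultrafilter (k u : V) : Prop :=
  forall b (X : V -> V), b ∈ k -> (forall i, i ∈ b -> X i ∈ u) ->
    sep k (fun x => forall i, i ∈ b -> x ∈ X i) ∈ u.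

Definition diagonal_closed (k u : V) : Prop :=
  forall X : V -> V, (forall i, i ∈ k -> X i ∈ u) ->
    sep k (fun x => forall i, i ∈ x -> x ∈ X i) ∈ u.

Definition measurable k : Prop :=
  cardinal k /\ omega ∈ k /\
  exists u, ultrafilter_on k u /\ nonprincipal k u /\ complete_ultrafilter k u.

Definition normal_ultrafilter (k u : V) : Prop :=
  ultrafilter_on k u /\ nonprincipal k u /\ complete_ultrafilter k u /\
  diagonal_closed k u.

Definition limit_point (D d : V) : Prop :=
  ordinal d /\ (exists b, b ∈ d) /\
  forall b, b ∈ d -> exists c, c ∈ D /\ b ∈ c /\ c ∈ d.

Definition discrete (D : V) : Prop := forall d, d ∈ D -> ~ limit_point D d.

Definition monotone_enumeration (D α κ : V) : Prop :=
  ordinal α /\ fun_on κ α /\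
  (forall i j, j ∈ α -> i ∈ j -> app κ i ∈ app κ j) /\
  (forall d, d ∈ D <-> exists i, i ∈ α /\ d = app κ i).

(** ** Generalized Prikry forcing with [η_i = 1] *)

Definition prikry_condition (α κ Us p : V) : Prop :=
  exists s T, p = opair s T /\
    is_function s /\ finite_class (in_dom s) /\
    (forall i, in_dom s i ->
       i ∈ α /\ app s i ∈ app κ i /\
       (* [sup_{j<i} κ_j ≤ s(i)] *)
       forall j, j ∈ i -> app κ j ⊆ app s i) /\
    is_function T /\
    (forall i, in_dom T i <-> i ∈ α /\ ~ in_dom s i) /\
    (forall i, in_dom T i -> app T i ∈ app Us i).

Definition prikry (α κ Us : V) : V := {: p | prikry_condition α κ Us p }.

Definition prikry_le (p' p : V) : Prop :=
  exists s' T' s T, p' = opair s' T' /\ p = opair s T /\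
    s ⊆ s' /\
    (forall i, in_dom s' i -> ~ in_dom s i -> app s' i ∈ app T i) /\
    (forall i, in_dom T' i -> app T' i ⊆ app T i).

(** The order as a set of ordered pairs, so that embeddings apply to it. *)
Definition prikry_order (α κ Us : V) : V :=
  {: z | exists p' p, z = opair p' p /\
           p' ∈ prikry α κ Us /\ p ∈ prikry α κ Us /\ prikry_le p' p }.

(** ** The complete Boolean algebra of a poset

    A poset is a set [P] with an order [r], a set of pairs ([opair q p ∈ r] is
    [q ≤ p]).  Its complete Boolean algebra consists of the regular open subsets
    of [P], ordered by inclusion; open sets are the downward closed ones. *)

Definition reg (P r : V) φ : V :=
  sep P (fun p => forall q, opair q p ∈ r -> exists t, opair t q ∈ r /\ φ t).

Definition RO (P r : V) : V :=
  {: b | b ⊆ P /\ reg P r (fun p => p ∈ b) = b }.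

Definition RO_embedding (P r : V) : V :=
  {: z | exists p, p ∈ P /\ z = opair p (reg P r (fun q => opair q p ∈ r)) }.

Definition bsup (P r : V) (I : Type) (b : I -> V) : V :=
  reg P r (fun p => exists i, p ∈ b i).
Definition binf (P : V) (I : Type) (b : I -> V) : V :=
  sep P (fun p => forall i, p ∈ b i).
Definition bimp (P r b c : V) : V :=
  sep P (fun p => forall q, opair q p ∈ r -> q ∈ b -> q ∈ c).

(** ** Names

    Names are sets of pairs [(τ, b)] with [τ] a name and [b] in the algebra. *)

Inductive is_name (B : V) : V -> Prop :=
  IsName σ :
    (forall z, z ∈ σ -> exists τ b, z = opair τ b /\ b ∈ B) ->
    (forall τ b, opair τ b ∈ σ -> is_name B τ) ->
    is_name B σ.

Definition child τ σ : Prop := exists b, opair τ b ∈ σ.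

Definition small φ : Prop := exists a, forall x, φ x -> x ∈ a.

Lemma mem_wf : well_founded (@mem V).
Proof.
intros x; apply NNPP; intros Hx.
destruct (ax_foundation (C := fun x => ~ Acc (@mem V) x)) as [y [Hy Hmin]].
  now exists x.
apply Hy; constructor; intros z Hz; apply NNPP; exact (Hmin z Hz).
Qed.

Lemma in_compr φ x : small φ -> (x ∈ {: x | φ x } <-> φ x).
Proof.
intros [a Ha].
assert (Hex : exists y, forall x, x ∈ y <-> φ x).
  destruct (@ax_replacement V (fun x y => x = y /\ φ x) a) as [y Hy].
    intros u v w _ [<- _] [<- _]; reflexivity.
  exists y; intros u; rewrite Hy; split.
    now intros [v [_ [<- Hv]]].
  intros Hu; exists u; auto.
exact (epsilon_spec V_inhabited (fun y : V => forall x, x ∈ y <-> φ x) Hex x).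
Qed.

Lemma in_upair a b x : x ∈ upair a b <-> x = a \/ x = b.
Proof.
apply in_compr with (φ := fun z => z = a \/ z = b).
destruct (ax_pairing a b) as [c Hc]; exists c; intros y Hy; now apply Hc.
Qed.

Lemma opair_inj a b a' b' : opair a b = opair a' b' -> a = a' /\ b = b'.
Proof.
assert (Hmem : forall x u v, x ∈ opair u v <-> x = singleton u \/ x = upair u v).
  intros; apply in_upair.
assert (Hs : forall u v w, singleton u = upair v w -> u = v /\ u = w).
  intros u v w E; split; symmetry.
    assert (H : v ∈ singleton u) by (rewrite E, in_upair; auto).
    now apply in_upair in H; destruct H.
  assert (H : w ∈ singleton u) by (rewrite E, in_upair; auto).
  now apply in_upair in H; destruct H.
intros E.
assert (Ha : a = a').
  assert (H : singleton a ∈ opair a' b') by (rewrite <- E, Hmem; auto).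
  apply Hmem in H; destruct H as [H | H]; now apply Hs in H.
subst a'; split; [reflexivity|].
assert (H1 : upair a b ∈ opair a b') by (rewrite <- E, Hmem; auto).
assert (H2 : upair a b' ∈ opair a b) by (rewrite E, Hmem; auto).
apply Hmem in H1; apply Hmem in H2.
destruct H1 as [H1 | H1].
  symmetry in H1; apply Hs in H1; destruct H1 as [_ <-].
  destruct H2 as [H2 | H2]; symmetry in H2.
    now apply Hs in H2.
  now apply Hs in H2.
assert (H : b ∈ upair a b') by (rewrite <- H1, in_upair; auto).
apply in_upair in H; destruct H as [-> | H]; [|assumption].
symmetry in H1; symmetry.
assert (H : b' ∈ upair a a) by (rewrite <- H1, in_upair; auto).
now apply in_upair in H; destruct H.
Qed.

Lemma child_wf : well_founded child.
Proof.
assert (H : forall τ σ, child τ σ -> Relation_Operators.clos_trans V (@mem V) τ σ).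
  intros τ σ [b Hb].
  apply Relation_Operators.t_trans with (singleton τ).
    apply Relation_Operators.t_step; apply in_upair; auto.
  apply Relation_Operators.t_trans with (opair τ b); apply Relation_Operators.t_step.
    apply in_upair; auto.
  exact Hb.
apply (wf_incl _ _ _ H), wf_clos_trans, mem_wf.
Qed.

(** The elements of a name, as pairs (subname, Boolean value). *)
Definition entry σ : Type := {e : V * V | opair (fst e) (snd e) ∈ σ}.
Definition ename σ (e : entry σ) : V := fst (proj1_sig e).
Definition evalue σ (e : entry σ) : V := snd (proj1_sig e).
Lemma ename_child σ (e : entry σ) : child (ename e) σ.
Proof. exists (evalue e); exact (proj2_sig e). Qed.

(** [[[σ = τ]]] is the meet of
      [⋀_{(ρ,b) ∈ σ} (b ⇒ ⋁_{(ρ',b') ∈ τ} (b' ∧ [[ρ = ρ']]))] and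
      [⋀_{(ρ',b') ∈ τ} (b' ⇒ ⋁_{(ρ,b) ∈ σ} (b ∧ [[ρ = ρ']]))],
    by recursion on [σ]; see [bv_eqE]. *)
Definition bv_eq (P r : V) : V -> V -> V :=
  Fix child_wf (fun _ => V -> V) (fun σ bv_eq_rec τ =>
    inter
      (binf P (fun e : entry σ => bimp P r (evalue e)
         (bsup P r (fun e' : entry τ =>
            inter (evalue e') (bv_eq_rec (ename e) (ename_child e) (ename e'))))))
      (binf P (fun e' : entry τ => bimp P r (evalue e')
         (bsup P r (fun e : entry σ =>
            inter (evalue e) (bv_eq_rec (ename e) (ename_child e) (ename e'))))))).

Definition bv_mem (P r σ τ : V) : V :=
  bsup P r (fun e : entry τ => inter (evalue e) (bv_eq P r σ (ename e))).

(** The canonical name [x̌ = {(y̌, 1) | y ∈ x}]; the unit of [RO P r] is [P]. *)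
Definition check (P : V) : V -> V :=
  Fix mem_wf (fun _ => V) (fun x check_rec =>
    {: z | exists y (h : y ∈ x), z = opair (check_rec y h) P }).

(** The value of "[σ] is in the ground model": [⋁_{x ∈ V} [[σ = x̌]]]. *)
Definition bv_ground (P r σ : V) : V :=
  bsup P r (fun x : V => bv_eq P r σ (check P x)).

(** ** Boolean ultrapower of [V] by an ultrafilter [U] on [RO P r] *)

Definition name (P r : V) : Type := {σ : V | is_name (RO P r) σ}.

Definition bclass (P r : V) (U : V -> Prop) (σ : name P r) : name P r -> Prop :=
  fun τ : name P r => U (bv_eq P r (proj1_sig σ) (proj1_sig τ)).

Definition bultrapower (P r : V) (U : V -> Prop) : Type :=
  {C : name P r -> Prop | exists σ : name P r, C = bclass U σ}.

Definition bultra_class (P r : V) (U : V -> Prop) (σ : name P r) : bultrapower P r U :=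
  exist _ (bclass U σ) (ex_intro _ σ eq_refl).

Definition bultra_mem (P r : V) (U : V -> Prop) (C D : bultrapower P r U) : Prop :=
  exists σ τ : name P r, C = bultra_class U σ /\ D = bultra_class U τ /\
    U (bv_mem P r (proj1_sig σ) (proj1_sig τ)).

Definition bultra_ground (P r : V) (U : V -> Prop) (C : bultrapower P r U) : Prop :=
  exists σ : name P r, C = bultra_class U σ /\ U (bv_ground P r (proj1_sig σ)).

Definition transitive_collapse (X : Type) (E : X -> X -> Prop) (c : X -> V) : Prop :=
  (forall u v : X, c u = c v -> u = v) /\
  (forall u v : X, c u ∈ c v <-> E u v) /\
  transitive_class (fun y => exists u : X, y = c u).

(** ** Generic filters and extensions *)

Definition generic_filter (M : V -> Prop) (P r : V) (g : V -> Prop) : Prop :=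
  (forall p, g p -> p ∈ P) /\
  (exists p, g p) /\
  (forall p q, g p -> q ∈ P -> opair p q ∈ r -> g q) /\
  (forall p q, g p -> g q -> exists t, g t /\ opair t p ∈ r /\ opair t q ∈ r) /\
  (forall D, M D -> D ⊆ P ->
     (forall p, p ∈ P -> exists q, q ∈ D /\ opair q p ∈ r) ->
     exists p, p ∈ D /\ g p).

Definition name_value (G : V -> Prop) : V -> V :=
  Fix child_wf (fun _ => V) (fun σ value_rec =>
    {: y | exists τ b (h : opair τ b ∈ σ),
             G b /\ y = value_rec τ (ex_intro _ b h) }).

Definition generic_extension (M : V -> Prop) (B : V) (G : V -> Prop) : V -> Prop :=
  fun y => exists σ, M σ /\ is_name B σ /\ y = name_value G σ.

(** ** Ultrapowers, direct limits, and the imitation iteration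

    [N] is the transitive collapse of the ultrapower of [M] by [W], formed with
    functions [f ∈ M] on [k], and [e] is the ultrapower embedding. *)
Definition ultrapower (M : V -> Prop) (k W : V) (N : V -> Prop) (e : V -> V) : Prop :=
  transitive_class N /\
  exists cl : V -> V,
    (forall f g, M f -> fun_on f k -> M g -> fun_on g k ->
       (cl f = cl g <-> sep k (fun x => app f x = app g x) ∈ W) /\
       (cl f ∈ cl g <-> sep k (fun x => app f x ∈ app g x) ∈ W)) /\
    (forall y, N y <-> exists f, M f /\ fun_on f k /\ y = cl f) /\
    (forall x, M x -> e x = cl (const_fun k x)).

(** [M δ], with the maps [π i δ], is the transitivized direct limit of the system
    below [δ]. *)
Definition direct_limit (M : V -> V -> Prop) (π : V -> V -> V -> V) (δ : V) : Prop :=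
  transitive_class (M δ) /\
  (forall i k x y, i ∈ δ -> k ∈ δ -> M i x -> M k y ->
     (π i δ x = π k δ y <->
        exists m, m ∈ δ /\ ole i m /\ ole k m /\ π i m x = π k m y) /\
     (π i δ x ∈ π k δ y <->
        exists m, m ∈ δ /\ ole i m /\ ole k m /\ π i m x ∈ π k m y)) /\
  (forall y, M δ y <-> exists i x, i ∈ δ /\ M i x /\ y = π i δ x).

(** The models are the classes [M i], for ordinals [i ≤ αt]; [π i j] is meaningful
    on [M i] for [i ≤ j ≤ αt]. *)
Record imitation_iteration (α κ Us αt : V)
    (M : V -> V -> Prop) (π : V -> V -> V -> V) : Prop := ImitationIteration {
  it_ord : ordinal αt;
  it_zero : forall x, M emptyset x;
  it_id : forall i x, ole i αt -> M i x -> π i i x = x;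
  it_comp : forall i j k x, ole i j -> ole j k -> ole k αt -> M i x ->
    π i k x = π j k (π i j x);
  it_succ : forall i, i ∈ αt -> i ∈ π emptyset i α ->
    ultrapower (M i) (app (π emptyset i κ) i) (app (π emptyset i Us) i)
      (M (succ i)) (π i (succ i));
  it_lim : forall δ, ole δ αt -> limit_ordinal δ -> direct_limit M π δ;
  it_stop : π emptyset αt α = αt;
  it_least : forall i, i ∈ αt -> π emptyset i α <> i
}.

Definition critical_point (κ : V) (π : V -> V -> V -> V) (i : V) : V :=
  app (π emptyset i κ) i.

(** The filter on the forcing [Q] given by a sequence [lam] of length [αt]. *)
Definition sequence_filter (Q αt : V) (lam : V -> V) : V -> Prop := fun p =>
  p ∈ Q /\ exists s T, p = opair s T /\
    (forall i, in_dom s i -> app s i = lam i) /\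
    (forall i, i ∈ αt -> ~ in_dom s i -> lam i ∈ app T i).

(** The filter on the Boolean algebra [B] generated by the image of [g] under [e]. *)
Definition generated_filter (B e : V) (g : V -> Prop) : V -> Prop := fun b =>
  b ∈ B /\ exists p, g p /\ app e p ⊆ b.

(** ** The comprehensions above are sets, and the recursions unfold as intended *)

Lemma small_set a : small (fun x => x ∈ a).
Proof. now exists a. Qed.

Lemma small_sub φ ψ : small ψ -> (forall x, φ x -> ψ x) -> small φ.
Proof. intros [a Ha] H; exists a; auto. Qed.

Lemma small_power φ : small φ -> small (fun y => forall z, z ∈ y -> φ z).
Proof.
intros [a Ha]; destruct (ax_power a) as [p Hp]; exists p; intros y Hy.
apply Hp; auto.
Qed.

Lemma small_image a (h : V -> V) : small (fun y => exists x, x ∈ a /\ y = h x).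
Proof.
destruct (@ax_replacement V (fun x y => y = h x) a) as [b Hb].
  now intros x y y' _ -> ->.
exists b; intros y Hy; now apply Hb.
Qed.

Lemma small_bind φ (Q : V -> V -> Prop) : small φ -> (forall x, φ x -> small (Q x)) ->
  small (fun y => exists x, φ x /\ Q x y).
Proof.
intros [a Ha] H.
destruct (small_image a (fun x => {: y | φ x /\ Q x y })) as [b Hb].
destruct (ax_union b) as [u Hu]; exists u; intros y [x [Hx Hy]]; apply Hu.
exists {: y | φ x /\ Q x y }; split; [apply Hb; exists x; auto|].
apply in_compr with (φ := fun y => φ x /\ Q x y); [|auto].
apply small_sub with (1 := H x Hx); tauto.
Qed.

Lemma small_eq a : small (fun x => x = a).
Proof. exists (upair a a); intros x ->; apply in_upair; auto. Qed.

Lemma small_pairs φ ψ : small φ -> small ψ ->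
  small (fun z => exists x y, z = opair x y /\ φ x /\ ψ y).
Proof.
intros Hφ Hψ.
apply small_sub with (ψ := fun z => exists x, φ x /\ exists y, ψ y /\ z = opair x y).
  apply small_bind; [assumption|]; intros x _.
  apply small_bind; [assumption|]; intros y _; apply small_eq.
intros z (x & y & H); exists x; split; [tauto|]; exists y; tauto.
Qed.

Lemma in_sep a φ x : x ∈ sep a φ <-> x ∈ a /\ φ x.
Proof.
apply in_compr with (φ := fun z => z ∈ a /\ φ z).
apply small_sub with (1 := small_set a); tauto.
Qed.

Lemma in_inter a b x : x ∈ inter a b <-> x ∈ a /\ x ∈ b.
Proof.
apply in_compr with (φ := fun z => z ∈ a /\ z ∈ b).
apply small_sub with (1 := small_set a); tauto.
Qed.

Lemma in_setminus a b x : x ∈ setminus a b <-> x ∈ a /\ x ∉ b.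
Proof.
apply in_compr with (φ := fun z => z ∈ a /\ z ∉ b).
apply small_sub with (1 := small_set a); tauto.
Qed.

Lemma in_emptyset x : x ∉ emptyset.
Proof.
unfold emptyset; rewrite in_compr; [tauto|].
exists x; tauto.
Qed.

Lemma in_succ a x : x ∈ succ a <-> x ∈ a \/ x = a.
Proof.
apply in_compr with (φ := fun z => z ∈ a \/ z = a).
destruct (ax_union (upair a (singleton a))) as [u Hu]; exists u; intros y Hy.
apply Hu; destruct Hy as [Hy | ->].
  exists a; rewrite in_upair; auto.
exists (singleton a); unfold singleton; rewrite !in_upair; auto.
Qed.

Lemma in_const_fun a x z : z ∈ const_fun a x <-> exists u, u ∈ a /\ z = opair u x.
Proof.
apply in_compr with (φ := fun z => exists u, u ∈ a /\ z = opair u x).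
apply small_image with (h := fun u => opair u x).
Qed.

Lemma in_omega x : x ∈ omega <-> exists n, x = numeral n.
Proof.
apply in_compr with (φ := fun x => exists n, x = numeral n).
destruct (ax_infinity V) as [w [[e [He He0]] Hw]]; exists w.
intros y [n ->]; induction n as [|n IHn]; simpl.
  replace emptyset with e; [assumption|].
  apply ax_extensionality; intros z; split; intros Hz.
    now destruct (He0 z).
  now destruct (in_emptyset Hz).
destruct (Hw _ IHn) as [y [Hy Hyn]].
replace (succ (numeral n)) with y; [assumption|].
apply ax_extensionality; intros z; rewrite Hyn, in_succ; tauto.
Qed.

Lemma appE f x y : is_function f -> opair x y ∈ f -> app f x = y.
Proof.
intros [_ Hf] Hxy; apply (Hf x); [|assumption].
apply (epsilon_spec V_inhabited (fun y => opair x y ∈ f)); now exists y.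
Qed.

Lemma in_prikry α κ Us p : p ∈ prikry α κ Us <-> prikry_condition α κ Us p.
Proof.
apply in_compr with (φ := prikry_condition α κ Us).
pose (pair_in := fun (Q : V -> V -> Prop) z =>
  exists i, i ∈ α /\ exists y, Q i y /\ z = opair i y).
assert (Hpair : forall Q : V -> V -> Prop, (forall i, small (Q i)) -> small (pair_in Q)).
  intros Q HQ; apply small_bind; [apply small_set|]; intros i _.
  apply small_bind; [apply HQ|]; intros y _; apply small_eq.
apply small_sub with (ψ := fun p => exists s T, p = opair s T /\
    (forall z, z ∈ s -> pair_in (fun i y => y ∈ app κ i) z) /\
    (forall z, z ∈ T -> pair_in (fun i y => y ∈ app Us i) z)).
  apply small_pairs; apply small_power, Hpair; intros i; apply small_set.
intros q (s & T & -> & Hs & _ & Hsi & HT & HTd & HTi).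
exists s, T; split; [reflexivity|]; split; intros z Hz.
  destruct (proj1 Hs z Hz) as (i & y & ->).
  assert (Hi : in_dom s i) by now exists y.
  exists i; split; [now apply Hsi|]; exists y; split; [|reflexivity].
  rewrite <- (appE Hs Hz); now apply Hsi.
destruct (proj1 HT z Hz) as (i & y & ->).
assert (Hi : in_dom T i) by now exists y.
exists i; split; [now apply HTd|]; exists y; split; [|reflexivity].
rewrite <- (appE HT Hz); now apply HTi.
Qed.

Lemma in_prikry_order α κ Us p' p : opair p' p ∈ prikry_order α κ Us <->
  p' ∈ prikry α κ Us /\ p ∈ prikry α κ Us /\ prikry_le p' p.
Proof.
unfold prikry_order; rewrite in_compr.
  split; [|now intros H; exists p', p].
  intros (q' & q & E & H); now apply opair_inj in E; destruct E as [-> ->].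
apply small_sub with (ψ := fun z => exists p' p, z = opair p' p /\
  p' ∈ prikry α κ Us /\ p ∈ prikry α κ Us).
  apply small_pairs; apply small_set.
intros z (q' & q & H); exists q', q; tauto.
Qed.

Lemma in_RO P r b : b ∈ RO P r <-> b ⊆ P /\ reg P r (fun p => p ∈ b) = b.
Proof.
apply in_compr with (φ := fun b => b ⊆ P /\ reg P r (fun p => p ∈ b) = b).
apply small_sub with (ψ := fun b => b ⊆ P); [|tauto].
apply small_power, small_set.
Qed.

Lemma in_RO_embedding P r p b : opair p b ∈ RO_embedding P r <->
  p ∈ P /\ b = reg P r (fun q => opair q p ∈ r).
Proof.
unfold RO_embedding; rewrite in_compr.
  split; [|now intros [Hp ->]; exists p].
  intros (q & Hq & E); now apply opair_inj in E; destruct E as [-> ->].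
apply small_image with (h := fun p => opair p (reg P r (fun q => opair q p ∈ r))).
Qed.

Lemma bv_eq_unfold P r σ τ : bv_eq P r σ τ =
  inter
    (binf P (fun e : entry σ => bimp P r (evalue e)
       (bsup P r (fun e' : entry τ =>
          inter (evalue e') (bv_eq P r (ename e) (ename e'))))))
    (binf P (fun e' : entry τ => bimp P r (evalue e')
       (bsup P r (fun e : entry σ =>
          inter (evalue e) (bv_eq P r (ename e) (ename e')))))).
Proof.
unfold bv_eq at 1; rewrite Fix_eq; [reflexivity|].
intros x f g H; replace g with f; [reflexivity|].
extensionality y; extensionality h; apply H.
Qed.

Lemma interC a b : inter a b = inter b a.
Proof. apply ax_extensionality; intros z; rewrite !in_inter; tauto. Qed.

Lemma bv_eqC P r σ τ : bv_eq P r σ τ = bv_eq P r τ σ.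
Proof.
revert τ; induction σ as [σ IH] using (well_founded_induction child_wf); intros τ.
rewrite (bv_eq_unfold P r σ τ), (bv_eq_unfold P r τ σ), interC.
f_equal; f_equal; extensionality e; do 2 f_equal; extensionality e'; f_equal;
  apply IH; apply ename_child.
Qed.

Lemma bv_eqE P r σ τ : bv_eq P r σ τ =
  inter
    (binf P (fun e : entry σ => bimp P r (evalue e) (bv_mem P r (ename e) τ)))
    (binf P (fun e : entry τ => bimp P r (evalue e) (bv_mem P r (ename e) σ))).
Proof.
rewrite bv_eq_unfold; unfold bv_mem; do 2 f_equal.
extensionality e; do 2 f_equal; extensionality e'; f_equal; apply bv_eqC.
Qed.

Lemma in_check P x z : z ∈ check P x <-> exists y, y ∈ x /\ z = opair (check P y) P.
Proof.
unfold check at 1; rewrite Fix_eq.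
  rewrite in_compr.
    split; [intros (y & h & ->) | intros (y & h & ->)]; exists y; eauto.
  apply small_sub with (1 := small_image x (fun y => opair (check P y) P)).
  intros u (y & h & ->); now exists y.
intros u f g H; replace g with f; [reflexivity|].
extensionality y; extensionality h; apply H.
Qed.

Lemma in_name_value (G : V -> Prop) σ y : y ∈ name_value G σ <->
  exists τ b, opair τ b ∈ σ /\ G b /\ y = name_value G τ.
Proof.
unfold name_value at 1; rewrite Fix_eq.
  rewrite in_compr.
    split; [intros (τ & b & h & H) | intros (τ & b & h & H)]; exists τ, b; eauto.
  apply small_sub with (ψ := fun y => exists z, z ∈ σ /\
    exists τ b, z = opair τ b /\ y = name_value G τ).
    apply small_bind; [apply small_set|]; intros z _.
    destruct (classic (exists τ b, z = opair τ b)) as [(τ & b & ->) | H].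
      exists (singleton (name_value G τ)); intros u (τ' & b' & E & ->).
      apply opair_inj in E; destruct E as [<- _]; apply in_upair; auto.
    exists z; intros u (τ & b & E & _); destruct H; eauto.
  intros u (τ & b & h & _ & ->); exists (opair τ b); split; [exact h|]; eauto.
intros u f g H; replace g with f; [reflexivity|].
extensionality τ; extensionality h; apply H.
Qed.

End Basics.

(* Main.v *)
(** All the embeddings of the iteration are elementary for bounded formulas as
    maps into [V], and cofinal, by the theorem of Łoś at successors and directly at
    limits; so the [M i] satisfy every [Π2] statement true in [V], which is all of
    their first-order theory that is needed.  Since [λ_i] is fixed by the later
    embeddings and [i < λ_i] by discreteness, every element of the last model [N] is,
    by induction along the iteration, of the form [j(h)(p)] with [p] in the generic
    filter [g] and [h ∈ V] a function on an open dense set of conditions, constant on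
    compatible conditions.  For a name [σ ∈ V] the class of [σ] is mapped to the value
    of the name [j(σ)] under [G]: by the truth lemma for [G] this is a well defined
    embedding, and it is onto [N[G]], because a name [j(h)(p)] in [N] has the same
    value as [j(σ)] for the name [σ] obtained by mixing the values of [h]. *)

From Stdlib Require Import Classical ClassicalEpsilon FunctionalExtensionality
  PropExtensionality List Lia ssreflect.
Require Import Defs.

Set Implicit Arguments.
Unset Strict Implicit.
Unset Printing Implicit Defensive.

(** * Set-theoretic operations *)

(** The models [M i] are proper classes, so their truth would have to be relativized formula by
    formula. Bounded formulas avoid this: for parameters in a transitive class they mean the same
    there as in [V], so one satisfaction relation [sat], evaluated in [V], serves all stages. The
    price is that everything moved along an embedding must be bounded. Application and projections
    are therefore replaced by total operations with bounded values ([appd], [fst], [snd]), and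
    recursive notions by sets witnessing them: a set function satisfying the recursion on a
    transitive set stands for [bv_eq] or [check], and a closed set of names for [is_name]. The
    existence of such witnesses, or of Skolem functions, is beyond bounded formulas; cofinality of
    the embeddings is what provides it inside each model. Capturing replaces the usual normal form,
    a function applied to finitely many critical points: one condition of the filter already carries
    these points in its stem, so no finite sequences have to be managed. *)

Section Operations.
Context {V : zfc_universe}.
Implicit Types (a b c f p x y z : V) (φ : V -> Prop).

Lemma set_ext a b : (forall z, z ∈ a <-> z ∈ b) -> a = b.
Proof. exact: ax_extensionality. Qed.

Definition Un a : V := {: z | exists y, y ∈ a /\ z ∈ y }.
Definition img a (h : V -> V) : V := {: z | exists x, x ∈ a /\ z = h x }.
Definition mkfun a (h : V -> V) : V := img a (fun x => opair x (h x)).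

(** The union of a union contains both coordinates of every pair in [f]. *)
Definition field f : V := Un (Un f).

(** The total operations [appd], [fst], [snd] have values bounded by their
    argument, which [app] has not. *)
Definition appd f x : V :=
  Un (sep (field f) (fun y => opair x y ∈ f)).
Definition fst p : V := Un (sep (Un p) (fun x => exists y, y ∈ Un p /\ p = opair x y)).
Definition snd p : V := Un (sep (Un p) (fun y => exists x, x ∈ Un p /\ p = opair x y)).

Lemma in_Un a z : z ∈ Un a <-> exists y, y ∈ a /\ z ∈ y.
Proof.
apply: in_compr; case: (ax_union a) => u Hu; exists u => x Hx.
by apply/Hu.
Qed.

Lemma in_img a h z : z ∈ img a h <-> exists x, x ∈ a /\ z = h x.
Proof. exact/in_compr/small_image. Qed.

Lemma in_opair a b x : x ∈ opair a b <-> x = singleton a \/ x = upair a b.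
Proof. exact: in_upair. Qed.

Lemma in_singleton a x : x ∈ singleton a <-> x = a.
Proof. rewrite /singleton in_upair; tauto. Qed.

Lemma Un_opair_l a b : a ∈ Un (opair a b).
Proof.
rewrite in_Un; exists (singleton a); rewrite in_opair in_singleton; auto.
Qed.

Lemma Un_opair_r a b : b ∈ Un (opair a b).
Proof. rewrite in_Un; exists (upair a b); rewrite in_opair in_upair; auto. Qed.

Lemma field_l f x y : opair x y ∈ f -> x ∈ field f.
Proof.
move=> H; rewrite in_Un; exists (singleton x); rewrite in_singleton.
by split=> //; rewrite in_Un; exists (opair x y); rewrite in_opair; auto.
Qed.

Lemma field_r f x y : opair x y ∈ f -> y ∈ field f.
Proof.
move=> H; rewrite in_Un; exists (upair x y); rewrite in_upair.
by split; auto; rewrite in_Un; exists (opair x y); rewrite in_opair; auto.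
Qed.

Lemma Un_singleton a : Un (singleton a) = a.
Proof.
apply: set_ext => z; rewrite in_Un; split.
  by move=> [y []]; rewrite in_singleton => ->.
by move=> Hz; exists a; rewrite in_singleton.
Qed.

Lemma fst_opair a b : fst (opair a b) = a.
Proof.
rewrite -[RHS]Un_singleton; congr Un; apply: set_ext => z.
rewrite in_sep in_singleton; split.
  by move=> [_ [y [_ /opair_inj[]]]].
move=> ->; split; first exact: Un_opair_l.
by exists b; split=> //; exact: Un_opair_r.
Qed.

Lemma snd_opair a b : snd (opair a b) = b.
Proof.
rewrite -[RHS]Un_singleton; congr Un; apply: set_ext => z.
rewrite in_sep in_singleton; split.
  by move=> [_ [y [_ /opair_inj[]]]].
move=> ->; split; first exact: Un_opair_r.
by exists a; split=> //; exact: Un_opair_l.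
Qed.

Lemma appd_eq f x y : (forall y', opair x y' ∈ f -> y' = y) -> opair x y ∈ f ->
  appd f x = y.
Proof.
move=> Hf H; rewrite -[RHS]Un_singleton; congr Un; apply: set_ext => z.
rewrite in_sep in_singleton; split; first by move=> [_ /Hf].
by move=> ->; split=> //; exact: field_r H.
Qed.

Lemma appd_fun f x y : is_function f -> opair x y ∈ f -> appd f x = y.
Proof. by move=> [_ Hf] H; apply: appd_eq => // y' H'; exact: Hf H' H. Qed.

Lemma app_appd f x : is_function f -> in_dom f x -> app f x = appd f x.
Proof.
by move=> Hf [y Hy]; rewrite (appE Hf Hy) (appd_fun Hf Hy).
Qed.

Lemma in_dom_app f x : is_function f -> in_dom f x -> opair x (app f x) ∈ f.
Proof. by move=> Hf [y Hy]; rewrite (appE Hf Hy). Qed.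

Lemma fun_on_app a f x : fun_on f a -> x ∈ a -> app f x = appd f x.
Proof. by move=> [Hf Hd] /Hd; exact: app_appd. Qed.

Lemma fun_on_opair a f x : fun_on f a -> x ∈ a -> opair x (appd f x) ∈ f.
Proof.
move=> H Hx; rewrite -(fun_on_app H Hx); case: H => Hf Hd.
by apply: in_dom_app => //; apply/Hd.
Qed.

Lemma in_mkfun a h x y : opair x y ∈ mkfun a h <-> x ∈ a /\ y = h x.
Proof.
rewrite in_img; split; first by move=> [u [Hu /opair_inj [-> ->]]].
by move=> [Hx ->]; exists x.
Qed.

Lemma mkfun_on a h : fun_on (mkfun a h) a.
Proof.
split; last first.
  by move=> x; split=> [[y /in_mkfun[]]//|Hx]; exists (h x); apply/in_mkfun.
split=> [z /in_img [x [_ ->]]|x y y' /in_mkfun [_ ->] /in_mkfun [_ ->] //].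
by exists x, (h x).
Qed.

Lemma mkfunE a h x : x ∈ a -> appd (mkfun a h) x = h x.
Proof. by move=> Hx; apply: (appd_fun (proj1 (mkfun_on a h))); apply/in_mkfun. Qed.

Lemma const_funE a x : const_fun a x = mkfun a (fun _ => x).
Proof. by []. Qed.

Lemma sep_ext a φ (ψ : V -> Prop) : (forall x, x ∈ a -> (φ x <-> ψ x)) -> sep a φ = sep a ψ.
Proof.
move=> H; apply: set_ext => z; rewrite !in_sep.
by split=> -[Hz]; move: (H z Hz); tauto.
Qed.

Lemma mem_irrefl x : x ∉ x.
Proof. by elim/(well_founded_induction (mem_wf (V := V))): x => x IH H; exact: (IH x H H). Qed.

Lemma mem_asym x y : x ∈ y -> y ∉ x.
Proof.
elim/(well_founded_induction (mem_wf (V := V))): x y => x IH y H1 H2; exact: (IH y H2 x H2 H1).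
Qed.

Lemma compr_exists φ : small φ -> exists a, forall x, x ∈ a <-> φ x.
Proof. by move=> H; exists {: x | φ x } => x; exact: in_compr. Qed.

(** Collection: the set is the image of [a] under an epsilon-choice of witnesses. *)
Lemma small_choice a (R : V -> V -> Prop) : (forall x, x ∈ a -> exists y, R x y) ->
  exists b, forall x, x ∈ a -> exists y, y ∈ b /\ R x y.
Proof.
move=> H.
pose h x := epsilon V_inhabited (fun y => x ∈ a -> R x y).
have Hh x : x ∈ a -> R x (h x).
  move=> Hx; apply: (epsilon_spec V_inhabited (fun y => x ∈ a -> R x y)) => //.
  by case: (H x Hx) => y ?; exists y.
by exists (img a h) => x Hx; exists (h x); split; [apply/in_img; exists x|exact: Hh].
Qed.

Lemma pair_cover a b : exists c, a ⊆ c /\ b ⊆ c.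
Proof.
exists (Un (upair a b)).
by split=> z Hz; rewrite in_Un; (exists a + exists b); rewrite in_upair; auto.
Qed.

(** By ∈-induction: [a] together with the union of transitive covers of its elements, which are
    collected by [small_choice]. *)
Lemma transitive_cover a : exists t, a ⊆ t /\ transitive_class (fun x => x ∈ t).
Proof.
elim/(well_founded_induction (mem_wf (V := V))): a => a IH.
have [b Hb] := small_choice IH.
have [c Hc] : exists c, forall x, x ∈ c <-> x ∈ a \/ exists t, t ∈ b /\
  transitive_class (fun x => x ∈ t) /\ x ∈ t.
  apply: compr_exists; have [c [H1 H2]] := pair_cover a (Un b).
  exists c => x [/H1//|[t [Ht [_ Hx]]]]; apply/H2/in_Un; by exists t.
exists c; split=> [x Hx|x y]; first by apply/Hc; left.
rewrite !Hc => -[Hx|[t [Ht [Htr Hx]]]] Hy.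
  have [t [Ht [H1 H2]]] := Hb x Hx.
  by right; exists t; do !split=> //; exact: H1.
by right; exists t; do !split=> //; exact: Htr Hx Hy.
Qed.

Lemma transitive_opair t x y z : transitive_class (fun x => x ∈ t) ->
  z ∈ t -> opair x y ∈ z -> x ∈ t /\ y ∈ t.
Proof.
move=> Ht Hz H.
have Hp := Ht _ _ Hz H.
have H1 : upair x y ∈ t by apply: (Ht _ _ Hp); rewrite in_opair; auto.
by split; apply: (Ht _ _ H1); rewrite in_upair; auto.
Qed.

End Operations.

(** * Bounded formulas *)

Section Bounded.
Context {V : zfc_universe}.
Implicit Types (a b c f p x y z : V).

(** Variables are de Bruijn indices and membership is the only atom; equality becomes two bounded
    inclusions by extensionality, see [D0_eq]. *)
Inductive formula : Type :=
  | FMem (i j : nat)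
  | FNot (φ : formula)
  | FAnd (φ ψ : formula)
  | FAll (i : nat) (φ : formula).

Definition env := nat -> V.

Definition push x (e : env) : env :=
  fun n => match n with O => x | S m => e m end.

Local Notation "x .: e" := (push x e) (at level 60, right associativity).

Fixpoint sat (φ : formula) (e : env) : Prop :=
  match φ with
  | FMem i j => e i ∈ e j
  | FNot φ => ~ sat φ e
  | FAnd φ ψ => sat φ e /\ sat ψ e
  | FAll i φ => forall z, z ∈ e i -> sat φ (z .: e)
  end.

Definition lift (ρ : nat -> nat) (n : nat) : nat :=
  match n with O => O | S m => S (ρ m) end.

Fixpoint rename (ρ : nat -> nat) (φ : formula) : formula :=
  match φ with
  | FMem i j => FMem (ρ i) (ρ j)
  | FNot φ => FNot (rename ρ φ)
  | FAnd φ ψ => FAnd (rename ρ φ) (rename ρ ψ)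
  | FAll i φ => FAll (ρ i) (rename (lift ρ) φ)
  end.

Lemma sat_rename φ : forall ρ e, sat (rename ρ φ) e <-> sat φ (fun n => e (ρ n)).
Proof.
elim: φ => [i j|φ IH|φ IH1 ψ IH2|i φ IH] ρ e //=.
- by rewrite IH.
- by rewrite IH1 IH2.
- have E z : (fun n => (z .: e) (lift ρ n)) = z .: (fun n => e (ρ n)).
    by extensionality n; case: n.
  by split=> H z /H; rewrite IH E.
Qed.

(** Environments are infinite sequences; this finiteness is what allows the relevant parameters to
    be covered by a single set in [inner_model_of_embedding]. *)
Lemma sat_support φ : exists n, forall e e', (forall m, m < n -> e m = e' m) ->
  (sat φ e <-> sat φ e').
Proof.
elim: φ => [i j|φ [n IH]|φ [n IH1] ψ [m IH2]|i φ [n IH]].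
- exists (S i + S j) => e e' H /=; rewrite !H //; lia.
- by exists n => e e' H /=; rewrite (IH _ e').
- exists (n + m) => e e' H /=; rewrite (IH1 e e') ?(IH2 e e') // => k Hk; apply: H; lia.
- exists (S (i + n)) => e e' H /=; have -> : e i = e' i by apply: H; lia.
  have E z : sat φ (z .: e) <-> sat φ (z .: e').
    apply: IH => -[|m] //= Hm; apply: H; lia.
  by split=> Hz z /Hz /E.
Qed.

(** Closed under equivalence in [V] by definition, so a predicate written with unbounded quantifiers
    counts as soon as they can be bounded. *)
Definition Delta0 (Q : env -> Prop) : Prop := exists φ, forall e, Q e <-> sat φ e.

(** A term is simple when it may be substituted for a variable in a bounded
    formula: membership in it, and quantification over it, are bounded. *)
Definition simple (t : env -> V) : Prop :=
  (forall ρ, Delta0 (fun e => e 0 ∈ t (fun n => e (ρ n)))) /\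
  (forall ρ Q, Delta0 Q ->
     Delta0 (fun e => forall z, z ∈ t (fun n => e (ρ n)) -> Q (z .: e))).

Lemma D0_ext Q Q' : (forall e, Q e <-> Q' e) -> Delta0 Q' -> Delta0 Q.
Proof. by move=> H [φ Hφ]; exists φ => e; rewrite H. Qed.

Lemma D0_not Q : Delta0 Q -> Delta0 (fun e => ~ Q e).
Proof. by move=> [φ H]; exists (FNot φ) => e /=; rewrite H. Qed.

Lemma D0_and Q Q' : Delta0 Q -> Delta0 Q' -> Delta0 (fun e => Q e /\ Q' e).
Proof. by move=> [φ H] [ψ H']; exists (FAnd φ ψ) => e /=; rewrite H H'. Qed.

Lemma D0_or Q Q' : Delta0 Q -> Delta0 Q' -> Delta0 (fun e => Q e \/ Q' e).
Proof.
move=> H H'; apply: (@D0_ext _ (fun e => ~ (~ Q e /\ ~ Q' e))); first by move=> e; tauto.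
by apply/D0_not/D0_and; exact: D0_not.
Qed.

Lemma D0_imp Q Q' : Delta0 Q -> Delta0 Q' -> Delta0 (fun e => Q e -> Q' e).
Proof.
move=> H H'; apply: (@D0_ext _ (fun e => ~ (Q e /\ ~ Q' e))); first by move=> e; tauto.
by apply/D0_not/D0_and => //; exact: D0_not.
Qed.

Lemma D0_iff Q Q' : Delta0 Q -> Delta0 Q' -> Delta0 (fun e => Q e <-> Q' e).
Proof. by move=> H H'; apply: D0_and; apply: D0_imp. Qed.

Lemma D0_rename Q ρ : Delta0 Q -> Delta0 (fun e => Q (fun n => e (ρ n))).
Proof. by move=> [φ H]; exists (rename ρ φ) => e; rewrite sat_rename H. Qed.

Lemma simple_var n : simple (fun e => e n).
Proof.
split=> [ρ|ρ Q [φ H]]; first by exists (FMem 0 (ρ n)).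
by exists (FAll (ρ n) φ) => e /=; split=> Hz z /Hz /H.
Qed.

Lemma simple_rename t ρ : simple t -> simple (fun e => t (fun n => e (ρ n))).
Proof. by move=> [H1 H2]; split=> [ρ'|ρ' Q HQ]; [exact: H1|exact: H2]. Qed.

Lemma simple_up t : simple t -> simple (fun e => t (fun n => e (S n))).
Proof. exact: simple_rename. Qed.

Lemma D0_all t (Q : V -> env -> Prop) : simple t ->
  Delta0 (fun e => Q (e 0) (fun n => e (S n))) ->
  Delta0 (fun e => forall z, z ∈ t e -> Q z e).
Proof. by move=> [_ Ht] HQ; exact: (Ht (fun n => n) _ HQ). Qed.

Lemma D0_ex t (Q : V -> env -> Prop) : simple t ->
  Delta0 (fun e => Q (e 0) (fun n => e (S n))) ->
  Delta0 (fun e => exists z, z ∈ t e /\ Q z e).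
Proof.
move=> Ht HQ; apply: (@D0_ext _ (fun e => ~ forall z, z ∈ t e -> ~ Q z e)).
  move=> e; split; first by move=> [z [Hz H]] H'; exact: H' H.
  by move=> H; apply: NNPP => H'; apply: H => z Hz Hq; apply: H'; exists z.
by apply/D0_not/D0_all => //; exact: D0_not.
Qed.

Lemma D0_mem_var n u : simple u -> Delta0 (fun e => e n ∈ u e).
Proof.
move=> [H _]; have := D0_rename (fun k => match k with O => n | S m => m end)
  (H S).
exact.
Qed.

Lemma D0_subset t u : simple t -> simple u -> Delta0 (fun e => t e ⊆ u e).
Proof. by move=> Ht Hu; apply: D0_all => //; apply: D0_mem_var; exact: simple_up. Qed.

Lemma D0_eq t u : simple t -> simple u -> Delta0 (fun e => t e = u e).
Proof.
move=> Ht Hu; apply: (@D0_ext _ (fun e => t e ⊆ u e /\ u e ⊆ t e)).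
  move=> e; split; first by move=> ->; split=> z.
  by move=> [H1 H2]; apply: set_ext => z; split; [exact: H1|exact: H2].
by apply: D0_and; apply: D0_subset.
Qed.

Lemma D0_mem t u : simple t -> simple u -> Delta0 (fun e => t e ∈ u e).
Proof.
move=> Ht Hu; apply: (@D0_ext _ (fun e => exists z, z ∈ u e /\ z = t e)).
  by move=> e; split; [move=> H; exists (t e)|move=> [z [H <-]]].
by apply: D0_ex => //; apply: D0_eq; [exact: simple_var|exact: simple_up].
Qed.

(** Induction on the formula. Substituting into the range of a quantifier gives quantification over
    the members of a term, which is what the second clause of [simple] permits. *)
Lemma D0_subst Q (τ : nat -> env -> V) : Delta0 Q -> (forall n, simple (τ n)) ->
  Delta0 (fun e => Q (fun n => τ n e)).
Proof.
move=> [φ H] Hτ; apply: D0_ext (fun e => H _) _ => {Q H}.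
elim: φ τ Hτ => [i j|φ IH|φ IH1 ψ IH2|i φ IH] τ Hτ /=.
- exact: D0_mem.
- exact/D0_not/IH.
- by apply: D0_and; [exact: IH1|exact: IH2].
- apply: D0_all => //.
  pose τ' n : env -> V := match n with O => fun e => e 0
    | S m => fun e => τ m (fun n => e (S n)) end.
  apply: (@D0_ext _ (fun e => sat φ (fun n => τ' n e))); last first.
    by apply: IH => -[|n]; [exact: simple_var|exact: simple_up].
  move=> e; suff -> : (fun n => τ' n e) =
    (e 0 .: fun n => τ n (fun n => e (S n))) by [].
  by extensionality n; case: n.
Qed.

Lemma D0_subst1 Q t ρ : Delta0 Q -> simple t ->
  Delta0 (fun e => Q (t e .: fun n => e (ρ n))).
Proof.
move=> HQ Ht.
pose τ n : env -> V := match n with O => t | S m => fun e => e (ρ m) end.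
apply: (@D0_ext _ (fun e => Q (fun n => τ n e))); last first.
  by apply: D0_subst => // -[|n] //; exact: simple_var.
move=> e; suff -> : (fun n => τ n e) = (t e .: fun n => e (ρ n)) by [].
by extensionality n; case: n.
Qed.

Lemma simple_emptyset : simple (fun _ => emptyset).
Proof.
have [φ Hφ] : Delta0 (fun _ => False).
  apply: (@D0_ext _ (fun e => e 0 ∈ e 0)); first by move=> e; split=> // /mem_irrefl.
  by apply: D0_mem; exact: simple_var.
split=> [ρ|ρ Q HQ]; first by exists φ => e; rewrite -Hφ; split=> // /in_emptyset.
by exists (FNot φ) => e /=; rewrite -Hφ; split; [move=> _ []|move=> _ z /in_emptyset].
Qed.

Lemma simple_upair t u : simple t -> simple u -> simple (fun e => upair (t e) (u e)).
Proof.
move=> Ht Hu; split=> [ρ|ρ Q HQ].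
  apply: D0_ext (fun e => in_upair _ _ _) _.
  by apply: D0_or; apply: D0_eq; (exact: simple_var || exact: simple_rename).
apply: (@D0_ext _ (fun e => Q (t (fun n => e (ρ n)) .: e) /\ Q (u (fun n => e (ρ n)) .: e))).
  move=> e; split; first by move=> H; split; apply: H; rewrite in_upair; auto.
  by move=> [H1 H2] z; rewrite in_upair => -[->|->].
by apply: D0_and; apply: (D0_subst1 (fun n => n)) => //; exact: simple_rename.
Qed.

Lemma simple_singleton t : simple t -> simple (fun e => singleton (t e)).
Proof. by move=> H; exact: simple_upair. Qed.

Lemma simple_opair t u : simple t -> simple u -> simple (fun e => opair (t e) (u e)).
Proof. by move=> Ht Hu; do !apply: simple_upair. Qed.

Lemma simple_Un t : simple t -> simple (fun e => Un (t e)).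
Proof.
move=> Ht; split=> [ρ|ρ Q HQ].
  apply: D0_ext (fun e => in_Un _ _) _.
  apply: D0_ex; first exact: simple_rename.
  by apply: D0_mem; exact: simple_var.
apply: (@D0_ext _ (fun e => forall y, y ∈ t (fun n => e (ρ n)) -> forall z, z ∈ y -> Q (z .: e))).
  move=> e; split; first by move=> H y Hy z Hz; apply: H; apply/in_Un; exists y.
  by move=> H z /in_Un [y [Hy Hz]]; exact: H Hz.
apply: D0_all; first exact: simple_rename.
apply: D0_all; first exact: simple_var.
have := D0_rename (fun n => match n with O => 0 | S m => S (S m) end) HQ.
apply: D0_ext => e.
suff -> : (fun n => e (match n with 0 => 0 | S m => S (S m) end)) =
  (e 0 .: fun n => e (S (S n))) by [].
by extensionality n; case: n.
Qed.

Lemma simple_sep t (Q : V -> env -> Prop) : simple t ->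
  Delta0 (fun e => Q (e 0) (fun n => e (S n))) ->
  simple (fun e => sep (t e) (fun x => Q x e)).
Proof.
move=> Ht HQ.
have HQ' ρ : Delta0 (fun e => Q (e 0) (fun n => e (S (ρ n)))).
  exact: (D0_rename (fun n => match n with O => 0 | S m => S (ρ m) end) HQ).
split=> [ρ|ρ R HR].
  apply: D0_ext (fun e => in_sep _ _ _) _.
  apply: D0_and; first by apply: D0_mem; [exact: simple_var|exact: simple_rename].
  exact: (D0_rename (fun n => match n with O => 0 | S m => ρ m end) HQ).
apply: (@D0_ext _ (fun e => forall z, z ∈ t (fun n => e (ρ n)) ->
  Q z (fun n => e (ρ n)) -> R (z .: e))).
  move=> e; split; first by move=> H z Hz Hq; apply: H; apply/in_sep.
  by move=> H z /in_sep [Hz Hq]; exact: H Hq.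
apply: D0_all; first exact: simple_rename.
apply: D0_imp => //.
apply: D0_ext HR => e.
suff -> : (e 0 .: fun n => e (S n)) = e by [].
by extensionality n; case: n.
Qed.

Lemma simple_img t (u : V -> env -> V) : simple t ->
  simple (fun e => u (e 0) (fun n => e (S n))) ->
  simple (fun e => img (t e) (fun x => u x e)).
Proof.
move=> Ht Hu.
have Hu' ρ : simple (fun e => u (e 0) (fun n => e (S (ρ n)))).
  exact: (simple_rename (fun n => match n with O => 0 | S m => S (ρ m) end) Hu).
split=> [ρ|ρ Q HQ].
  apply: D0_ext (fun e => in_img _ _ _) _.
  apply: D0_ex; first exact: simple_rename.
  apply: D0_eq; first exact: simple_var.
  exact: Hu'.
apply: (@D0_ext _ (fun e => forall z, z ∈ t (fun n => e (ρ n)) ->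
  Q (u z (fun n => e (ρ n)) .: e))).
  move=> e; split; first by move=> H z Hz; apply: H; apply/in_img; exists z.
  by move=> H z /in_img [x [Hx ->]]; exact: H.
apply: D0_all; first exact: simple_rename.
apply: (D0_subst1 (fun n => S n)) => //; exact: Hu'.
Qed.

(** Both coordinates of a pair in [t e] lie in [field (t e)], which bounds the two quantifiers. *)
Lemma D0_all_pair t (Q : V -> V -> env -> Prop) : simple t ->
  Delta0 (fun e => Q (e 1) (e 0) (fun n => e (S (S n)))) ->
  Delta0 (fun e => forall x y, opair x y ∈ t e -> Q x y e).
Proof.
move=> Ht HQ; apply: (@D0_ext _ (fun e => forall x, x ∈ field (t e) ->
  forall y, y ∈ field (t e) -> opair x y ∈ t e -> Q x y e)).
  move=> e; split=> H x; first by move=> _ y _; exact: H.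
  by move=> y Hxy; apply: (H x _ y) => //; [exact: field_l Hxy|exact: field_r Hxy].
have Hf : simple (fun e => field (t e)) by do 2!apply: simple_Un.
apply: D0_all => //; apply: D0_all; first exact: (simple_up Hf).
apply: D0_imp => //; apply: D0_mem; last exact: (simple_rename (fun n => S (S n)) Ht).
by apply: simple_opair; exact: simple_var.
Qed.

Lemma D0_ex_pair t (Q : V -> V -> env -> Prop) : simple t ->
  Delta0 (fun e => Q (e 1) (e 0) (fun n => e (S (S n)))) ->
  Delta0 (fun e => exists x y, opair x y ∈ t e /\ Q x y e).
Proof.
move=> Ht HQ; apply: (@D0_ext _ (fun e => ~ forall x y, opair x y ∈ t e -> ~ Q x y e)).
  move=> e; split; first by move=> [x [y [H1 H2]]] H; exact: H H2.
  by move=> H; apply: NNPP => H'; apply: H => x y H1 H2; apply: H'; exists x, y.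
by apply/D0_not/D0_all_pair => //; exact: D0_not.
Qed.

Lemma D0_all_fst t u (Q : V -> env -> Prop) : simple t -> simple u ->
  Delta0 (fun e => Q (e 0) (fun n => e (S n))) ->
  Delta0 (fun e => forall x, opair x (u e) ∈ t e -> Q x e).
Proof.
move=> Ht Hu HQ; apply: (@D0_ext _ (fun e => forall x, x ∈ field (t e) ->
  opair x (u e) ∈ t e -> Q x e)).
  move=> e; split=> H x; first by move=> _; exact: H.
  by move=> Hx; apply: H => //; exact: field_l Hx.
apply: D0_all; first by do 2!apply: simple_Un.
apply: D0_imp => //; apply: D0_mem; last exact: simple_up.
by apply: simple_opair; [exact: simple_var|exact: simple_up].
Qed.

Lemma D0_ex_fst t u (Q : V -> env -> Prop) : simple t -> simple u ->
  Delta0 (fun e => Q (e 0) (fun n => e (S n))) ->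
  Delta0 (fun e => exists x, opair x (u e) ∈ t e /\ Q x e).
Proof.
move=> Ht Hu HQ; apply: (@D0_ext _ (fun e => ~ forall x, opair x (u e) ∈ t e -> ~ Q x e)).
  move=> e; split; first by move=> [x [H1 H2]] H; exact: H H2.
  by move=> H; apply: NNPP => H'; apply: H => x H1 H2; apply: H'; exists x.
by apply/D0_not/D0_all_fst => //; exact: D0_not.
Qed.

Lemma D0_all_snd t u (Q : V -> env -> Prop) : simple t -> simple u ->
  Delta0 (fun e => Q (e 0) (fun n => e (S n))) ->
  Delta0 (fun e => forall x, opair (u e) x ∈ t e -> Q x e).
Proof.
move=> Ht Hu HQ; apply: (@D0_ext _ (fun e => forall x, x ∈ field (t e) ->
  opair (u e) x ∈ t e -> Q x e)).
  move=> e; split=> H x; first by move=> _; exact: H.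
  by move=> Hx; apply: H => //; exact: field_r Hx.
apply: D0_all; first by do 2!apply: simple_Un.
apply: D0_imp => //; apply: D0_mem; last exact: simple_up.
by apply: simple_opair; [exact: simple_up|exact: simple_var].
Qed.

Lemma D0_ex_snd t u (Q : V -> env -> Prop) : simple t -> simple u ->
  Delta0 (fun e => Q (e 0) (fun n => e (S n))) ->
  Delta0 (fun e => exists x, opair (u e) x ∈ t e /\ Q x e).
Proof.
move=> Ht Hu HQ; apply: (@D0_ext _ (fun e => ~ forall x, opair (u e) x ∈ t e -> ~ Q x e)).
  move=> e; split; first by move=> [x [H1 H2]] H; exact: H H2.
  by move=> H; apply: NNPP => H'; apply: H => x H1 H2; apply: H'; exists x.
by apply/D0_not/D0_all_snd => //; exact: D0_not.
Qed.

Lemma D0_in_dom t u : simple t -> simple u -> Delta0 (fun e => in_dom (t e) (u e)).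
Proof.
move=> Ht Hu; apply: (@D0_ext _ (fun e => exists y, opair (u e) y ∈ t e /\ u e = u e)).
  by move=> e; split=> [[y Hy]|[y [Hy _]]]; exists y.
by apply: D0_ex_snd => //; apply: D0_eq; exact: simple_up.
Qed.

Lemma simple_field t : simple t -> simple (fun e => field (t e)).
Proof. by move=> H; do 2!apply: simple_Un. Qed.

End Bounded.

Notation "x .: e" := (push x e) (at level 60, right associativity) : zf_scope.

(** Connectives and atoms are treated by their head symbol, quantifiers by the way in which they are
    bounded: by members of a term, by pairs in it, or by one coordinate of such pairs. *)
Ltac bounded_step :=
  cbv beta;
  first
  [ assumption
  | match goal with
    | |- simple (fun e => e _) => apply: simple_var
    | |- simple (fun e => emptyset) => apply: simple_emptyset
    | |- simple (fun e => upair _ _) => apply: simple_upair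
    | |- simple (fun e => singleton _) => apply: simple_singleton
    | |- simple (fun e => opair _ _) => apply: simple_opair
    | |- simple (fun e => Un _) => apply: simple_Un
    | |- simple (fun e => field _) => apply: simple_field
    | |- simple (fun e => sep _ _) => refine (simple_sep (Q := fun x e => _) _ _)
    | |- simple (fun e => img _ _) => refine (simple_img (u := fun x e => _) _ _)
    | |- Delta0 (fun e => ~ _) => apply: D0_not
    | |- Delta0 (fun e => _ /\ _) => apply: D0_and
    | |- Delta0 (fun e => _ \/ _) => apply: D0_or
    | |- Delta0 (fun e => _ <-> _) => apply: D0_iff
    | |- Delta0 (fun e => _ = _) => apply: D0_eq
    | |- Delta0 (fun e => _ ∈ _) => apply: D0_mem
    | |- Delta0 (fun e => _ ⊆ _) => apply: D0_subset
    | |- Delta0 (fun e => in_dom _ _) => apply: D0_in_dom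
    end
  | simple refine (D0_all (Q := fun x e => _) _ _)
  | simple refine (D0_all_pair (Q := fun x y e => _) _ _)
  | simple refine (D0_all_fst (Q := fun x e => _) _ _ _)
  | simple refine (D0_all_snd (Q := fun x e => _) _ _ _)
  | simple refine (D0_ex (Q := fun x e => _) _ _)
  | simple refine (D0_ex_pair (Q := fun x y e => _) _ _)
  | simple refine (D0_ex_fst (Q := fun x e => _) _ _ _)
  | simple refine (D0_ex_snd (Q := fun x e => _) _ _ _)
  | simple refine (D0_imp _ _) ].

Ltac bounded := repeat bounded_step.

(** * Bounded-elementary embeddings *)

Section Embeddings.
Context {V : zfc_universe}.
Implicit Types (a b c f k p x y z : V) (M N : V -> Prop) (j : V -> V).
Local Notation env := (@env V).

Lemma D0_is_function t : simple t -> Delta0 (fun e : env => is_function (t e)).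
Proof.
move=> Ht; apply: (@D0_ext _ _ (fun e =>
  (forall z, z ∈ t e -> exists x, x ∈ Un z /\ exists y, y ∈ Un z /\ z = opair x y) /\
  (forall x y, opair x y ∈ t e -> forall y', opair x y' ∈ t e -> y = y'))).
  move=> e; split=> -[H1 H2]; split.
  - move=> z /H1 [x [y ->]]; exists x; split; first exact: Un_opair_l.
    by exists y; split=> //; exact: Un_opair_r.
  - by move=> x y H y' H'; exact: H2 H H'.
  - by move=> z /H1 [x [_ [y [_ ->]]]]; exists x, y.
  - by move=> x y y' H H'; exact: H2 H y' H'.
- have H1 := simple_up Ht; have H2 := simple_up H1.
  have H3 := simple_up H2.
  by bounded.
Qed.

Lemma D0_fun_on t u : simple t -> simple u -> Delta0 (fun e : env => fun_on (t e) (u e)).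
Proof.
move=> Ht Hu; apply: (@D0_ext _ _ (fun e => is_function (t e) /\
  (forall x y, opair x y ∈ t e -> x ∈ u e) /\
  forall x, x ∈ u e -> in_dom (t e) x)).
  move=> e; split=> -[H1 H2]; split=> //.
    by split=> x; [move=> y Hy; apply/H2; exists y|move/H2].
  by case: H2 => H2 H3 x; split=> [[y /H2]|/H3].
have H1 := simple_up Ht; have H2 := simple_up Hu; have H3 := simple_up H2.
by apply: D0_and; [exact: D0_is_function|bounded].
Qed.

Lemma simple_appd t u : simple t -> simple u -> simple (fun e : env => appd (t e) (u e)).
Proof.
move=> Ht Hu; rewrite /appd.
have H1 := simple_up Ht; have H2 := simple_up Hu.
by bounded.
Qed.

Lemma simple_mkfun t (u : V -> env -> V) : simple t ->
  simple (fun e => u (e 0) (fun n => e (S n))) ->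
  simple (fun e => mkfun (t e) (fun x => u x e)).
Proof. by move=> Ht Hu; rewrite /mkfun; bounded. Qed.

Lemma simple_fst t : simple t -> simple (fun e : env => fst (t e)).
Proof.
move=> Ht; rewrite /fst.
have H1 := simple_up Ht; have H2 := simple_up H1.
by bounded.
Qed.

Lemma simple_snd t : simple t -> simple (fun e : env => snd (t e)).
Proof.
move=> Ht; rewrite /snd.
have H1 := simple_up Ht; have H2 := simple_up H1.
by bounded.
Qed.

Lemma simple_inter t u : simple t -> simple u -> simple (fun e : env => inter (t e) (u e)).
Proof.
move=> Ht Hu; have H := simple_up Hu.
by apply: (simple_sep (Q := fun x e => x ∈ u e)) => //; bounded.
Qed.

Lemma simple_setminus t u : simple t -> simple u ->
  simple (fun e : env => setminus (t e) (u e)).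
Proof.
move=> Ht Hu; have H := simple_up Hu.
by apply: (simple_sep (Q := fun x e => x ∉ u e)) => //; bounded.
Qed.

(** Both sides of [emb_sat] are evaluated in [V], which for transitive classes agrees with their own
    bounded truth. Cofinality turns collections formed in the source model into bounds for arbitrary
    elements of [N]. *)
Record embedding M N j : Prop := Embedding {
  emb_maps : forall x, M x -> N (j x);
  emb_sat : forall φ (e : env), (forall n, M (e n)) ->
    (sat φ e <-> sat φ (fun n => j (e n)));
  emb_cofinal : forall y, N y -> exists x, M x /\ y ∈ j x
}.

Lemma emb_D0 M N j (Q : env -> Prop) e : embedding M N j -> Delta0 Q ->
  (forall n, M (e n)) -> (Q e <-> Q (fun n => j (e n))).
Proof. by move=> E [φ H] He; rewrite !H; exact: emb_sat E _ _ He. Qed.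

(** The graph of a simple term is a bounded relation, so the true equation between [t e] and its
    value is carried over by [j]. *)
Lemma emb_simple M N j (t : env -> V) e : embedding M N j -> simple t ->
  (forall n, M (e n)) -> M (t e) -> j (t e) = t (fun n => j (e n)).
Proof.
move=> E Ht He HMt.
have HD : Delta0 (fun e : env => e 0 = t (fun n => e (S n))).
  by have H := simple_up Ht; bounded.
by apply/(@emb_D0 _ _ _ _ (t e .: e) E HD) => // -[|n] /=.
Qed.

Section Mem.
Variables (M N : V -> Prop) (j : V -> V) (E : embedding M N j).

Lemma emb_mem x y : M x -> M y -> (x ∈ y <-> j x ∈ j y).
Proof.
move=> Hx Hy; apply: (@emb_D0 _ _ _ (fun e => e 0 ∈ e 1) (x .: fun _ => y) E).
  by bounded.
by case.
Qed.

Lemma emb_sub x y : M x -> M y -> (x ⊆ y <-> j x ⊆ j y).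
Proof.
move=> Hx Hy; apply: (@emb_D0 _ _ _ (fun e => e 0 ⊆ e 1) (x .: fun _ => y) E).
  by bounded.
by case.
Qed.

Lemma emb_appd f x : M f -> M x -> M (appd f x) -> j (appd f x) = appd (j f) (j x).
Proof.
move=> Hf Hx; apply: (@emb_simple _ _ _ (fun e => appd (e 0) (e 1)) (f .: fun _ => x) E).
  by apply: simple_appd; bounded.
by case.
Qed.

Lemma emb_opair x y : M x -> M y -> M (opair x y) -> j (opair x y) = opair (j x) (j y).
Proof.
move=> Hf Hx; apply: (@emb_simple _ _ _ (fun e => opair (e 0) (e 1)) (x .: fun _ => y) E).
  by bounded.
by case.
Qed.

Lemma emb_fun_on f a : M f -> M a -> (fun_on f a <-> fun_on (j f) (j a)).
Proof.
move=> Hf Ha; apply: (@emb_D0 _ _ _ (fun e => fun_on (e 0) (e 1)) (f .: fun _ => a) E).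
  by apply: D0_fun_on; bounded.
by case.
Qed.

End Mem.

(** [im_pi2] says that a ∀∃ statement with bounded matrix, true in [V], holds in [N]. It supplies
    the sets needed inside [N]: values of simple terms, Skolem functions, transitive covers,
    attempts at recursions. *)
Record inner_model N : Prop := InnerModel {
  im_trans : transitive_class N;
  im_pi2 : forall Q, Delta0 Q -> (forall e : env, exists y, Q (y .: e)) ->
    forall e : env, (forall n, N (e n)) -> exists y, N y /\ Q (y .: e)
}.

Lemma im_simple N t e : inner_model N -> simple t -> (forall n, N (e n)) -> N (t e).
Proof.
move=> HN Ht He.
have HD : Delta0 (fun e : env => e 0 = t (fun n => e (S n))).
  by have H := simple_up Ht; bounded.
case: (im_pi2 HN HD _ He) => [e'|y [Hy]]; first by exists (t e').
by move=> /= <-.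
Qed.

Lemma emb_comp M1 M2 M3 (j1 j2 j3 : V -> V) : inner_model M1 -> inner_model M2 ->
  embedding M1 M2 j1 -> embedding M2 M3 j2 ->
  (forall x, M1 x -> j3 x = j2 (j1 x)) -> embedding M1 M3 j3.
Proof.
move=> I1 I2 E1 E2 H; split.
- by move=> x Hx; rewrite H //; apply: (emb_maps E2); exact: (emb_maps E1).
- move=> φ e He; rewrite (emb_sat E1 φ He) (emb_sat E2).
    by move=> n; exact: (emb_maps E1).
  suff -> : (fun n => j2 (j1 (e n))) = (fun n => j3 (e n)) by [].
  by extensionality n; rewrite H.
- move=> y /(emb_cofinal E2) [x [Hx Hy]].
  have [u [Hu Hxu]] := emb_cofinal E1 Hx.
  have HUn : M1 (Un u).
    by apply: (im_simple (t := fun e => Un (e 0)) (e := fun _ => u)) => //; bounded.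
  (* From [x ∈ j1 u] follows [x ⊆ j1 (Un u)], and [j2] preserves this inclusion, so [y] lies in the
     image of [Un u]. *)
  exists (Un u); split=> //; rewrite H //.
  have HUn2 := emb_maps E1 HUn.
  apply: (proj1 (emb_sub E2 Hx HUn2)) Hy.
  rewrite (emb_simple (t := fun e => Un (e 0)) (e := fun _ => u) E1) //; first by bounded.
  by move=> z Hz; apply/in_Un; exists x.
Qed.

Definition pushl (l : list V) (e : env) : env := fold_right push e l.

Lemma pushl_nth l e n : n < length l -> pushl l e n = nth n l (e 0).
Proof. elim: l n => [|x l IH] [|n] //= H; try lia; apply: IH; lia. Qed.

Lemma pushl_add l e n : pushl l e (length l + n) = e n.
Proof. by elim: l => [|x l IH] //=. Qed.

Lemma D0_all_lists (k n : nat) (Q : env -> Prop) : Delta0 Q ->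
  Delta0 (fun e => forall l, length l = n -> Forall (fun v => v ∈ e k) l -> Q (pushl l e)).
Proof.
elim: n Q => [|n IH] Q HQ.
  apply: D0_ext HQ => e; split; first by move=> H; exact: (H nil).
  by move=> H [].
(* The [n] outer entries are already pushed when [v] is bound, so the bounding set [e k] has moved
   to index [n + k]. *)
pose Q1 (e : env) := forall v, v ∈ e (n + k) -> Q (v .: e).
have HQ1 : Delta0 Q1.
  apply: (D0_all (Q := fun v e => Q (v .: e))); first exact: simple_var.
  apply: (D0_subst1 (fun n => S n)) => //; exact: simple_var.
apply: D0_ext (IH _ HQ1) => e; split.
  move=> H l Hl Hal v; rewrite -Hl pushl_add => Hv.
  apply: (H (v :: l)) => /=; [by rewrite Hl|by constructor].
move=> H [//|v l] [Hl] /Forall_cons_iff [Hv Hal].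
by apply: (H l Hl Hal); rewrite -Hl pushl_add.
Qed.

Lemma small_lists a n (h : list V -> V) :
  small (fun y => exists l, length l = n /\ Forall (fun v => v ∈ a) l /\ y = h l).
Proof.
elim: n h => [|n IH] h.
  apply: small_sub (small_eq (h nil)) _.
  by move=> x [[|v l] [Hl [_ ->]]].
apply: small_sub (small_bind (Q := fun v y => exists l, length l = n /\
    Forall (fun v => v ∈ a) l /\ y = h (v :: l)) (small_set a) _) _.
  by move=> v _; exact: (IH (fun l => h (v :: l))).
move=> y [l [Hl [Hal ->]]].
case: l Hl Hal => [|v l] // [Hl] /Forall_cons_iff [Hv Hal].
by exists v; split=> //; exists l.
Qed.

(** Cofinality puts the finitely many relevant parameters into one [j a]. In [V], witnesses for all
    tuples from [a] are collected in a set [b]. That every tuple from [a] has a witness in [b] is a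
    bounded statement, so tuples from [j a] have witnesses in [j b], whose members belong to the
    transitive class [N]. *)
Lemma inner_model_of_embedding N j : transitive_class N ->
  embedding (fun _ => True) N j -> inner_model N.
Proof.
move=> Htr E; split=> // Q HQ HE e He.
have [φ Hφ] := HQ; have [n Hn] := @sat_support V φ.
have Hsup e1 e2 : (forall m, m < n -> e1 m = e2 m) -> (Q e1 <-> Q e2).
  by move=> H; rewrite !Hφ; exact: Hn.
have [a Ha] : exists a, forall m, m < n -> e m ∈ j a.
  elim: (n) => [|m [a Ha]]; first by exists emptyset; lia.
  have [b [_ Hb]] := emb_cofinal E (He m).
  have [c [H1 H2]] := pair_cover a b.
  exists c => i Hi.
  have [->|Hi'] : i = m \/ i < m by lia.
    by apply: (proj1 (emb_sub E I I) H2).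
  by apply: (proj1 (emb_sub E I I) H1); exact: Ha.
(* [d] is arbitrary padding: [n] bounds all variables, the one of the witness included, so entries
   beyond a list of length [n] do not matter. *)
pose d : env := fun _ => emptyset.
pose h l := epsilon V_inhabited (fun y => Q (y .: pushl l d)).
have Hh l : Q (h l .: pushl l d).
  exact: (epsilon_spec V_inhabited (fun y => Q (y .: pushl l d)) (HE _)).
have [b Hb] := small_lists a n h.
pose R (e : env) := forall l, length l = n -> Forall (fun v => v ∈ e 0) l ->
  exists y, y ∈ pushl l e (n + 1) /\ Q (y .: pushl l e).
have HR : Delta0 R.
  apply: (D0_all_lists 0 n (Q := fun e => exists y, y ∈ e (n + 1) /\ Q (y .: e))).
  apply: (D0_ex (Q := fun y e => Q (y .: e))); first exact: simple_var.
  apply: (D0_subst1 (fun n => S n)) => //; exact: simple_var.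
have HRab : R (a .: fun _ => b).
  move=> l Hl Hal; exists (h l); split.
    by rewrite -Hl pushl_add /=; apply: Hb; exists l.
  apply: (proj1 (Hsup (h l .: pushl l d) _ _) (Hh l)) => -[|m] //= Hm.
  rewrite !pushl_nth ?Hl; try lia.
  apply: nth_indep; lia.
have {}HRab := proj1 (emb_D0 E HR (fun _ => I)) HRab.
have Hle : length (map e (seq 0 n)) = n by rewrite length_map length_seq.
have [|y [Hy Hqy]] := HRab (map e (seq 0 n)) Hle.
  apply/Forall_forall => v /in_map_iff [m [<- /in_seq Hm]] /=.
  apply: Ha; lia.
exists y; split.
  move: Hy; rewrite -[in n + 1]Hle pushl_add /=.
  by apply: Htr; exact: (emb_maps E I).
apply: (proj1 (Hsup _ (y .: e) _) Hqy) => -[|m] //= Hm.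
rewrite pushl_nth ?Hle; try lia.
rewrite (nth_indep _ _ (e 0)) ?Hle; try lia.
rewrite map_nth seq_nth //; lia.
Qed.

End Embeddings.

Ltac bounded_step_ext :=
  cbv beta;
  first
  [ bounded_step
  | match goal with
    | |- simple (fun e => appd _ _) => apply: simple_appd
    | |- simple (fun e => mkfun _ _) => refine (simple_mkfun (u := fun x e => _) _ _)
    | |- simple (fun e => fst _) => apply: simple_fst
    | |- simple (fun e => snd _) => apply: simple_snd
    | |- simple (fun e => inter _ _) => apply: simple_inter
    | |- simple (fun e => setminus _ _) => apply: simple_setminus
    | |- Delta0 (fun e => is_function _) => apply: D0_is_function
    | |- Delta0 (fun e => fun_on _ _) => apply: D0_fun_on
    end ].

Ltac bounded ::= repeat bounded_step_ext.

(** * Ultrapowers *)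

Section Ultrapower.
Context {V : zfc_universe}.
Implicit Types (a b c f g x y z ξ η : V) (N : V -> Prop).
Local Notation env := (@env V).

(** The properties of normal ultrafilters used below, relativized to [M].  Those
    that quantify over functions do so one function at a time, which makes them
    bounded and lets them pass from [V] to the models of the iteration. *)
Record measure_in (M : V -> Prop) (k W : V) : Prop := MeasureIn {
  mi_card : M k;
  mi_trans : transitive_class (fun x => x ∈ k);
  mi_sub : forall x, x ∈ W -> x ⊆ k;
  mi_top : k ∈ W;
  mi_bot : emptyset ∉ W;
  mi_up : forall x y, x ∈ W -> M y -> x ⊆ y -> y ⊆ k -> y ∈ W;
  mi_inter : forall x y, x ∈ W -> y ∈ W -> inter x y ∈ W;
  mi_ultra : forall x, M x -> x ⊆ k -> x ∈ W \/ setminus k x ∈ W;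
  mi_press : forall f, M f -> sep k (fun z => appd f z ∈ z) ∈ W ->
    exists y, y ∈ k /\ sep k (fun z => appd f z = y) ∈ W;
  mi_complete : forall f ξ, M f -> ξ ∈ k -> sep k (fun z => appd f z ∈ ξ) ∈ W ->
    exists y, y ∈ ξ /\ sep k (fun z => appd f z = y) ∈ W;
  mi_tail : forall ξ, ξ ∈ k -> sep k (fun z => ξ ∈ z) ∈ W
}.

Lemma sep_sub a (φ : V -> Prop) : sep a φ ⊆ a.
Proof. by move=> z /in_sep []. Qed.

Variables (M : V -> Prop) (k W : V) (N : V -> Prop) (e cl : V -> V).
Hypothesis IM : inner_model M.
Hypothesis HW : measure_in M k W.
Hypothesis HN : transitive_class N.
Hypothesis Hcl : forall f g, M f -> fun_on f k -> M g -> fun_on g k ->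
  (cl f ∈ cl g <-> sep k (fun x => app f x ∈ app g x) ∈ W).
Hypothesis HNcl : forall y, N y <-> exists f, M f /\ fun_on f k /\ y = cl f.
Hypothesis He : forall x, M x -> e x = cl (const_fun k x).

Let Mk : M k := mi_card HW.

(** The ultrafilter decides only subsets of [k] that belong to [M]; this puts the truth sets of
    bounded formulas among them. *)
Lemma M_sep φ (s : env) : (forall n, M (s n)) ->
  M (sep k (fun x => sat φ (fun n => appd (s n) x))).
Proof.
move=> Hs; apply: (im_simple IM (t := fun E => sep (E 0)
  (fun x => sat φ (fun n => appd (E (S n)) x))) (e := k .: s)); last by case.
refine (simple_sep (Q := fun x E => sat φ (fun n => appd (E (S n)) x)) _ _).
  exact: simple_var.
apply: (D0_subst (Q := sat φ) (τ := fun n E => appd (E (S (S n))) (E 0))).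
  by exists φ.
by move=> n; bounded.
Qed.

Lemma push_cl (s : env) g : (fun n => cl ((g .: s) n)) = (cl g .: fun n => cl (s n)).
Proof. by extensionality n; case: n. Qed.

Lemma push_appd (s : env) g x :
  (fun n => appd ((g .: s) n) x) = (appd g x .: fun n => appd (s n) x).
Proof. by extensionality n; case: n. Qed.

(** Choice in [V] gives such a function for any parameters, and being one is a bounded property. The
    Π2 property then yields one in [M], although the function chosen in [V] may lie outside. *)
Lemma M_skolem φ i (s : env) : (forall n, M (s n)) ->
  exists g, M g /\ fun_on g k /\ forall x, x ∈ k ->
    (exists z, z ∈ appd (s i) x /\ ~ sat φ (z .: fun n => appd (s n) x)) ->
    appd g x ∈ appd (s i) x /\ ~ sat φ (appd g x .: fun n => appd (s n) x).
Proof.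
move=> Hs.
pose R z x (E : env) := z ∈ appd (E i) x /\ ~ sat φ (z .: fun n => appd (E n) x).
pose Q (E : env) := fun_on (E 0) (E 1) /\ forall x, x ∈ E 1 ->
  (exists z, z ∈ appd (E (S (S i))) x /\ ~ sat φ (z .: fun n => appd (E (S (S n))) x)) ->
  R (appd (E 0) x) x (fun n => E (S (S n))).
have HQ : Delta0 Q.
  have Hφ (t : env -> V) (ρ : nat -> nat) m : simple t ->
      Delta0 (fun E => ~ sat φ (t E .: fun n => appd (E (ρ n)) (E m))).
    move=> Ht; apply: D0_not.
    pose τ n : env -> V := match n with O => t | S n => fun E => appd (E (ρ n)) (E m) end.
    apply: (@D0_ext _ _ (fun E => sat φ (fun n => τ n E))).
      move=> E; suff -> : (fun n => τ n E) = (t E .: fun n => appd (E (ρ n)) (E m)) by [].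
      by extensionality n; case: n.
    apply: D0_subst; first by exists φ.
    by case=> [|n] //=; bounded.
  apply: D0_and; first by bounded.
  refine (D0_all (Q := fun x E => (exists z, z ∈ appd (E (S (S i))) x /\
    ~ sat φ (z .: fun n => appd (E (S (S n))) x)) ->
    R (appd (E 0) x) x (fun n => E (S (S n)))) _ _); first by bounded.
  apply: D0_imp.
    refine (D0_ex (Q := fun z E => ~ sat φ (z .: fun n => appd (E (S (S (S n)))) (E 0))) _ _).
      by bounded.
    exact: (Hφ (fun E => E 0) (fun n => S (S (S (S n)))) 1 (simple_var 0)).
  apply: D0_and; first by bounded.
  by apply: (Hφ (fun E => appd (E 1) (E 0)) (fun n => S (S (S n))) 0); bounded.
have HE (E : env) : exists g, Q (g .: E).
  pose h x := epsilon V_inhabited (fun z => R z x (fun n => E (S n))).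
  exists (mkfun (E 0) h); split; first exact: mkfun_on.
  move=> x Hx Hz; rewrite /= mkfunE //.
  exact: (epsilon_spec V_inhabited (fun z => R z x (fun n => E (S n))) Hz).
have Hks n : M ((k .: s) n) by case: n.
by have [g [Mg [H1 H2]]] := im_pi2 IM HQ HE Hks; exists g.
Qed.

Lemma inter_in x y z : x ∈ W -> y ∈ W -> M z -> z ⊆ k ->
  (forall u, u ∈ k -> u ∈ x -> u ∈ y -> u ∈ z) -> z ∈ W.
Proof.
move=> Hx Hy Mz Hz H; apply: (mi_up HW (mi_inter HW Hx Hy)) => // u /in_inter [Hux Huy].
by apply: H => //; exact: (mi_sub HW Hx).
Qed.

Lemma disjoint_not x y : x ∈ W -> y ∈ W -> (forall u, u ∈ k -> u ∈ x -> u ∉ y) -> False.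
Proof.
move=> Hx Hy H; apply: (mi_bot HW).
have <- : inter x y = emptyset; last exact: (mi_inter HW).
apply: set_ext => u; rewrite in_inter; split; last by move/in_emptyset.
by move=> [Hux Huy]; case: (H u) => //; exact: (mi_sub HW Hx).
Qed.

(** Only the quantifier needs an argument. If the truth set of the universal formula were not in
    [W], a Skolem function in [M] choosing counterexamples on the complement would represent a
    member of [cl (s i)] refuting it. Conversely, members of [cl (s i)] are represented by functions
    because [N] is transitive. *)
Theorem los φ (s : env) : (forall n, M (s n) /\ fun_on (s n) k) ->
  (sat φ (fun n => cl (s n)) <-> sep k (fun x => sat φ (fun n => appd (s n) x)) ∈ W).
Proof.
elim: φ s => [i j|φ IH|φ IH1 ψ IH2|i φ IH] s Hs /=.
- have [Mi Fi] := Hs i; have [Mj Fj] := Hs j.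
  rewrite Hcl // (@sep_ext _ _ _ (fun x => appd (s i) x ∈ appd (s j) x)) // => x Hx.
  by rewrite !(fun_on_app _ Hx).
- rewrite IH //.
  have MS := M_sep φ (fun n => proj1 (Hs n)).
  have E : sep k (fun x => ~ sat φ (fun n => appd (s n) x)) =
      setminus k (sep k (fun x => sat φ (fun n => appd (s n) x))).
    by apply: set_ext => z; rewrite in_sep in_setminus in_sep; tauto.
  rewrite E; split=> H.
    by case: (mi_ultra HW MS (@sep_sub _ _)).
  move=> H'; apply: (disjoint_not H' H) => u _ Hu.
  by rewrite in_setminus; tauto.
- rewrite IH1 // IH2 //.
  have M1 := M_sep φ (fun n => proj1 (Hs n)).
  have M2 := M_sep ψ (fun n => proj1 (Hs n)).
  have M3 := M_sep (FAnd φ ψ) (fun n => proj1 (Hs n)).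
  split=> [[H1 H2]|H].
    apply: (inter_in H1 H2 M3 (@sep_sub _ _)) => u Hu.
    by rewrite !in_sep /=; tauto.
  split; apply: (inter_in H H) => //; try exact: sep_sub;
    by move=> u Hu; rewrite !in_sep /=; tauto.
- have Ms n := proj1 (Hs n).
  have M1 := M_sep (FAll i φ) Ms.
  split=> H.
    case: (mi_ultra HW M1 (@sep_sub _ _)) => // HT.
    have [g [Mg [Fg Hg]]] := M_skolem φ i Ms.
    have [Mi Fi] := Hs i.
    have Hgs n : M ((g .: s) n) /\ fun_on ((g .: s) n) k by case: n.
    have Hx x : x ∈ k -> x ∈ setminus k (sep k (fun x => sat (FAll i φ) (fun n => appd (s n) x))) ->
        appd g x ∈ appd (s i) x /\ ~ sat φ (appd g x .: fun n => appd (s n) x).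
      move=> Hxk /in_setminus [_]; rewrite in_sep => Hn; apply: Hg => //.
      apply: NNPP => Hno; apply: Hn; split=> // z Hz.
      by apply: NNPP => Hsat; apply: Hno; exists z.
    have Mm : M (sep k (fun x => appd g x ∈ appd (s i) x)).
      exact: (M_sep (FMem 0 (S i)) (fun n => proj1 (Hgs n))).
    have Hmem : cl g ∈ cl (s i).
      rewrite Hcl // (@sep_ext _ _ _ (fun x => appd g x ∈ appd (s i) x)).
        by move=> x Hxk; rewrite !(fun_on_app _ Hxk).
      apply: (inter_in HT HT Mm (@sep_sub _ _)) => u Hu HuT _.
      by rewrite in_sep; split=> //; case: (Hx u).
    move/(_ _ Hmem): H; rewrite -push_cl IH // => Hphi.
    exfalso; apply: (disjoint_not HT Hphi) => u Hu HuT; rewrite in_sep push_appd.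
    by have [_ Hn] := Hx u Hu HuT; tauto.
  move=> z Hz.
  have /HNcl [g [Mg [Fg Ez]]] : N z.
    by apply: (HN _ Hz); apply/HNcl; exists (s i); case: (Hs i).
  have [Mi Fi] := Hs i.
  have Hgs n : M ((g .: s) n) /\ fun_on ((g .: s) n) k by case: n.
  rewrite Ez -push_cl IH //.
  rewrite Ez Hcl // in Hz.
  apply: (inter_in H Hz); [by apply: M_sep => n; case: (Hgs n)|exact: sep_sub|].
  move=> u Hu; rewrite !in_sep push_appd !(fun_on_app _ Hu) //.
  by move=> [_ Hall] [_ Hgu]; split=> //; exact: Hall.
Qed.

Lemma los_D0 Q (s : env) : Delta0 Q -> (forall n, M (s n) /\ fun_on (s n) k) ->
  (Q (fun n => cl (s n)) <-> sep k (fun x => Q (fun n => appd (s n) x)) ∈ W).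
Proof.
move=> [φ Hφ] Hs; rewrite Hφ los //.
by rewrite (@sep_ext _ k _ (fun x => Q (fun n => appd (s n) x))) // => x _; rewrite Hφ.
Qed.

Lemma M_const x : M x -> M (const_fun k x) /\ fun_on (const_fun k x) k.
Proof.
move=> Mx; rewrite const_funE; split; last exact: mkfun_on.
apply: (im_simple IM (t := fun e => mkfun (e 0) (fun _ => e 1)) (e := k .: fun _ => x)).
  by bounded.
by case.
Qed.

Lemma ultrapower_embedding : embedding M N e.
Proof.
split.
- by move=> x Mx; apply/HNcl; exists (const_fun k x); case: (M_const Mx) => *; rewrite He.
- move=> φ s Ms.
  have -> : (fun n => e (s n)) = (fun n => cl (const_fun k (s n))).
    by extensionality n; rewrite He.
  rewrite (los φ (s := fun n => const_fun k (s n))); first by move=> n; exact: M_const.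
  rewrite (@sep_ext _ k _ (fun x => sat φ s)).
    move=> x Hx; have -> // : (fun n => appd (const_fun k (s n)) x) = s.
    by extensionality n; rewrite const_funE mkfunE.
  case: (classic (sat φ s)) => Hs; split=> // H.
    suff -> : sep k (fun _ => sat φ s) = k by exact: (mi_top HW).
    by apply: set_ext => z; rewrite in_sep; tauto.
  case: (mi_bot HW); suff <- : sep k (fun _ => sat φ s) = emptyset by [].
  by apply: set_ext => z; rewrite in_sep; split=> [[]//|/in_emptyset].
- move=> y /HNcl [f [Mf [Ff ->]]].
  (* Cofinality: the range [b] of [f] lies in [M] and contains every value of [f], so [cl f] is a
     member of [e b]. *)
  pose b := img k (fun x => appd f x).
  have Mb : M b.
    apply: (im_simple IM (t := fun e => img (e 0) (fun x => appd (e 1) x)) (e := k .: fun _ => f)).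
      by bounded.
    by case.
  exists b; split=> //; rewrite He //.
  have [Mc Fc] := M_const Mb.
  rewrite Hcl // (@sep_ext _ k _ (fun x => x ∈ k)).
    move=> x Hx; rewrite !(fun_on_app _ Hx) // const_funE mkfunE //.
    by split=> // _; apply/in_img; exists x.
  suff -> : sep k (fun x => x ∈ k) = k by exact: (mi_top HW).
  by apply: set_ext => z; rewrite in_sep; tauto.
Qed.

Lemma cl_eq_const f η : M f -> fun_on f k -> M η ->
  sep k (fun x => appd f x = η) ∈ W -> cl f = e η.
Proof.
move=> Mf Ff Mη H; have [Mc Fc] := M_const Mη; rewrite He //.
have HD : Delta0 (fun E : env => E 0 = E 1) by bounded.
apply/(los_D0 (s := f .: fun _ => const_fun k η) HD); first by case.
rewrite (@sep_ext _ k _ (fun x => appd f x = η)) // => x Hx /=.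
by rewrite const_funE mkfunE.
Qed.

Lemma M_below ξ : ξ ∈ k -> M ξ.
Proof. exact: (im_trans IM Mk). Qed.

(** By induction on [ξ]: an element of [e ξ] is represented by a function with values in [ξ] on a
    set in [W], and [mi_complete] makes it constant on a set in [W]. *)
Lemma ultrapower_fix ξ : ξ ∈ k -> e ξ = ξ.
Proof.
elim/(well_founded_induction (mem_wf (V := V))): ξ => ξ IH Hξ.
have Mξ := M_below Hξ.
have Hk η : η ∈ ξ -> η ∈ k by exact: (mi_trans HW Hξ).
apply: set_ext => z; split=> Hz; last first.
  rewrite -(IH z Hz (Hk _ Hz)).
  exact: (proj1 (emb_mem ultrapower_embedding (M_below (Hk _ Hz)) Mξ) Hz).
have /HNcl [f [Mf [Ff Ez]]] := HN (emb_maps ultrapower_embedding Mξ) Hz.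
have [Mc Fc] := M_const Mξ.
move: Hz; rewrite Ez He // Hcl // (@sep_ext _ k _ (fun x => appd f x ∈ ξ)).
  by move=> x Hx; rewrite !(fun_on_app _ Hx) // const_funE mkfunE.
move=> /(mi_complete HW Mf Hξ) [η [Hη E]].
by rewrite (cl_eq_const Mf Ff (M_below (Hk _ Hη)) E) IH //; exact: Hk.
Qed.

Let idf := mkfun k (fun x => x).

Lemma M_id : M idf /\ fun_on idf k.
Proof.
split; last exact: mkfun_on.
by apply: (im_simple IM (t := fun e => mkfun (e 0) (fun x => x)) (e := fun _ => k)); bounded.
Qed.

(** Here normality enters. A function representing an element of [cl idf] is regressive on a set in
    [W], hence constant on one by [mi_press]; conversely [mi_tail] puts every element of [k] into
    [cl idf]. *)
Lemma cl_id : cl idf = k.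
Proof.
have [Mi Fi] := M_id.
apply: set_ext => z; split=> Hz.
  have /HNcl [f [Mf [Ff Ez]]] : N z.
    by apply: (HN _ Hz); apply/HNcl; exists idf.
  move: Hz; rewrite Ez Hcl // (@sep_ext _ k _ (fun x => appd f x ∈ x)).
    by move=> x Hx; rewrite !(fun_on_app _ Hx) // mkfunE.
  move=> /(mi_press HW Mf) [η [Hη E]].
  by rewrite (cl_eq_const Mf Ff (M_below Hη) E) ultrapower_fix.
have Mz := M_below Hz; have [Mc Fc] := M_const Mz.
rewrite -(ultrapower_fix Hz) He // Hcl //.
rewrite (@sep_ext _ k _ (fun x => z ∈ x)); last exact: (mi_tail HW Hz).
by move=> x Hx; rewrite !(fun_on_app _ Hx) // const_funE !mkfunE.
Qed.

Lemma ultrapower_moves : k ∈ e k.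
Proof.
have [Mi Fi] := M_id; have [Mc Fc] := M_const Mk.
rewrite -{1}cl_id He // Hcl // (@sep_ext _ k _ (fun x => x ∈ k)).
  by move=> x Hx; rewrite !(fun_on_app _ Hx) // const_funE !mkfunE.
suff -> : sep k (fun x => x ∈ k) = k by exact: (mi_top HW).
by apply: set_ext => z; rewrite in_sep; tauto.
Qed.

(** [k] is represented by the identity, so Łoś's theorem evaluates [e f] at [k] to the class of
    [f]. *)
Lemma ultrapower_rep y : N y -> exists f, M f /\ fun_on f k /\ y = appd (e f) k.
Proof.
move=> /HNcl [f [Mf [Ff ->]]]; exists f; do 2!split=> //.
have [Mi Fi] := M_id; have [Mc Fc] := M_const Mf.
have [[Fef _] _] := (proj1 (emb_fun_on ultrapower_embedding Mf Mk) Ff, I).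
symmetry; apply: appd_fun => //.
rewrite -cl_id He //.
have HD : Delta0 (fun E : env => opair (E 0) (E 1) ∈ E 2) by bounded.
apply/(los_D0 (s := idf .: f .: fun _ => const_fun k f) HD); first by case=> [|[|]].
rewrite (@sep_ext _ k _ (fun x => x ∈ k)).
  move=> x Hx /=; rewrite const_funE !mkfunE //.
  by split=> // _; exact: (fun_on_opair Ff).
suff -> : sep k (fun x => x ∈ k) = k by exact: (mi_top HW).
by apply: set_ext => z; rewrite in_sep; tauto.
Qed.

End Ultrapower.

(** * Ordinals *)

Section Ordinals.
Context {V : zfc_universe}.
Implicit Types (a b c f g x y z ξ η : V) (M N : V -> Prop).
Local Notation env := (@env V).

Lemma ord_mem a x : ordinal a -> x ∈ a -> ordinal x.
Proof.
move=> [H1 H2] Hx; split; first exact: H2.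
by move=> y Hy; apply: H2; exact: H1 Hx Hy.
Qed.

Lemma ord_trans a x y : ordinal a -> x ∈ a -> y ∈ x -> y ∈ a.
Proof. by move=> [H _]; exact: H. Qed.

Lemma ord_total a b : ordinal a -> ordinal b -> a ∈ b \/ a = b \/ b ∈ a.
Proof.
elim/(well_founded_induction (mem_wf (V := V))): a b => a IHa b.
elim/(well_founded_induction (mem_wf (V := V))): b => b IHb Ha Hb.
case: (classic (b ∈ a)) => Hba; first by right; right.
case: (classic (a ∈ b)) => Hab; first by left.
right; left; apply: set_ext => z; split=> Hz.
  have [//|[E|H]] := IHa z Hz b (ord_mem Ha Hz) Hb; first by rewrite E in Hz.
  by case: Hba; exact: ord_trans Hz H.
have [H|[E|//]] := IHb z Hz Ha (ord_mem Hb Hz); last by rewrite -E in Hz.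
by case: Hab; exact: ord_trans Hz H.
Qed.

Lemma ord_zero a : ordinal a -> ole emptyset a.
Proof.
move=> Ha; have H0 : ordinal (@emptyset V).
  by split=> [x y /in_emptyset|x /in_emptyset].
by case: (ord_total H0 Ha) => [|[|/in_emptyset]]; rewrite /ole; auto.
Qed.

Lemma ord_succ a : ordinal a -> ordinal (succ a).
Proof.
move=> Ha; split=> [x y|x]; rewrite !in_succ.
  by move=> [Hx|->] Hy; left=> //; exact: ord_trans Hx Hy.
by move=> [Hx|->]; [case: (ord_mem Ha Hx)|case: Ha].
Qed.

Lemma succ_ole a b : ordinal b -> a ∈ b -> ole (succ a) b.
Proof.
move=> Hb Hab; have Ha := ord_mem Hb Hab.
case: (ord_total (ord_succ Ha) Hb) => [|[|]]; rewrite /ole; auto.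
rewrite in_succ => -[H|E]; last by rewrite E in Hab; case: (mem_irrefl Hab).
by case: (mem_asym Hab).
Qed.

Lemma ord_cases a : ordinal a ->
  a = emptyset \/ (exists b, b ∈ a /\ a = succ b) \/ limit_ordinal a.
Proof.
move=> Ha; case: (classic (exists x, x ∈ a)) => Hx; last first.
  left; apply: set_ext => z; split=> [Hz|/in_emptyset//].
  by case: Hx; exists z.
right; case: (classic (exists b, b ∈ a /\ a = succ b)) => Hs; first by left.
right; do 2!split=> //.
move=> x Hxa; case: (succ_ole Ha Hxa) => // E.
by case: Hs; exists x.
Qed.

Lemma ole_trans a b c : ordinal c -> ole a b -> ole b c -> ole a c.
Proof.
move=> Hc [Hab|->] // [Hbc|<-]; left=> //; exact: ord_trans Hbc Hab.
Qed.

Lemma ole_ord a b : ordinal b -> ole a b -> ordinal a.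
Proof. by move=> Hb [/(ord_mem Hb)|->]. Qed.

Lemma ole_mem a b x : ordinal b -> ole a b -> x ∈ a -> x ∈ b.
Proof. by move=> Hb [H|->] // Hx; exact: ord_trans H Hx. Qed.

Lemma D0_ordinal t : simple t -> Delta0 (fun e : env => ordinal (t e)).
Proof.
move=> Ht; apply: (@D0_ext _ _ (fun e =>
  (forall x, x ∈ t e -> forall y, y ∈ x -> y ∈ t e) /\
  (forall x, x ∈ t e -> forall y, y ∈ x -> forall z, z ∈ y -> z ∈ x))).
  move=> e; split=> -[H1 H2]; split.
  - by move=> x Hx y Hy; exact: H1 Hx Hy.
  - by move=> x Hx y Hy z Hz; exact: H2 Hx _ _ Hy Hz.
  - by move=> x y Hx Hy; exact: H1 Hx _ Hy.
  - by move=> x Hx y z Hy Hz; exact: H2 Hx _ Hy _ Hz.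
- have H1 := simple_up Ht; have H2 := simple_up H1.
  by bounded.
Qed.

Lemma emb_ordinal M N j x : embedding M N j -> M x -> (ordinal x <-> ordinal (j x)).
Proof.
move=> E Mx.
apply: (@emb_D0 _ _ _ _ (fun e => ordinal (e 0)) (fun _ => x) E) => //.
by apply: D0_ordinal; bounded.
Qed.

(** If [j x ∈ x], applying [j] gives [j (j x) ∈ j x], against the induction hypothesis at [j x];
    transitivity of [M] keeps [j x] in the domain. *)
Lemma emb_ord_ge M N j x : embedding M N j -> transitive_class M -> ordinal x -> M x ->
  ole x (j x).
Proof.
move=> E HM; elim/(well_founded_induction (mem_wf (V := V))): x => x IH Hx Mx.
have Hj := proj1 (emb_ordinal E Mx) Hx.
case: (ord_total Hx Hj) => [|[|H]]; rewrite /ole; auto.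
have Mj := HM _ _ Mx H.
have := proj1 (emb_mem E Mj Mx) H.
case: (IH _ H (ord_mem Hx H) Mj) => [/mem_asym//|<- /mem_irrefl //].
Qed.

End Ordinals.

(** * The measures in [V] *)

Section Measures.
Context {V : zfc_universe}.
Implicit Types (a b c f g x y z ξ η i k W : V).
Local Notation env := (@env V).

(** For fixed [x], [y], [f] this is a bounded formula; [measure_in] results from letting the three
    range over the model. *)
Definition measure_axioms k W x y f : Prop :=
  (forall u, u ∈ k -> u ⊆ k) /\
  (x ∈ W -> x ⊆ k) /\ k ∈ W /\ emptyset ∉ W /\
  (x ∈ W -> x ⊆ y -> y ⊆ k -> y ∈ W) /\
  (x ∈ W -> y ∈ W -> inter x y ∈ W) /\
  (x ⊆ k -> x ∈ W \/ setminus k x ∈ W) /\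
  (sep k (fun z => appd f z ∈ z) ∈ W ->
     exists y, y ∈ k /\ sep k (fun z => appd f z = y) ∈ W) /\
  (forall ξ, ξ ∈ k -> sep k (fun z => appd f z ∈ ξ) ∈ W ->
    exists y, y ∈ ξ /\ sep k (fun z => appd f z = y) ∈ W) /\
  (forall ξ, ξ ∈ k -> sep k (fun z => ξ ∈ z) ∈ W).

Lemma measure_in_intro (M : V -> Prop) k W : transitive_class M -> M k -> M W ->
  (forall x y f, M x -> M y -> M f -> measure_axioms k W x y f) -> measure_in M k W.
Proof.
move=> HM Mk MW H.
have MinW x : x ∈ W -> M x by exact: HM.
split=> //.
- move=> x y Hx; case: (H k k k Mk Mk Mk) => H0 _; exact: H0.
- by move=> x Hx; case: (H x x x) => [|||_ [H1 _]]; auto.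
- by case: (H k k k Mk Mk Mk) => _ [_ []].
- by case: (H k k k Mk Mk Mk) => _ [_ [_ []]].
- move=> x y Hx My; case: (H x y y) => [|||_ [_ [_ [_ [H1 _]]]]]; auto.
- move=> x y Hx Hy; case: (H x y y) => [|||_ [_ [_ [_ [_ [H1 _]]]]]]; auto.
- move=> x Mx; case: (H x x x) => [|||_ [_ [_ [_ [_ [_ [H1 _]]]]]]]; auto.
- move=> f Mf; case: (H f f f) => [|||_ [_ [_ [_ [_ [_ [_ [H1 _]]]]]]]]; auto.
- move=> f ξ Mf; case: (H f f f) => [|||_ [_ [_ [_ [_ [_ [_ [_ [H1 _]]]]]]]]]; auto.
- by case: (H k k k Mk Mk Mk) => _ [_ [_ [_ [_ [_ [_ [_ [_ H1]]]]]]]].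
Qed.

Variables (k W : V).
Hypothesis Hord : ordinal k.
Hypothesis HW : normal_ultrafilter k W.

Lemma uf_disjoint x y : x ∈ W -> y ∈ W -> (forall u, u ∈ k -> u ∈ x -> u ∉ y) -> False.
Proof.
case: HW => [[H1 [_ [H2 [_ [H3 _]]]]] _] Hx Hy H; apply: H2.
have <- : inter x y = emptyset; last exact: H3.
apply: set_ext => u; rewrite in_inter; split; last by move/in_emptyset.
by move=> [Hux Huy]; case: (H u) => //; exact: (H1 x).
Qed.

Lemma uf_compl x : x ⊆ k -> x ∉ W -> setminus k x ∈ W.
Proof. by case: HW => [[_ [_ [_ [_ [_ H]]]]] _] Hx Hn; case: (H x Hx). Qed.

(** Otherwise the ordinals up to [ξ] form a set in the ultrafilter. Their singletons have
    complements in it, and completeness removes all points below [ξ], one more intersection removes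
    [ξ], and nothing is left. *)
Lemma uf_tail ξ : ξ ∈ k -> sep k (fun z => ξ ∈ z) ∈ W.
Proof.
move=> Hξ; apply: NNPP => Hn.
have H1 := uf_compl (@sep_sub _ _ _) Hn.
have Hc η : η ∈ k -> setminus k (singleton η) ∈ W.
  move=> Hη; apply: uf_compl; last by case: HW => _ [H _]; exact: H.
  by move=> z /in_singleton ->.
have H2 : sep k (fun x => forall i, i ∈ ξ -> x ∈ setminus k (singleton i)) ∈ W.
  case: HW => _ [_ [H _]]; apply: (H ξ (fun i => setminus k (singleton i))) => //.
  by move=> i Hi; apply: Hc; exact: ord_trans Hord Hξ Hi.
have H3 : inter (setminus k (sep k (fun z => ξ ∈ z))) (setminus k (singleton ξ)) ∈ W.
  by case: HW => [[_ [_ [_ [_ [H _]]]]] _]; apply: H => //; exact: Hc.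
apply: (uf_disjoint H3 H2) => u Hu.
rewrite in_inter !in_setminus !in_sep in_singleton => -[[_ Hu1] [_ Hu2]] [_ Hu3].
have [H|[//|H]] := ord_total (ord_mem Hord Hu) (ord_mem Hord Hξ).
  by have := Hu3 u H; rewrite in_setminus in_singleton; tauto.
by tauto.
Qed.

Lemma normal_measure_axioms x y f : measure_axioms k W x y f.
Proof.
have HW' := HW; case: HW' => [[H1 [H2 [H3 [H4 [H5 H6]]]]] [_ [H7 H8]]].
split; first by move=> u Hu z; exact: ord_trans.
do !split=> //.
- exact: H1.
- exact: H4.
- exact: H5.
- exact: H6.
(* Pressing down: if no fibre of [f] is in the ultrafilter, the diagonal intersection of the
   complements is, and no point of it can have [f] regressive. *)
- move=> HS; apply: NNPP => Hn.
  have Hc i : i ∈ k -> setminus k (sep k (fun z => appd f z = i)) ∈ W.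
    by move=> Hi; apply: uf_compl; [exact: sep_sub|move=> H; apply: Hn; exists i].
  apply: (uf_disjoint HS (H8 _ Hc)) => u Hu; rewrite !in_sep => -[_ Hf] [_ H].
  have := H _ Hf; rewrite in_setminus in_sep; tauto.
- move=> ξ Hξ HS; apply: NNPP => Hn.
  have Hc i : i ∈ ξ -> setminus k (sep k (fun z => appd f z = i)) ∈ W.
    by move=> Hi; apply: uf_compl; [exact: sep_sub|move=> H; apply: Hn; exists i].
  apply: (uf_disjoint HS (H7 _ _ Hξ Hc)) => u Hu; rewrite !in_sep => -[_ Hf] [_ H].
  have := H _ Hf; rewrite in_setminus in_sep; tauto.
- exact: uf_tail.
Qed.

Lemma uf_unbounded ξ x : ξ ∈ k -> x ∈ W -> exists u, u ∈ x /\ ξ ∈ u.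
Proof.
move=> Hξ Hx; apply: NNPP => Hn; apply: (uf_disjoint Hx (uf_tail Hξ)) => u Hu Hux.
by rewrite in_sep => -[_ Hξu]; apply: Hn; exists u.
Qed.

End Measures.

(** * Direct limits *)

Section DirectLimit.
Context {V : zfc_universe}.
Implicit Types (a b c f g x y z ξ η i k m δ : V).
Local Notation env := (@env V).

Variables (M : V -> V -> Prop) (π : V -> V -> V -> V) (δ : V).
Hypothesis Hδ : limit_ordinal δ.
Hypothesis HM : forall i, i ∈ δ -> transitive_class (M i).
Hypothesis HE : forall i m, m ∈ δ -> ole i m -> embedding (M i) (M m) (π i m).
Hypothesis Hcomp : forall i m x, ole i m -> m ∈ δ -> M i x -> π i δ x = π m δ (π i m x).
Hypothesis HL : direct_limit M π δ.

Lemma limit_mem i x y : i ∈ δ -> M i x -> M i y -> (x ∈ y <-> π i δ x ∈ π i δ y).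
Proof.
case: HL => [_ [H _]] Hi Mx My; rewrite (proj2 (H i i x y Hi Hi Mx My)); split.
  move=> Hxy; have Hii : ole i i by right.
  exists i; do 3!split=> //; exact: (proj1 (emb_mem (HE Hi Hii) Mx My)).
by move=> [m [Hm [Him [_ Hmem]]]]; exact: (proj2 (emb_mem (HE Hm Him) Mx My)).
Qed.

(** The representing stage is taken at or above [i], so that it also holds the images of parameters
    from [M i]. *)
Lemma limit_rep i z : i ∈ δ -> M δ z -> exists m x, m ∈ δ /\ ole i m /\ M m x /\ z = π m δ x.
Proof.
case: HL => [_ [_ H]] Hi /H [m [x [Hm [Mx ->]]]].
have [Hord _] := Hδ.
have [Him|[Him|Hmi]] := ord_total (ord_mem Hord Hi) (ord_mem Hord Hm).
- by exists m, x; do !split=> //; left.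
- by exists m, x; do !split=> //; right.
- exists i, (π m i x); have Hle : ole m i by left.
  by do !split=> //; [right|exact: (emb_maps (HE Hi Hle))|exact: Hcomp].
Qed.

(** The induction covers all stages at once: an element of [π i δ (e n)] may appear only at a later
    stage [m], so the universal formula is moved from [i] to [m] and the induction hypothesis is
    used there. *)
Lemma limit_sat φ : forall i (e : env), i ∈ δ -> (forall n, M i (e n)) ->
  (sat φ e <-> sat φ (fun n => π i δ (e n))).
Proof.
elim: φ => [n m|φ IH|φ IH1 ψ IH2|n φ IH] i e Hi He /=.
- exact: limit_mem.
- by rewrite (IH i).
- by rewrite (IH1 i) // (IH2 i).
- have Epush z : (π i δ z .: fun n => π i δ (e n)) = (fun n => π i δ ((z .: e) n)).
    by extensionality u; case: u.
  split=> H z Hz; last first.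
    have Mz : M i z := HM Hi (He n) Hz.
    have Mze u : M i ((z .: e) u) by case: u.
    rewrite (IH i) // -Epush; apply: H.
    exact: (proj1 (limit_mem Hi Mz (He n)) Hz).
  have Mz : M δ z.
    case: (HL) => [HT [_ Hrep]]; apply: (HT _ _ _ Hz); apply/Hrep; by exists i, (e n).
  have [m [x [Hm [Him [Mx Ez]]]]] := limit_rep Hi Mz.
  have Hpi u : π i δ (e u) = π m δ (π i m (e u)) by exact: Hcomp.
  have Me u := emb_maps (HE Hm Him) (He u).
  rewrite Ez Hpi -limit_mem // in Hz.
  have {}H := proj1 (emb_sat (HE Hm Him) (FAll n φ) He) H.
  have Mxe u : M m ((x .: fun n => π i m (e n)) u) by case: u.
  move: (proj1 (IH m _ Hm Mxe) (H x Hz)).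
  suff -> : (fun u => π m δ ((x .: fun n => π i m (e n)) u)) = (z .: fun n => π i δ (e n)) by [].
  by extensionality u; case: u => [|u] //=.
Qed.

Lemma limit_embedding i : i ∈ δ -> embedding (M i) (M δ) (π i δ).
Proof.
move=> Hi; split.
- move=> x Mx; case: HL => [_ [_ H]]; apply/H; by exists i, x.
- by move=> φ e He; exact: limit_sat.
- move=> y /(limit_rep Hi) [m [x [Hm [Him [Mx ->]]]]].
  have [u [Mu Hxu]] := emb_cofinal (HE Hm Him) Mx.
  exists u; split=> //; rewrite (Hcomp Him Hm Mu).
  exact: (proj1 (limit_mem Hm Mx (emb_maps (HE Hm Him) Mu)) Hxu).
Qed.

End DirectLimit.

(** * The imitation iteration *)

Section Iteration.
Context {V : zfc_universe}.
Implicit Types (a b c d f g x y z ξ η i k m δ : V).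
Local Notation env := (@env V).

Variables (D α κ Us : V).
Hypothesis HD : monotone_enumeration D α κ.
Hypothesis Hdiscrete : discrete D.
Hypothesis Hmeasurable : forall d, d ∈ D -> measurable d.
Hypothesis HUs : fun_on Us α.
Hypothesis Hnormal : forall i, i ∈ α -> normal_ultrafilter (app κ i) (app Us i).

(** * The enumeration of the discrete set of measurable cardinals *)

Lemma ord_alpha : ordinal α.
Proof. by case: HD. Qed.

Lemma kappa_fun : fun_on κ α.
Proof. by case: HD => _ []. Qed.

Lemma kappa_ord i : i ∈ α -> ordinal (app κ i).
Proof.
move=> Hi; have : app κ i ∈ D by case: HD => _ [_ [_ H]]; apply/H; exists i.
by move=> /Hmeasurable [[]].
Qed.

Lemma kappa_mono i k : k ∈ α -> i ∈ k -> app κ i ∈ app κ k.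
Proof. by case: HD => _ [_ [H _]]; exact: H. Qed.

Lemma kappa_nonempty i : i ∈ α -> exists b, b ∈ app κ i.
Proof.
move=> Hi; apply: NNPP => Hn; case: (Hnormal Hi) => [[_ [H1 [H2 _]]] _].
apply: H2; suff <- : app κ i = emptyset by [].
by apply: set_ext => z; split=> [Hz|/in_emptyset//]; case: Hn; exists z.
Qed.

(** Without such a bound the earlier cardinals would be cofinal in [app κ i], making it a limit
    point of [D]. *)
Lemma kappa_discrete i : i ∈ α ->
  exists b, b ∈ app κ i /\ forall k, k ∈ i -> app κ k ⊆ b.
Proof.
move=> Hi.
have HDi : app κ i ∈ D by case: HD => _ [_ [_ H]]; apply/H; exists i.
apply: NNPP => Hn; apply: (Hdiscrete HDi); split; first exact: kappa_ord.
split; first exact: kappa_nonempty.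
move=> b Hb; apply: NNPP => Hc; apply: Hn; exists b; split=> // k Hk.
have Hkα := ord_trans ord_alpha Hi Hk.
have Hbo := ord_mem (kappa_ord Hi) Hb.
have [H|[<-//|H]] := ord_total (kappa_ord Hkα) Hbo.
  by move=> z; exact: ord_trans.
case: Hc; exists (app κ k); split; last by split=> //; exact: kappa_mono.
by case: HD => _ [_ [_ H']]; apply/H'; exists k.
Qed.

(** Otherwise every element of [app κ i] is an element of [i]. The bound [b] from discreteness is
    then an index below [i], and by induction [b ∈ app κ b ⊆ b]. *)
Lemma kappa_above i : i ∈ α -> i ∈ app κ i.
Proof.
elim/(well_founded_induction (mem_wf (V := V))): i => i IH Hi.
apply: NNPP => Hn.
have Hio := ord_mem ord_alpha Hi.
have Hsub b : b ∈ app κ i -> b ∈ i.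
  by have [//|[<-//|H]] := ord_total Hio (kappa_ord Hi); exact: ord_trans.
have [b [Hb Hsup]] := kappa_discrete Hi.
have Hbi := Hsub _ Hb; have Hbα := ord_trans ord_alpha Hi Hbi.
exact: (mem_irrefl (Hsup b Hbi b (IH b Hbi Hbα))).
Qed.

Variables (αt : V) (M : V -> V -> Prop) (π : V -> V -> V -> V).
Hypothesis Hiter : imitation_iteration α κ Us αt M π.

Let M0 : M emptyset = (fun _ => True).
Proof.
extensionality x; apply: propositional_extensionality; split=> // _.
exact: (it_zero Hiter).
Qed.

(** * Transfer of these facts to a single stage *)

Section Stage.
Variables (N : V -> Prop) (j : V -> V).
Hypothesis HN : transitive_class N.
Hypothesis E : embedding (fun _ => True) N j.

Lemma stage_kappa_fun : fun_on (j κ) (j α).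
Proof. exact: (proj1 (emb_fun_on E I I) kappa_fun). Qed.

Lemma stage_Us_fun : fun_on (j Us) (j α).
Proof. exact: (proj1 (emb_fun_on E I I) HUs). Qed.

Lemma stage_facts i : i ∈ j α -> ordinal (app (j κ) i) /\ i ∈ app (j κ) i /\
  forall k, k ∈ i -> app (j κ) k ∈ app (j κ) i.
Proof.
move=> Hi.
have HQ : Delta0 (fun e : env => ordinal (e 0) /\ forall i, i ∈ e 0 -> ordinal (appd (e 1) i) /\ i ∈ appd (e 1) i /\
  forall k, k ∈ i -> appd (e 1) k ∈ appd (e 1) i).
  by bounded; apply: D0_ordinal; bounded.
have := proj1 (emb_D0 (e := α .: fun _ => κ) E HQ (fun _ => I)) => /= -[].
  split; first exact: ord_alpha.
  move=> k Hk; rewrite -!(fun_on_app kappa_fun Hk).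
  split; first exact: kappa_ord.
  split; first exact: kappa_above.
  move=> m Hm; rewrite -(fun_on_app kappa_fun (ord_trans ord_alpha Hk Hm)).
  exact: kappa_mono.
move=> Ho /(_ i Hi); rewrite -!(fun_on_app stage_kappa_fun Hi) => -[H1 [H2 H3]].
do 2!split=> //; move=> k Hk; rewrite (fun_on_app stage_kappa_fun (ord_trans Ho Hi Hk)).
exact: H3.
Qed.

Lemma class_opair x y : N (opair x y) -> N x /\ N y.
Proof.
move=> Hp; have H1 : N (upair x y) by apply: (HN Hp); rewrite in_opair; auto.
by split; apply: (HN H1); rewrite in_upair; auto.
Qed.

Lemma class_app f a x : N f -> fun_on f a -> x ∈ a -> N (app f x).
Proof.
move=> Nf Hf Hx; rewrite (fun_on_app Hf Hx).
by case: (class_opair (HN Nf (fun_on_opair Hf Hx))).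
Qed.

Lemma stage_measure i : i ∈ j α -> measure_in N (app (j κ) i) (app (j Us) i).
Proof.
move=> Hi.
have Nj x : N (j x) by exact: (emb_maps E).
apply: measure_in_intro => //; try exact: (class_app (Nj _) stage_kappa_fun Hi);
  try exact: (class_app (Nj _) stage_Us_fun Hi).
(* [x], [y], [f] need not be images under [j]. Cofinality puts them into one [j c], and the axioms
   for all members of [c] form a bounded statement. *)
move=> x y f /(emb_cofinal E) [ax [_ Hx]] /(emb_cofinal E) [ay [_ Hy]] /(emb_cofinal E) [af [_ Hf]].
have [b [Hb1 Hb2]] := pair_cover ax ay; have [c [Hc1 Hc2]] := pair_cover b af.
have {}Hx := proj1 (emb_sub E I I) Hc1 _ (proj1 (emb_sub E I I) Hb1 _ Hx).
have {}Hy := proj1 (emb_sub E I I) Hc1 _ (proj1 (emb_sub E I I) Hb2 _ Hy).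
have {}Hf := proj1 (emb_sub E I I) Hc2 _ Hf.
have HQ : Delta0 (fun e : env => forall i, i ∈ e 0 -> forall x, x ∈ e 3 ->
    forall y, y ∈ e 3 -> forall f, f ∈ e 3 -> measure_axioms (appd (e 1) i) (appd (e 2) i) x y f).
  by rewrite /measure_axioms; bounded.
have := proj1 (emb_D0 (e := α .: κ .: Us .: fun _ => c) E HQ (fun _ => I)) => /= H.
rewrite (fun_on_app stage_kappa_fun Hi) (fun_on_app stage_Us_fun Hi).
apply: (H _ i Hi x Hx y Hy f Hf) => {x Hx y Hy f Hf} k Hk x _ y _ f _.
rewrite -(fun_on_app kappa_fun Hk) -(fun_on_app HUs Hk).
by apply: normal_measure_axioms; [exact: kappa_ord|exact: Hnormal].
Qed.

End Stage.

(** [st_le] keeps the construction going: with the minimality of [αt] it gives [k ∈ π emptyset k α]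
    for [k ∈ αt], the condition under which [it_succ] provides the next ultrapower. Hence it is
    proved in the same induction as elementarity. *)
Record stage k : Prop := Stage {
  st_trans : transitive_class (M k);
  st_emb : forall i, ole i k -> embedding (M i) (M k) (π i k);
  st_le : ole k (π emptyset k α)
}.

Lemma ord_at : ordinal αt.
Proof. exact: (it_ord Hiter). Qed.

Lemma stage_emb0 k : stage k -> ordinal k -> embedding (fun _ => True) (M k) (π emptyset k).
Proof. by move=> H Ho; rewrite -M0; apply: (st_emb H); exact: ord_zero. Qed.

Lemma stage_inner k : stage k -> ordinal k -> inner_model (M k).
Proof.
by move=> H Ho; apply: inner_model_of_embedding (stage_emb0 H Ho); exact: st_trans.
Qed.

Lemma stage_alpha k : stage k -> k ∈ αt -> k ∈ π emptyset k α.
Proof. by move=> H Hk; case: (st_le H) => // E; case: (it_least Hiter Hk). Qed.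

Lemma embedding_id (N : V -> Prop) j : transitive_class N -> (forall x, N x -> j x = x) ->
  (forall y, N y -> exists x, N x /\ y ∈ x) -> embedding N N j.
Proof.
move=> HN Hj Hcof; split.
- by move=> x Nx; rewrite Hj.
- move=> φ e He; suff -> : (fun n => j (e n)) = e by [].
  by extensionality n; rewrite Hj.
- by move=> y /Hcof [x [Nx Hy]]; exists x; rewrite Hj.
Qed.

Lemma inner_singleton (N : V -> Prop) x : inner_model N -> N x -> N (singleton x).
Proof.
by move=> HN Nx; apply: (im_simple HN (t := fun e => singleton (e 0)) (e := fun _ => x)); bounded.
Qed.

Lemma emb_id k : ole k αt -> inner_model (M k) -> embedding (M k) (M k) (π k k).
Proof.
move=> Hk HI; apply: embedding_id.
- exact: im_trans.
- by move=> x; exact: (it_id Hiter).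
- by move=> y My; exists (singleton y); rewrite in_singleton; split=> //; exact: inner_singleton.
Qed.

(** * One ultrapower step of the iteration *)

Section Ultrapower_step.
Variable i : V.
Hypothesis Hi : i ∈ αt.
Hypothesis HS : stage i.

Let Ho : ordinal i := ord_mem ord_at Hi.
Let lam : V := critical_point κ π i.

Lemma lam_measure : measure_in (M i) lam (app (π emptyset i Us) i).
Proof.
by apply: (stage_measure (st_trans HS) (stage_emb0 HS Ho)); exact: stage_alpha.
Qed.

Lemma lam_above : i ∈ lam.
Proof. by case: (stage_facts (stage_emb0 HS Ho) (stage_alpha HS Hi)) => _ []. Qed.

Lemma lam_ord : ordinal lam.
Proof. by case: (stage_facts (stage_emb0 HS Ho) (stage_alpha HS Hi)). Qed.

Let HU := it_succ Hiter Hi (stage_alpha HS Hi).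

Lemma succ_trans : transitive_class (M (succ i)).
Proof. by case: HU. Qed.

Lemma succ_embedding : embedding (M i) (M (succ i)) (π i (succ i)).
Proof.
case: HU => HT [cl [H1 [H2 H3]]].
exact: (ultrapower_embedding (stage_inner HS Ho) lam_measure HT
  (fun f g Mf Ff Mg Fg => proj2 (H1 f g Mf Ff Mg Fg)) H2 H3).
Qed.

Lemma succ_fix ξ : ξ ∈ lam -> π i (succ i) ξ = ξ.
Proof.
case: HU => HT [cl [H1 [H2 H3]]].
exact: (ultrapower_fix (stage_inner HS Ho) lam_measure HT
  (fun f g Mf Ff Mg Fg => proj2 (H1 f g Mf Ff Mg Fg)) H2 H3).
Qed.

Lemma succ_moves : lam ∈ π i (succ i) lam.
Proof.
case: HU => HT [cl [H1 [H2 H3]]].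
exact: (ultrapower_moves (stage_inner HS Ho) lam_measure HT
  (fun f g Mf Ff Mg Fg => proj2 (H1 f g Mf Ff Mg Fg)) H2 H3).
Qed.

Lemma succ_rep y : M (succ i) y ->
  exists f, M i f /\ fun_on f lam /\ y = appd (π i (succ i) f) lam.
Proof.
case: HU => HT [cl [H1 [H2 H3]]].
exact: (ultrapower_rep (stage_inner HS Ho) lam_measure HT
  (fun f g Mf Ff Mg Fg => proj2 (H1 f g Mf Ff Mg Fg)) H2 H3).
Qed.

End Ultrapower_step.

Lemma ole_succ i k : ole i (succ k) -> ole i k \/ i = succ k.
Proof. by move=> [|]; rewrite ?in_succ /ole; tauto. Qed.

Theorem stages k : ole k αt -> stage k.
Proof.
elim/(well_founded_induction (mem_wf (V := V))): k => k IH Hk.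
have Hord := ole_ord ord_at Hk.
have Hbelow i : i ∈ k -> stage i.
  by move=> Hi; apply: IH => //; left; exact: ole_mem ord_at Hk Hi.
case: (ord_cases Hord) => [E|[[b [Hb E]]|Hlim]].
- have HT : transitive_class (M k) by rewrite E M0.
  split=> //.
    move=> i [Hi|->]; first by rewrite E in Hi; case: (in_emptyset Hi).
    apply: embedding_id => //; first by move=> x; exact: (it_id Hiter).
    by move=> y _; exists (singleton y); rewrite in_singleton E M0; split.
  have -> : π emptyset k α = α.
    by rewrite E; apply: (it_id Hiter); [rewrite -E|exact: (it_zero Hiter)].
  rewrite E; exact: (ord_zero ord_alpha).
- have Hbt : b ∈ αt by exact: ole_mem ord_at Hk Hb.
  have HSb := Hbelow _ Hb.
  have Hbo := ord_mem Hord Hb.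
  have HT : transitive_class (M k) by rewrite E; exact: succ_trans.
  have Es : embedding (M b) (M k) (π b k) by rewrite E; exact: succ_embedding.
  have Hcomp i x : ole i b -> M i x -> π i k x = π b k (π i b x).
    by move=> Hi Mx; apply: (it_comp Hiter) => //; left.
  have Hmid i : ole i b -> embedding (M i) (M k) (π i k).
    move=> Hi; have HSi : stage i by case: Hi => [Hi|->//]; apply: Hbelow; exact: ord_trans Hb Hi.
    have Hio := ole_ord Hbo Hi.
    apply: (emb_comp (stage_inner HSi Hio) (stage_inner HSb Hbo) (st_emb HSb Hi) Es).
    by move=> x; exact: Hcomp.
  have E0 : embedding (fun _ => True) (M k) (π emptyset k).
    by rewrite -M0; apply: Hmid; exact: ord_zero.
  split=> //.
    move=> i; rewrite {1}E => /ole_succ [|Ei]; first exact: Hmid.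
    by rewrite -E in Ei; rewrite Ei; apply: emb_id => //; exact: inner_model_of_embedding E0.
  (* For [st_le]: [b] is below [π emptyset b α], which is at most its image under [π b k]; hence
     [succ b] is at most that image. *)
  have Eα : π emptyset k α = π b k (π emptyset b α).
    by apply: Hcomp; [exact: ord_zero|exact: (it_zero Hiter)].
  have Eb := stage_emb0 HSb Hbo.
  have Hoα := proj1 (emb_ordinal (x := α) Eb I) ord_alpha.
  have Hle := emb_ord_ge Es (st_trans HSb) Hoα (emb_maps Eb I).
  have Hoα' := proj1 (emb_ordinal Es (emb_maps Eb I)) Hoα.
  rewrite Eα {1}E; apply: ole_trans Hle => //.
  by apply: succ_ole => //; exact: stage_alpha.
- have HL := it_lim Hiter Hk Hlim.
  have HT : transitive_class (M k) by case: HL.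
  have HEm i m : m ∈ k -> ole i m -> embedding (M i) (M m) (π i m).
    by move=> Hm; apply: st_emb; exact: Hbelow.
  have Hcomp i m x : ole i m -> m ∈ k -> M i x -> π i k x = π m k (π i m x).
    by move=> Hi Hm Mx; apply: (it_comp Hiter) => //; left.
  have Hmid i : i ∈ k -> embedding (M i) (M k) (π i k).
    apply: (limit_embedding Hlim _ HEm Hcomp HL).
    by move=> m /Hbelow; exact: st_trans.
  have Hk0 : emptyset ∈ k.
    by case: (ord_zero Hord) => // E; case: Hlim => _ [[x Hx] _]; rewrite -E in Hx; case: (in_emptyset Hx).
  have E0 : embedding (fun _ => True) (M k) (π emptyset k) by rewrite -M0; exact: Hmid.
  split=> //.
    move=> i [|->]; first exact: Hmid.
    by apply: emb_id => //; exact: inner_model_of_embedding E0.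
  have Hoα := proj1 (emb_ordinal (x := α) E0 I) ord_alpha.
  case: (ord_total Hord Hoα) => [|[|Hm]]; rewrite /ole; auto.
  (* Suppose the image [m] of [α] at the limit were below [k]. Then [m] is below [π emptyset m α],
     which is at most its image under [π m k]; but that image is [m] itself. *)
  have Hmt : π emptyset k α ∈ αt by exact: ole_mem ord_at Hk Hm.
  set m := π emptyset k α in Hm Hmt Hoα.
  have HSm := Hbelow _ Hm.
  have Em := stage_emb0 HSm Hoα.
  have Hom := proj1 (emb_ordinal (x := α) Em I) ord_alpha.
  have Hle := emb_ord_ge (Hmid _ Hm) (st_trans HSm) Hom (emb_maps Em I).
  have Ec : π m k (π emptyset m α) = m.
    by rewrite -Hcomp //; [exact: ord_zero|exact: (it_zero Hiter)].
  rewrite Ec in Hle; have := ole_mem Hoα Hle (stage_alpha HSm Hmt).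
  by move/mem_irrefl.
Qed.

Lemma stage_at i : i ∈ αt -> stage i.
Proof. by move=> Hi; apply: stages; left. Qed.

(** * The critical sequence *)

Local Notation lam := (critical_point κ π).

Lemma M_lam i : i ∈ αt -> M i (lam i).
Proof. by move=> Hi; exact: (mi_card (lam_measure Hi (stage_at Hi))). Qed.

Lemma M_below_lam i ξ : i ∈ αt -> ξ ∈ lam i -> M i ξ.
Proof. by move=> Hi; apply: (st_trans (stage_at Hi)); exact: M_lam. Qed.

(** As [i] is fixed, [π i m] sends [lam i] to entry [i] of the sequence at stage [m], which lies
    below entry [m], that is [lam m]; and [lam i] is at most its image. The induction in
    [below_lam_fix] supplies the fixedness of [i] at each stage. *)
Lemma lam_increasing_of_fix i m : m ∈ αt -> i ∈ m -> π i m i = i -> lam i ∈ lam m.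
Proof.
move=> Hm Him Hfix.
have Hi : i ∈ αt := ord_trans ord_at Hm Him.
have HSi := stage_at Hi; have HSm := stage_at Hm.
have Hio := ord_mem ord_at Hi; have Hmo := ord_mem ord_at Hm.
have Ei := stage_emb0 HSi Hio; have Em := stage_emb0 HSm Hmo.
have [Hom [_ Hmono]] := stage_facts Em (stage_alpha HSm Hm).
have Him' : ole i m by left.
have Eim := st_emb HSm Him'.
have Mκ := emb_maps Ei (x := κ) I.
have Fi := stage_kappa_fun Ei; have Fm := stage_kappa_fun Em.
have Hiα := stage_alpha HSi Hi.
have Hc : π emptyset m κ = π i m (π emptyset i κ).
  apply: (it_comp Hiter) => //; [exact: ord_zero|by left|exact: (it_zero Hiter)].
have Hiαm : i ∈ π emptyset m α.
  apply: ord_trans (stage_alpha HSm Hm) Him; exact: (proj1 (emb_ordinal (x := α) Em I) ord_alpha).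
have Elam : app (π emptyset m κ) i = π i m (lam i).
  have Mlam := M_lam Hi; rewrite /critical_point (fun_on_app Fi Hiα) in Mlam.
  have Mi : M i i by apply: (st_trans HSi) Hiα; exact: (emb_maps Ei).
  rewrite (fun_on_app Fm Hiαm) Hc /critical_point (fun_on_app Fi Hiα).
  by rewrite (emb_appd Eim Mκ Mi Mlam) Hfix.
have Hle := emb_ord_ge Eim (st_trans HSi) (lam_ord Hi HSi) (M_lam Hi).
case: (Hle) => [H|->]; last by rewrite -Elam; exact: Hmono.
by apply: (ord_trans Hom (Hmono _ Him)); rewrite Elam.
Qed.

(** Induction on [k]. At successors [ξ] is below the next critical point because critical points
    increase. At limits a second induction, on [ξ], is needed: an element of [π i k ξ] comes from an
    element of [π i m ξ] at an earlier stage [m], and this set is [ξ]. *)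
Theorem below_lam_fix i k ξ : i ∈ αt -> ole i k -> ole k αt -> ξ ∈ lam i -> π i k ξ = ξ.
Proof.
move=> Hi; elim/(well_founded_induction (mem_wf (V := V))): k ξ => k IH ξ Hik Hk Hξ.
have Hord := ole_ord ord_at Hk.
case: Hik => [Hik|E]; last by rewrite -E; apply: (it_id Hiter); [left|exact: M_below_lam].
have HSi := stage_at Hi.
case: (ord_cases Hord) => [E|[[b [Hb E]]|Hlim]].
- by rewrite E in Hik; case: (in_emptyset Hik).
- have Hbt : b ∈ αt by exact: ole_mem ord_at Hk Hb.
  have Hib : ole i b by rewrite E in_succ in Hik.
  have Hbk : ole b αt by left.
  have Hlb : ξ ∈ lam b.
    case: Hib => [Hib|<-//].
    apply: (ord_trans (lam_ord Hbt (stage_at Hbt))) Hξ.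
    apply: lam_increasing_of_fix => //; apply: IH => //; [by left|].
    exact: (lam_above Hi HSi).
  have -> : π i k ξ = π b k (π i b ξ).
    by apply: (it_comp Hiter) => //; [left|exact: M_below_lam].
  rewrite IH // E; exact: (succ_fix Hbt (stage_at Hbt)).
- have HL := it_lim Hiter Hk Hlim.
  have HSk := stages Hk.
  have Hik' : ole i k by left.
  have Eik := st_emb HSk Hik'.
  elim/(well_founded_induction (mem_wf (V := V))): ξ Hξ => ξ IHξ Hξ.
  have Mξ := M_below_lam Hi Hξ.
  have Hsub z : z ∈ ξ -> z ∈ lam i by exact: (ord_trans (lam_ord Hi HSi) Hξ).
  apply: set_ext => z; split=> Hz; last first.
    rewrite -(IHξ z Hz (Hsub _ Hz)).
    exact: (proj1 (emb_mem Eik (M_below_lam Hi (Hsub _ Hz)) Mξ) Hz).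
  have HEm i' m : m ∈ k -> ole i' m -> embedding (M i') (M m) (π i' m).
    by move=> Hm; apply: st_emb; apply: stage_at; exact: ole_mem ord_at Hk Hm.
  have Hcomp i' m x : ole i' m -> m ∈ k -> M i' x -> π i' k x = π m k (π i' m x).
    by move=> Hi' Hm Mx; apply: (it_comp Hiter) => //; left.
  have Mz : M k z by apply: (st_trans HSk _ Hz); exact: (emb_maps Eik).
  have [m [x [Hm [Him [Mx Ez]]]]] := limit_rep Hlim HEm Hcomp HL Hik Mz.
  have Hmt : ole m αt by left; exact: ole_mem ord_at Hk Hm.
  have Hmk : ole m k by left.
  have Hfix y : y ∈ lam i -> π i m y = y by exact: IH.
  have Emk := st_emb HSk Hmk.
  have Mmξ : M m ξ by rewrite -(Hfix ξ Hξ); exact: (emb_maps (HEm _ _ Hm Him)).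
  move: Hz; rewrite Ez (Hcomp i m ξ Him Hm Mξ) (Hfix ξ Hξ).
  move=> /(proj2 (emb_mem Emk Mx Mmξ)) Hx.
  rewrite -{1}(Hfix x (Hsub _ Hx)) -(Hcomp i m x Him Hm); last by rewrite IHξ //; exact: Hsub.
  exact: (M_below_lam Hi (Hsub _ Hx)).
Qed.

Lemma lam_fix i : i ∈ αt -> π (succ i) αt (lam i) = lam i.
Proof.
move=> Hi; have HSi := stage_at Hi; have Ho := ord_mem ord_at Hi.
have Hmem : lam i ∈ π i (succ i) (lam i) := succ_moves Hi HSi.
have HSs := stages (succ_ole ord_at Hi).
have Ei : embedding (M i) (M (succ i)) (π i (succ i)) := succ_embedding Hi HSi.
(* If [succ i] is the last stage, the map is the identity; otherwise [lam i] lies below the next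
   critical point. *)
have [Hs|Hs] := succ_ole ord_at Hi; last first.
  rewrite -{1}Hs; apply: (it_id Hiter); first by rewrite Hs; right.
  by apply: (st_trans HSs) Hmem; apply: (emb_maps Ei); exact: M_lam.
apply: (below_lam_fix Hs); [by left|by right|].
apply: (lam_increasing_of_fix Hs); first by rewrite in_succ; right.
exact: (succ_fix Hi HSi (lam_above Hi HSi)).
Qed.

End Iteration.

(** * Boolean values *)

Section BooleanValues.
Context {V : zfc_universe}.
Implicit Types (B P r b c p q t x y z X F C Y σ τ ρ : V).
Local Notation env := (@env V).

Record preorder P r : Prop := Preorder {
  po_dom : forall q p, opair q p ∈ r -> q ∈ P /\ p ∈ P;
  po_refl : forall p, p ∈ P -> opair p p ∈ r;
  po_trans : forall t q p, opair t q ∈ r -> opair q p ∈ r -> opair t p ∈ r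
}.

(** With [E] as the value of equality, [bmem] is the value of membership and [bhalf] that of
    inclusion. Keeping [E] a parameter lets the same bounded expression be read with [bv_eq] or with
    a set function approximating it. *)
Definition bmem P r (E : V -> V -> V) ρ τ : V :=
  reg P r (fun p => exists ρ' b, opair ρ' b ∈ τ /\ (p ∈ b /\ p ∈ E ρ ρ')).

Definition bhalf P r (E : V -> V -> V) σ τ : V :=
  sep P (fun p => forall ρ b, opair ρ b ∈ σ -> forall q, opair q p ∈ r -> q ∈ b ->
    q ∈ bmem P r E ρ τ).

Lemma in_reg P r (φ : V -> Prop) p : p ∈ reg P r φ <->
  p ∈ P /\ forall q, opair q p ∈ r -> exists t, opair t q ∈ r /\ φ t.
Proof. exact: in_sep. Qed.

Lemma bv_memE P r ρ τ : bv_mem P r ρ τ = bmem P r (bv_eq P r) ρ τ.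
Proof.
apply: set_ext => p; rewrite !in_reg.
have Hiff t : (exists e : entry τ, t ∈ inter (evalue e) (bv_eq P r ρ (ename e))) <->
    (exists ρ' b, opair ρ' b ∈ τ /\ (t ∈ b /\ t ∈ bv_eq P r ρ ρ')).
  split; first by move=> [[[ρ' b] Hb]] /in_inter H; exists ρ', b.
  move=> [ρ' [b [Hb H]]]; exists (exist _ (ρ', b) Hb); exact/in_inter.
by split=> -[Hp H]; split=> // q /H [t [Ht /Hiff Hφ]]; exists t.
Qed.

Lemma bv_eq_halves P r σ τ : bv_eq P r σ τ =
  inter (bhalf P r (bv_eq P r) σ τ) (bhalf P r (bv_eq P r) τ σ).
Proof.
have Hhalf σ' τ' : binf P (fun e : entry σ' => bimp P r (evalue e) (bv_mem P r (ename e) τ'))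
    = bhalf P r (bv_eq P r) σ' τ'.
  apply: set_ext => p; rewrite !in_sep; split=> -[Hp H]; split=> //.
    move=> ρ b Hb q Hq Hqb; rewrite -bv_memE.
    have := H (exist _ (ρ, b) Hb); rewrite in_sep => -[_ H']; exact: H'.
  move=> [[ρ b] Hb]; rewrite in_sep; split=> // q Hq Hqb.
  by rewrite bv_memE; exact: H Hb _ Hq Hqb.
by rewrite bv_eqE !Hhalf.
Qed.

Lemma bmem_ext P r E E' ρ τ : (forall ρ', child ρ' τ -> E ρ ρ' = E' ρ ρ') ->
  bmem P r E ρ τ = bmem P r E' ρ τ.
Proof.
move=> H; apply: sep_ext => p Hp.
by split=> Hφ q /Hφ [t [Ht [ρ' [b [Hb [Hpb HE]]]]]]; exists t; split=> //; exists ρ', b;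
  do !split=> //; [rewrite -H|rewrite H] => //; exists b.
Qed.

Lemma bhalf_ext P r E E' σ τ :
  (forall ρ ρ', child ρ σ -> child ρ' τ -> E ρ ρ' = E' ρ ρ') ->
  bhalf P r E σ τ = bhalf P r E' σ τ.
Proof.
move=> H; apply: sep_ext => p Hp.
have Hc ρ b : opair ρ b ∈ σ -> bmem P r E ρ τ = bmem P r E' ρ τ.
  by move=> Hb; apply: bmem_ext => ρ' Hρ'; apply: H => //; exists b.
by split=> Hφ ρ b Hb; [rewrite -(Hc _ _ Hb)|rewrite (Hc _ _ Hb)]; exact: Hφ.
Qed.

(** [F] is [bv_eq] on the transitive set [X]; unlike the recursive definition of
    [bv_eq], this is a bounded property, and so preserved by embeddings. *)
Definition eq_attempt P r X F : Prop :=
  (forall x, x ∈ X -> forall y, y ∈ x -> y ∈ X) /\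
  forall σ, σ ∈ X -> forall τ, τ ∈ X -> appd F (opair σ τ) =
    inter (bhalf P r (fun a b => appd F (opair a b)) σ τ)
          (bhalf P r (fun a b => appd F (opair a b)) τ σ).

Lemma set_child X σ ρ : (forall x, x ∈ X -> forall y, y ∈ x -> y ∈ X) ->
  σ ∈ X -> child ρ σ -> ρ ∈ X.
Proof.
move=> HX Hσ [b Hb]; case: (transitive_opair (t := X) (z := σ) _ Hσ Hb) => //.
by move=> x y Hx Hy; exact: HX Hx _ Hy.
Qed.

Lemma eq_attemptE P r X F σ τ : eq_attempt P r X F -> σ ∈ X -> τ ∈ X ->
  appd F (opair σ τ) = bv_eq P r σ τ.
Proof.
move=> [HX HF] Hσ Hτ.
(* The second half evaluates [F] with the child of [τ] first, while the induction runs over children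
   of [σ]; hence both orders are proved at once. *)
suff : appd F (opair σ τ) = bv_eq P r σ τ /\ appd F (opair τ σ) = bv_eq P r τ σ by case.
elim/(well_founded_induction (child_wf (V := V))): σ τ Hσ Hτ => σ IH τ Hσ Hτ.
have H1 ρ ρ' : child ρ σ -> child ρ' τ ->
    appd F (opair ρ ρ') = bv_eq P r ρ ρ' /\ appd F (opair ρ' ρ) = bv_eq P r ρ' ρ.
  by move=> H H'; apply: IH => //; [exact: (set_child HX Hσ H)|exact: (set_child HX Hτ H')].
have E1 : bhalf P r (fun a b => appd F (opair a b)) σ τ = bhalf P r (bv_eq P r) σ τ.
  by apply: bhalf_ext => ρ ρ' H H'; case: (H1 ρ ρ').
have E2 : bhalf P r (fun a b => appd F (opair a b)) τ σ = bhalf P r (bv_eq P r) τ σ.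
  by apply: bhalf_ext => ρ ρ' H H'; case: (H1 ρ' ρ).
by rewrite !HF // !bv_eq_halves E1 E2.
Qed.

Lemma eq_attempt_exists P r X : (forall x, x ∈ X -> forall y, y ∈ x -> y ∈ X) ->
  exists F, eq_attempt P r X F.
Proof.
move=> HX.
have [A HA] := small_pairs (small_set X) (small_set X).
exists (mkfun A (fun p => bv_eq P r (fst p) (snd p))).
have HF σ τ : σ ∈ X -> τ ∈ X ->
    appd (mkfun A (fun p => bv_eq P r (fst p) (snd p))) (opair σ τ) = bv_eq P r σ τ.
  move=> Hσ Hτ; rewrite mkfunE; last by rewrite fst_opair snd_opair.
  by apply: HA; exists σ, τ.
split=> // σ Hσ τ Hτ; rewrite HF // bv_eq_halves.
by congr inter; apply: bhalf_ext => ρ ρ' H H'; rewrite HF //;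
  first [exact: (set_child HX Hσ H)|exact: (set_child HX Hτ H')|
         exact: (set_child HX Hτ H)|exact: (set_child HX Hσ H')].
Qed.

Lemma D0_eq_attempt (P r X F : env -> V) : simple P -> simple r -> simple X -> simple F ->
  Delta0 (fun e => eq_attempt (P e) (r e) (X e) (F e)).
Proof.
move=> H1 H2 H3 H4.
have H : Delta0 (fun e : env => eq_attempt (e 0) (e 1) (e 2) (e 3)).
  by rewrite /eq_attempt /bhalf /bmem /reg; bounded.
apply: (@D0_ext _ _ (fun e => (fun e : env => eq_attempt (e 0) (e 1) (e 2) (e 3))
  (fun n => (match n with 0 => P | 1 => r | 2 => X | _ => F end) e))) => //.
by apply: (D0_subst (τ := fun n => match n with 0 => P | 1 => r | 2 => X | _ => F end) H)
  => -[|[|[|n]]].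
Qed.

Definition check_attempt P X C : Prop :=
  (forall x, x ∈ X -> forall y, y ∈ x -> y ∈ X) /\
  forall x, x ∈ X -> appd C x = img x (fun y => opair (appd C y) P).

Lemma check_img P x : check P x = img x (fun y => opair (check P y) P).
Proof. by apply: set_ext => z; rewrite in_check in_img. Qed.

Lemma img_ext x (h h' : V -> V) : (forall y, y ∈ x -> h y = h' y) -> img x h = img x h'.
Proof.
move=> H; apply: set_ext => z; rewrite !in_img.
by split=> -[y [Hy ->]]; exists y; rewrite ?H // -H.
Qed.

Lemma check_attemptE P X C x : check_attempt P X C -> x ∈ X -> appd C x = check P x.
Proof.
move=> [HX HC]; elim/(well_founded_induction (mem_wf (V := V))): x => x IH Hx.
rewrite HC // check_img; apply: img_ext => y Hy; rewrite IH //; exact: HX Hx _ Hy.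
Qed.

Lemma check_attempt_exists P X : (forall x, x ∈ X -> forall y, y ∈ x -> y ∈ X) ->
  exists C, check_attempt P X C.
Proof.
move=> HX; exists (mkfun X (check P)); split=> // x Hx.
rewrite mkfunE // check_img; apply: img_ext => y Hy; rewrite mkfunE //; exact: HX Hx _ Hy.
Qed.

(** [is_name] is inductive and not given by a bounded formula. Closure of [Y] is bounded, and by
    foundation it makes every member of [Y] a name. *)
Definition name_closed B Y : Prop :=
  forall x, x ∈ Y -> forall z, z ∈ x -> exists ρ, ρ ∈ Y /\ exists b, b ∈ B /\ z = opair ρ b.

Lemma name_closed_name B Y x : name_closed B Y -> x ∈ Y -> is_name B x.
Proof.
move=> HY; elim/(well_founded_induction (child_wf (V := V))): x => x IH Hx.
split=> [z /(HY x Hx) [ρ [_ [b [Hb ->]]]]|ρ b Hb]; first by exists ρ, b.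
apply: IH; first by exists b.
by have [ρ' [Hρ' [b' [_ /opair_inj [-> _]]]]] := HY x Hx _ Hb.
Qed.

Lemma name_child B σ ρ b : is_name B σ -> opair ρ b ∈ σ -> is_name B ρ /\ b ∈ B.
Proof.
case=> {}σ H1 H2 H; split; first exact: H2 H.
by have [ρ' [b' [/opair_inj [_ ->]]]] := H1 _ H.
Qed.

Lemma name_closed_exists B σ : is_name B σ -> exists Y, name_closed B Y /\ σ ∈ Y.
Proof.
move=> Hσ; have [X [HσX HX]] := transitive_cover (singleton σ).
exists (sep X (is_name B)); split; last first.
  by rewrite in_sep; split=> //; apply: HσX; rewrite in_singleton.
move=> x /in_sep [Hx Hn] z Hz.
have [ρ [b [Ez Hb]]] : exists ρ b, z = opair ρ b /\ b ∈ B by case: Hn Hz => x' H1 _ /H1.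
rewrite Ez in Hz.
exists ρ; split; last by exists b.
rewrite in_sep; split; last by case: (name_child Hn Hz).
by case: (transitive_opair HX Hx Hz).
Qed.

(** * Regular open sets of a preorder *)

Section Preorder.
Variables (P r : V).
Hypothesis Hr : preorder P r.

Lemma RO_sub b : b ∈ RO P r -> b ⊆ P.
Proof. by move=> /in_RO []. Qed.

Lemma RO_open b p q : b ∈ RO P r -> p ∈ b -> opair q p ∈ r -> q ∈ b.
Proof.
move=> /in_RO [_ <-]; rewrite !in_reg => -[Hp H] Hq; split; first by case: (po_dom Hr Hq).
by move=> q' Hq'; apply: H; exact: po_trans Hr _ _ _ Hq' Hq.
Qed.

Lemma RO_dense b p : b ∈ RO P r -> p ∈ P ->
  (forall q, opair q p ∈ r -> exists t, opair t q ∈ r /\ t ∈ b) -> p ∈ b.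
Proof. by move=> /in_RO [_ E] Hp H; rewrite -E in_reg. Qed.

Lemma RO_intro b : b ⊆ P -> (forall p q, p ∈ b -> opair q p ∈ r -> q ∈ b) ->
  (forall p, p ∈ P -> (forall q, opair q p ∈ r -> exists t, opair t q ∈ r /\ t ∈ b) -> p ∈ b) ->
  b ∈ RO P r.
Proof.
move=> Hb Ho Hd; rewrite in_RO; split=> //; apply: set_ext => p; rewrite in_reg.
split; first by move=> [Hp H]; exact: Hd.
move=> Hp; split; first exact: Hb.
move=> q Hq; exists q; split; last exact: Ho Hp Hq.
by apply: (po_refl Hr); case: (po_dom Hr Hq).
Qed.

Lemma open_reg (φ : V -> Prop) p : p ∈ P -> (forall q, opair q p ∈ r -> φ q) -> p ∈ reg P r φ.
Proof.
move=> Hp H; rewrite in_reg; split=> // q Hq; exists q; split; last exact: H.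
by apply: (po_refl Hr); case: (po_dom Hr Hq).
Qed.

Lemma reg_RO (φ : V -> Prop) : (forall p q, φ p -> opair q p ∈ r -> φ q) -> reg P r φ ∈ RO P r.
Proof.
move=> Ho; apply: RO_intro; first exact: sep_sub.
- move=> p q; rewrite !in_reg => -[Hp H] Hq; split; first by case: (po_dom Hr Hq).
  by move=> q' Hq'; apply: H; exact: po_trans Hr _ _ _ Hq' Hq.
- move=> p Hp H; rewrite in_reg; split=> // q Hq.
  have [t [Ht]] := H q Hq; rewrite in_reg => -[Htp /(_ t (po_refl Hr Htp)) [u [Hu Hφ]]].
  by exists u; split=> //; exact: po_trans Hr _ _ _ Hu Ht.
Qed.

Lemma inter_RO b c : b ∈ RO P r -> c ∈ RO P r -> inter b c ∈ RO P r.
Proof.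
move=> Hb Hc; apply: RO_intro.
- by move=> p /in_inter [Hp _]; exact: RO_sub Hb _ Hp.
- by move=> p q; rewrite !in_inter => -[H1 H2] Hq; split; [exact: RO_open Hb H1 Hq|exact: RO_open Hc H2 Hq].
- move=> p Hp H; rewrite in_inter; split.
    by apply: RO_dense => // q /H [t [Ht /in_inter [H1 _]]]; exists t.
  by apply: RO_dense => // q /H [t [Ht /in_inter [_ H1]]]; exists t.
Qed.

Lemma unit_RO : P ∈ RO P r.
Proof. by apply: RO_intro => // p q _ /(po_dom Hr) []. Qed.

Lemma bhalf_open E σ τ p q : p ∈ bhalf P r E σ τ -> opair q p ∈ r -> q ∈ bhalf P r E σ τ.
Proof.
rewrite !in_sep => -[Hp H] Hq; split; first by case: (po_dom Hr Hq).
by move=> ρ b Hb q' Hq'; apply: (H ρ b Hb); exact: po_trans Hr _ _ _ Hq' Hq.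
Qed.

Lemma bv_eq_open σ τ p q : p ∈ bv_eq P r σ τ -> opair q p ∈ r -> q ∈ bv_eq P r σ τ.
Proof.
rewrite bv_eq_halves !in_inter => -[H1 H2] Hq.
by split; [exact: bhalf_open H1 Hq|exact: bhalf_open H2 Hq].
Qed.

Lemma bmem_RO E ρ τ : is_name (RO P r) τ ->
  (forall a b p q, p ∈ E a b -> opair q p ∈ r -> q ∈ E a b) -> bmem P r E ρ τ ∈ RO P r.
Proof.
move=> Hτ HE; apply: reg_RO => p q [ρ' [b [Hb [Hpb Hp]]]] Hq.
exists ρ', b; do !split=> //; last exact: HE Hp Hq.
by apply: RO_open Hpb Hq; case: (name_child Hτ Hb).
Qed.

Lemma bhalf_RO E σ τ : is_name (RO P r) σ -> is_name (RO P r) τ ->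
  (forall a b p q, p ∈ E a b -> opair q p ∈ r -> q ∈ E a b) -> bhalf P r E σ τ ∈ RO P r.
Proof.
move=> Hσ Hτ HE; apply: RO_intro; [exact: sep_sub|exact: bhalf_open|].
move=> p Hp H; rewrite in_sep; split=> // ρ b Hb q Hq Hqb.
have HqP : q ∈ P by case: (po_dom Hr Hq).
apply: RO_dense => //; first exact: bmem_RO.
move=> q' Hq'; have [t [Ht]] := H q' (po_trans Hr Hq' Hq).
rewrite in_sep => -[HtP Hall]; exists t; split=> //.
apply: (Hall ρ b Hb t (po_refl Hr HtP)).
apply: (RO_open (p := q)) => //; last exact: po_trans Hr _ _ _ Ht Hq'.
by case: (name_child Hσ Hb).
Qed.

Lemma bv_eq_RO σ τ : is_name (RO P r) σ -> is_name (RO P r) τ -> bv_eq P r σ τ ∈ RO P r.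
Proof.
move=> Hσ Hτ; rewrite bv_eq_halves.
by apply: inter_RO; apply: bhalf_RO => // a b p q H1 H2; exact: (bv_eq_open H1 H2).
Qed.

Lemma bv_mem_RO σ τ : is_name (RO P r) τ -> bv_mem P r σ τ ∈ RO P r.
Proof. by move=> Hτ; rewrite bv_memE; apply: bmem_RO => //; exact: bv_eq_open. Qed.

Lemma bv_ground_RO σ : bv_ground P r σ ∈ RO P r.
Proof. by apply: reg_RO => p q [x Hx] Hq; exists x; exact: bv_eq_open Hx Hq. Qed.

End Preorder.

Lemma check_name B P x : P ∈ B -> is_name B (check P x).
Proof.
move=> HP; elim/(well_founded_induction (mem_wf (V := V))): x => x IH.
split=> [z /in_check [y [_ ->]]|τ b /in_check [y [Hy /opair_inj [-> _]]]]; last exact: IH.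
by exists (check P y), P.
Qed.

Lemma check_value P (G : V -> Prop) x : G P -> name_value G (check P x) = x.
Proof.
move=> GP; elim/(well_founded_induction (mem_wf (V := V))): x => x IH.
apply: set_ext => z; rewrite in_name_value; split.
  by move=> [τ [b [/in_check [y [Hy /opair_inj [-> _]]] [_ ->]]]]; rewrite IH.
by move=> Hz; exists (check P z), P; rewrite in_check IH //; do !split=> //; exists z.
Qed.

End BooleanValues.

(** * The truth lemma *)

Section Truth.
Context {V : zfc_universe}.
Implicit Types (B b c p q t x y z X F C Y σ τ ρ : V).
Local Notation env := (@env V).

Variables (N : V -> Prop) (P r : V) (g : V -> Prop).
Hypothesis HN : inner_model N.
Hypothesis NP : N P.
Hypothesis Nr : N r.
Hypothesis Hr : preorder P r.
Hypothesis Hg : generic_filter N P r g.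

Definition meets b : Prop := exists p, g p /\ p ∈ b.

Lemma g_sub p : g p -> p ∈ P.
Proof. by case: Hg => H _; exact: H. Qed.

Lemma g_directed p q : g p -> g q -> exists t, g t /\ opair t p ∈ r /\ opair t q ∈ r.
Proof. by case: Hg => _ [_ [_ [H _]]]; exact: H. Qed.

Lemma g_dense D : N D -> D ⊆ P ->
  (forall p, p ∈ P -> exists q, q ∈ D /\ opair q p ∈ r) -> exists p, p ∈ D /\ g p.
Proof. by case: Hg => _ [_ [_ [_ H]]]; exact: H. Qed.

(** The conditions that are in [S] or have no extension in [S] form a dense set in [N]. A condition
    of [g] in this set is compatible with any [p] of [g] in the regularization, which excludes the
    second case. *)
Lemma meets_reg S : N S -> S ⊆ P -> (forall p q, p ∈ S -> opair q p ∈ r -> q ∈ S) ->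
  (meets (reg P r (fun p => p ∈ S)) <-> meets S).
Proof.
move=> NS HS Ho; split=> -[p [gp Hp]]; last first.
  exists p; split=> //; apply: open_reg => //; first exact: g_sub.
  by move=> q; exact: Ho.
pose D := sep P (fun q => q ∈ S \/ forall t, opair t q ∈ r -> t ∉ S).
have ND : N D.
  apply: (im_simple HN (t := fun e => sep (e 0) (fun q => q ∈ e 2 \/
    forall t, opair t q ∈ e 1 -> t ∉ e 2)) (e := P .: r .: fun _ => S)); first by bounded.
  by case=> [|[|]].
have [|q [/in_sep [HqP Hq] gq]] := g_dense ND (@sep_sub _ _ _).
  move=> q Hq; case: (classic (exists t, opair t q ∈ r /\ t ∈ S)) => [[t [Ht HtS]]|Hn].
    by exists t; split=> //; rewrite in_sep; split; [exact: HS|left].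
  exists q; split; last exact: (po_refl Hr).
  by rewrite in_sep; split=> //; right=> t Ht HtS; apply: Hn; exists t.
case: Hq => Hq; first by exists q.
have [t [gt [Htp Htq]]] := g_directed gp gq.
move: Hp; rewrite in_reg => -[_ /(_ t Htp) [u [Hu HuS]]].
by case: (Hq u (po_trans Hr Hu Htq)).
Qed.

(** [B] will be the image of the algebra under the embedding, that is, the algebra as computed in
    [N]. It may omit regular open sets of [V], so only inclusion is required. *)
Variables (B : V) (G : V -> Prop).
Hypothesis HB : forall b, b ∈ B -> b ∈ RO P r.
Hypothesis HG : forall b, b ∈ B -> (G b <-> meets b).

Lemma name_RO σ : is_name B σ -> is_name (RO P r) σ.
Proof.
elim=> {}σ H1 _ H2; split; last exact: H2.
by move=> z /H1 [τ [b [-> Hb]]]; exists τ, b; split=> //; exact: HB.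
Qed.

(** That attempts exist on transitive sets is a Π2 statement, so [N] contains one, and by
    [eq_attemptE] it computes the values of [V]. *)
Lemma inner_eq_attempt σ τ : N σ -> N τ ->
  exists X F, N X /\ N F /\ eq_attempt P r X F /\ σ ∈ X /\ τ ∈ X.
Proof.
move=> Nσ Nτ.
have HQ1 : Delta0 (fun e : env => (forall x, x ∈ e 0 -> forall y, y ∈ x -> y ∈ e 0) /\
    e 1 ∈ e 0 /\ e 2 ∈ e 0) by bounded.
have HE1 (e : env) : exists X, (forall x, x ∈ X -> forall y, y ∈ x -> y ∈ X) /\
    e 0 ∈ X /\ e 1 ∈ X.
  have [X [H1 H2]] := transitive_cover (upair (e 0) (e 1)).
  exists X; split; first by move=> x Hx y; exact: H2 Hx.
  by split; apply: H1; rewrite in_upair; auto.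
have Ne1 n : N ((σ .: fun _ => τ) n) by case: n.
have [X [NX /= [HX [H1 H2]]]] := im_pi2 HN HQ1 HE1 Ne1.
(* Transitivity of the domain is a premise inside the matrix, so that the existence statement holds
   in every environment. *)
have HQ2 : Delta0 (fun e : env => (forall x, x ∈ e 1 -> forall y, y ∈ x -> y ∈ e 1) ->
    eq_attempt (e 2) (e 3) (e 1) (e 0)).
  by apply: D0_imp; [bounded|apply: D0_eq_attempt; bounded].
have HE2 (e : env) : exists F, (forall x, x ∈ e 0 -> forall y, y ∈ x -> y ∈ e 0) ->
    eq_attempt (e 1) (e 2) (e 0) F.
  case: (classic (forall x, x ∈ e 0 -> forall y, y ∈ x -> y ∈ e 0)) => [H|H].
    by have [F HF] := eq_attempt_exists (e 1) (e 2) H; exists F.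
  by exists (e 0).
have Ne2 n : N ((X .: P .: fun _ => r) n) by case: n => [|[|]].
have [F [NF /= HF]] := im_pi2 HN HQ2 HE2 Ne2.
by exists X, F; split=> //; split=> //; split; first exact: HF.
Qed.

Lemma inner_check x : N x -> N (check P x).
Proof.
move=> Nx.
have HQ1 : Delta0 (fun e : env => (forall x, x ∈ e 0 -> forall y, y ∈ x -> y ∈ e 0) /\
    e 1 ∈ e 0) by bounded.
have HE1 (e : env) : exists X, (forall x, x ∈ X -> forall y, y ∈ x -> y ∈ X) /\ e 0 ∈ X.
  have [X [H1 H2]] := transitive_cover (singleton (e 0)).
  exists X; split; first by move=> u Hu y; exact: H2 Hu.
  by apply: H1; rewrite in_singleton.
have [X [NX /= [HX H1]]] := im_pi2 HN HQ1 HE1 (fun _ : nat => Nx).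
have HQ2 : Delta0 (fun e : env => (forall x, x ∈ e 1 -> forall y, y ∈ x -> y ∈ e 1) ->
    check_attempt (e 2) (e 1) (e 0)) by rewrite /check_attempt; bounded.
have HE2 (e : env) : exists C, (forall x, x ∈ e 0 -> forall y, y ∈ x -> y ∈ e 0) ->
    check_attempt (e 1) (e 0) C.
  case: (classic (forall x, x ∈ e 0 -> forall y, y ∈ x -> y ∈ e 0)) => [H|H].
    by have [C HC] := check_attempt_exists (e 1) H; exists C.
  by exists (e 0).
have Ne2 n : N ((X .: fun _ => P) n) by case: n => [|].
have [C [NC /= HC]] := im_pi2 HN HQ2 HE2 Ne2.
rewrite -(check_attemptE (HC HX) H1).
by apply: (im_simple HN (t := fun e => appd (e 0) (e 1)) (e := C .: fun _ => x)); [bounded|case].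
Qed.

Section Attempt.
Variables (X F : V).
Hypothesis NX : N X.
Hypothesis NF : N F.
Hypothesis HF : eq_attempt P r X F.

Let E a b := appd F (opair a b).

Lemma attempt_open a b p q : a ∈ X -> b ∈ X -> p ∈ E a b -> opair q p ∈ r -> q ∈ E a b.
Proof.
move=> Ha Hb; rewrite /E (eq_attemptE HF) //; exact: bv_eq_open.
Qed.

Lemma attempt_inner σ : σ ∈ X -> N σ.
Proof. by move=> Hσ; apply: (im_trans HN) Hσ. Qed.

Lemma attempt_child σ ρ : σ ∈ X -> child ρ σ -> ρ ∈ X.
Proof. by case: HF => HX _; exact: set_child. Qed.

Lemma truth_mem ρ τ : ρ ∈ X -> τ ∈ X -> is_name B τ ->
  (forall ρ', child ρ' τ ->
     (meets (E ρ ρ') <-> name_value G ρ = name_value G ρ')) ->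
  (meets (bmem P r E ρ τ) <-> name_value G ρ ∈ name_value G τ).
Proof.
move=> Hρ Hτ Nτ Heq.
(* Being defined from the attempt [F] instead of [bv_eq], the set [S] is seen to lie in [N], as
   [meets_reg] requires. *)
pose S := sep P (fun p => exists ρ' b, opair ρ' b ∈ τ /\ (p ∈ b /\ p ∈ appd F (opair ρ ρ'))).
have NS : N S.
  apply: (im_simple HN (t := fun e => sep (e 0) (fun p => exists ρ' b,
    opair ρ' b ∈ e 1 /\ (p ∈ b /\ p ∈ appd (e 2) (opair (e 3) ρ'))))
    (e := P .: τ .: F .: fun _ => ρ)); first by bounded.
  by case=> [|[|[|n]]] //=; exact: attempt_inner.
have So p q : p ∈ S -> opair q p ∈ r -> q ∈ S.
  rewrite !in_sep => -[Hp [ρ' [b [Hb [Hpb HpE]]]]] Hq.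
  split; first by case: (po_dom Hr Hq).
  exists ρ', b; do !split=> //.
    by apply: (RO_open Hr _ Hpb Hq); apply: HB; case: (name_child Nτ Hb).
  by apply: attempt_open HpE Hq => //; apply: (attempt_child Hτ); exists b.
have -> : bmem P r E ρ τ = reg P r (fun p => p ∈ S).
  apply: sep_ext => p Hp; split=> H q /H [t [Ht HtS]]; exists t; split=> //.
    by rewrite in_sep; split=> //; case: (po_dom Hr Ht).
  by move: HtS; rewrite in_sep => -[].
rewrite (meets_reg NS (@sep_sub _ _ _) So).
rewrite in_name_value; split.
  move=> [p [gp /in_sep [Hp [ρ' [b [Hb [Hpb HpE]]]]]]].
  have [_ HbB] := name_child Nτ Hb.
  exists ρ', b; split=> //; split; first by apply/HG => //; exists p.
  by apply/Heq; [exists b|exists p].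
move=> [ρ' [b [Hb [Gb Ev]]]].
have [_ HbB] := name_child Nτ Hb.
have [p [gp Hpb]] := proj1 (HG HbB) Gb.
have Hc : child ρ' τ by exists b.
have [q [gq HqE]] := proj2 (Heq ρ' Hc) Ev.
have [t [gt [Htp Htq]]] := g_directed gp gq.
exists t; split=> //; rewrite in_sep; split; first exact: g_sub.
exists ρ', b; do !split=> //; first exact: RO_open (HB HbB) Hpb Htp.
by apply: attempt_open HqE Htq => //; exact: attempt_child Hc.
Qed.

(** For the converse, take the conditions that lie in the value of the inclusion, or lie in the
    value of an entry [ρ] of [σ] with no extension in the value of [ρ] being in [τ]. They are dense,
    and when the inclusion holds for the evaluated names, [g] contains none of the second kind. *)
Lemma truth_half σ τ : σ ∈ X -> τ ∈ X -> is_name B σ -> is_name B τ ->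
  (forall ρ, child ρ σ -> (meets (bmem P r E ρ τ) <-> name_value G ρ ∈ name_value G τ)) ->
  (meets (bhalf P r E σ τ) <-> name_value G σ ⊆ name_value G τ).
Proof.
move=> Hσ Hτ Nσ Nτ Hmem; split.
  move=> [p [gp /in_sep [Hp Hall]]] z /in_name_value [ρ [b [Hb [Gb ->]]]].
  have [_ HbB] := name_child Nσ Hb.
  apply/Hmem; first by exists b.
  have [q [gq Hqb]] := proj1 (HG HbB) Gb.
  have [t [gt [Htp Htq]]] := g_directed gp gq.
  exists t; split=> //; apply: (Hall ρ b Hb t Htp); exact: RO_open (HB HbB) Hqb Htq.
move=> Hsub.
pose D := sep P (fun q => q ∈ bhalf P r E σ τ \/
  exists ρ b, opair ρ b ∈ σ /\ (q ∈ b /\ forall t, opair t q ∈ r -> t ∉ bmem P r E ρ τ)).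
have ND : N D.
  apply: (im_simple HN (t := fun e => sep (e 0) (fun q =>
    q ∈ bhalf (e 0) (e 1) (fun a b => appd (e 2) (opair a b)) (e 3) (e 4) \/
    exists ρ b, opair ρ b ∈ e 3 /\ (q ∈ b /\ forall t, opair t q ∈ e 1 ->
      t ∉ bmem (e 0) (e 1) (fun a b => appd (e 2) (opair a b)) ρ (e 4))))
    (e := P .: r .: F .: σ .: fun _ => τ)); first by rewrite /bhalf /bmem /reg; bounded.
  by case=> [|[|[|[|n]]]] //=; exact: attempt_inner.
have HRO ρ : ρ ∈ X -> bmem P r E ρ τ ∈ RO P r.
  move=> Hρ; have -> : bmem P r E ρ τ = bmem P r (bv_eq P r) ρ τ.
    by apply: bmem_ext => ρ' Hρ'; rewrite /E (eq_attemptE HF) //; exact: attempt_child Hρ'.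
  rewrite -(bv_memE P r ρ τ); apply: (bv_mem_RO Hr); exact: (name_RO Nτ).
have [|q [/in_sep [HqP Hq] gq]] := g_dense ND (@sep_sub _ _ _).
  move=> p Hp; case: (classic (p ∈ bhalf P r E σ τ)) => Hph.
    by exists p; split; [rewrite in_sep; auto|exact: (po_refl Hr)].
  have [ρ [b [Hb [q [Hq [Hqb Hqm]]]]]] : exists ρ b, opair ρ b ∈ σ /\
      exists q, opair q p ∈ r /\ q ∈ b /\ q ∉ bmem P r E ρ τ.
    apply: NNPP => Hn; apply: Hph; rewrite in_sep; split=> // ρ b Hb q Hq Hqb.
    by apply: NNPP => Hqm; apply: Hn; exists ρ, b; split=> //; exists q.
  have HqP : q ∈ P by case: (po_dom Hr Hq).
  have Hρ : ρ ∈ X by apply: (attempt_child Hσ); exists b.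
  have [q' [Hq' Hno]] : exists q', opair q' q ∈ r /\
      forall t, opair t q' ∈ r -> t ∉ bmem P r E ρ τ.
    apply: NNPP => Hn; apply: Hqm; apply: (RO_dense (HRO _ Hρ) HqP).
    move=> q' Hq'; apply: NNPP => Hn'; apply: Hn; exists q'; split=> // t Ht Htm.
    by apply: Hn'; exists t.
  exists q'; split; last exact: po_trans Hr _ _ _ Hq' Hq.
  rewrite in_sep; split; first by case: (po_dom Hr Hq').
  right; exists ρ, b; do !split=> //.
  by apply: (RO_open Hr _ Hqb Hq'); apply: HB; case: (name_child Nσ Hb).
case: Hq => [Hq|[ρ [b [Hb [Hqb Hno]]]]]; first by exists q.
have [_ HbB] := name_child Nσ Hb.
have Hc : child ρ σ by exists b.
have Hz : name_value G ρ ∈ name_value G τ.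
  apply: Hsub; rewrite in_name_value; exists ρ, b; do !split=> //.
  by apply/HG => //; exists q.
have [p [gp Hpm]] := proj2 (Hmem ρ Hc) Hz.
have [t [gt [Htp Htq]]] := g_directed gp gq.
case: (Hno t Htq); apply: (RO_open Hr _ Hpm Htp); apply: HRO; exact: attempt_child Hc.
Qed.

Lemma truth_eq σ τ : σ ∈ X -> τ ∈ X -> is_name B σ -> is_name B τ ->
  (meets (E σ τ) <-> name_value G σ = name_value G τ).
Proof.
elim/(well_founded_induction (child_wf (V := V))): σ τ => σ IH τ Hσ Hτ Nσ Nτ.
have Hcσ ρ : child ρ σ -> ρ ∈ X /\ is_name B ρ.
  by move=> Hρ; split; [exact: attempt_child Hρ|case: Hρ => b /(name_child Nσ) []].
have Hcτ ρ : child ρ τ -> ρ ∈ X /\ is_name B ρ.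
  by move=> Hρ; split; [exact: attempt_child Hρ|case: Hρ => b /(name_child Nτ) []].
have Eσ : meets (bhalf P r E σ τ) <-> name_value G σ ⊆ name_value G τ.
  apply: truth_half => // ρ Hρ; have [Xρ Nρ] := Hcσ _ Hρ.
  apply: truth_mem => // ρ' Hρ'; have [Xρ' Nρ'] := Hcτ _ Hρ'; exact: IH.
have Eτ : meets (bhalf P r E τ σ) <-> name_value G τ ⊆ name_value G σ.
  apply: truth_half => // ρ Hρ; have [Xρ Nρ] := Hcτ _ Hρ.
  apply: truth_mem => // ρ' Hρ'; have [Xρ' Nρ'] := Hcσ _ Hρ'.
  rewrite /E (eq_attemptE HF) // bv_eqC -(eq_attemptE HF) // IH //.
  by split=> ->.
have -> : E σ τ = inter (bhalf P r E σ τ) (bhalf P r E τ σ) by case: HF => _; exact.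
transitivity (meets (bhalf P r E σ τ) /\ meets (bhalf P r E τ σ)).
  split; first by move=> [p [gp /in_inter [H1 H2]]]; split; exists p.
  move=> [[p [gp Hp]] [q [gq Hq]]]; have [t [gt [Htp Htq]]] := g_directed gp gq.
  exists t; split=> //; rewrite in_inter.
  by split; [exact: (bhalf_open Hr Hp Htp)|exact: (bhalf_open Hr Hq Htq)].
rewrite Eσ Eτ; split; last by move=> ->; split=> z.
by move=> [H1 H2]; apply: set_ext => z; split; [exact: H1|exact: H2].
Qed.

End Attempt.

Theorem truth_bv_eq σ τ : N σ -> N τ -> is_name B σ -> is_name B τ ->
  (meets (bv_eq P r σ τ) <-> name_value G σ = name_value G τ).
Proof.
move=> Nσ Nτ Hσ Hτ; have [X [F [NX [NF [HF [H1 H2]]]]]] := inner_eq_attempt Nσ Nτ.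
by rewrite -(eq_attemptE HF) //; exact: (truth_eq NX NF HF).
Qed.

Theorem truth_bv_mem σ τ : N σ -> N τ -> is_name B σ -> is_name B τ ->
  (meets (bv_mem P r σ τ) <-> name_value G σ ∈ name_value G τ).
Proof.
move=> Nσ Nτ Hσ Hτ; have [X [F [NX [NF [HF [H1 H2]]]]]] := inner_eq_attempt Nσ Nτ.
have Hc ρ : child ρ τ -> ρ ∈ X by exact: (attempt_child HF H2).
rewrite (bv_memE P r σ τ); have <- : bmem P r (fun a b => appd F (opair a b)) σ τ =
    bmem P r (bv_eq P r) σ τ.
  by apply: bmem_ext => ρ Hρ; rewrite (eq_attemptE HF) //; exact: Hc.
refine (truth_mem NX NF HF H1 H2 Hτ _) => ρ Hρ.
refine (truth_eq NX NF HF H1 (Hc _ Hρ) Hσ _).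
by case: Hρ => b /(name_child Hτ) [].
Qed.

End Truth.

(** * Boolean ultrapowers *)

Section BooleanUltrapower.
Context {V : zfc_universe}.
Implicit Types (a b c h p q t x y z X F C Y A S σ τ ρ : V).
Local Notation env := (@env V).

(** [h] is a name for a single element of the ground model: a function on an open
    dense set which takes equal values at compatible conditions. *)
Definition dense_fun P r h : Prop :=
  (forall p x, opair p x ∈ h -> p ∈ P) /\
  (forall p x, opair p x ∈ h -> forall y, opair p y ∈ h -> x = y) /\
  (forall p x, opair p x ∈ h -> forall q, opair q p ∈ r -> opair q x ∈ h) /\
  (forall p, p ∈ P -> exists q, opair q p ∈ r /\ in_dom h q).

Definition captured (j : V -> V) P r (g : V -> Prop) x : Prop :=
  exists h, dense_fun P r h /\ exists p, g p /\ opair p x ∈ j h.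

Variables (N : V -> Prop) (j : V -> V) (P r : V) (g : V -> Prop).
Hypothesis HNt : transitive_class N.
Hypothesis E : embedding (fun _ => True) N j.
Hypothesis Hr : preorder P r.
Hypothesis Hg : generic_filter N (j P) (j r) g.

Let HN : inner_model N := inner_model_of_embedding HNt E.
Let Nj x : N (j x) := emb_maps E I.

Let tr (Q : env -> Prop) (e : env) (HQ : Delta0 Q) (H : Q e) : Q (fun n => j (e n)) :=
  proj1 (emb_D0 E HQ (fun _ => I)) H.

Lemma j_opair x y : j (opair x y) = opair (j x) (j y).
Proof. exact: (emb_opair E I I I). Qed.

Lemma j_preorder : preorder (j P) (j r).
Proof.
have HQ : Delta0 (fun e : env => (forall q p, opair q p ∈ e 1 -> q ∈ e 0 /\ p ∈ e 0) /\
  (forall p, p ∈ e 0 -> opair p p ∈ e 1) /\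
  (forall t q, opair t q ∈ e 1 -> forall p, opair q p ∈ e 1 -> opair t p ∈ e 1)) by bounded.
have [|H1 [H2 H3]] := tr (e := P .: fun _ => r) HQ.
  split; first exact: (po_dom Hr).
  split; first exact: (po_refl Hr).
  by move=> t q H p; exact: (po_trans Hr H).
by split=> // t q p H H'; exact: H3 H _ H'.
Qed.

Local Notation B := (RO P r).

Lemma j_RO b : b ∈ j B -> b ∈ RO (j P) (j r).
Proof.
have HQ : Delta0 (fun e : env => forall b, b ∈ e 2 -> b ⊆ e 0 /\ reg (e 0) (e 1) (fun p => p ∈ b) = b).
  by rewrite /reg; bounded.
have H := tr (e := P .: r .: fun _ => B) HQ (fun b Hb => proj1 (in_RO _ _ _) Hb).
by move=> Hb; rewrite in_RO; exact: H Hb.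
Qed.

Definition below P r p : V := reg P r (fun q => opair q p ∈ r).

Lemma j_RO_embedding p : p ∈ j P -> app (j (RO_embedding P r)) p = below (j P) (j r) p.
Proof.
move=> Hp.
have -> : j (RO_embedding P r) = mkfun (j P) (below (j P) (j r)).
  apply: (emb_simple (t := fun e => mkfun (e 0) (fun p => reg (e 0) (e 1) (fun q => opair q p ∈ e 1)))
    (e := P .: fun _ => r) E) => //.
  by rewrite /reg; bounded.
by rewrite (fun_on_app (mkfun_on _ _) Hp) mkfunE.
Qed.

Lemma below_self p : p ∈ j P -> p ∈ below (j P) (j r) p.
Proof. by move=> Hp; exact: (open_reg j_preorder). Qed.

Local Notation G := (generated_filter (j B) (j (RO_embedding P r)) g).
Local Notation val σ := (name_value G (j σ)).

(** A regular open set containing [p] includes the whole regular open set generated by [p]. *)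
Lemma G_meets b : b ∈ j B -> (G b <-> meets g b).
Proof.
move=> Hb; have HRO := j_RO Hb; split.
  move=> [_ [p [gp Hsub]]]; exists p; split=> //; apply: Hsub.
  have Hp := g_sub Hg gp; rewrite (j_RO_embedding Hp); exact: below_self.
move=> [p [gp Hpb]]; split=> //; exists p; split=> //.
rewrite (j_RO_embedding (g_sub Hg gp)) => q; rewrite in_reg => -[Hq H].
apply: (RO_dense HRO Hq) => q' /H [t [Ht Htp]]; exists t; split=> //.
exact: (RO_open j_preorder HRO Hpb Htp).
Qed.

Lemma j_unit : j P ∈ j B.
Proof. exact: (proj1 (emb_mem E I I) (unit_RO Hr)). Qed.

Lemma G_unit : G (j P).
Proof.
apply/G_meets; first exact: j_unit.
by case: (Hg) => H1 [[p gp] _]; exists p; split=> //; exact: H1.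
Qed.

Lemma attempt_cover a : exists X F C, a ⊆ X /\ eq_attempt P r X F /\ check_attempt P X C.
Proof.
have [X [HaX HX]] := transitive_cover a.
have HX' x : x ∈ X -> forall y, y ∈ x -> y ∈ X by move=> Hx y; exact: HX Hx.
have [F HF] := eq_attempt_exists P r HX'; have [C HC] := check_attempt_exists P HX'.
by exists X, F, C.
Qed.

Lemma j_attempts X F C : eq_attempt P r X F -> check_attempt P X C ->
  eq_attempt (j P) (j r) (j X) (j F) /\ check_attempt (j P) (j X) (j C).
Proof.
move=> HF HC.
have HQ : Delta0 (fun e : env => eq_attempt (e 0) (e 1) (e 2) (e 3) /\
    check_attempt (e 0) (e 2) (e 4)).
  by apply: D0_and; [apply: D0_eq_attempt; bounded|rewrite /check_attempt; bounded].
exact: (tr (e := P .: r .: X .: F .: fun _ => C) HQ).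
Qed.

(** An attempt [F] is mapped to an attempt for the image forcing, and each computes the recursive
    values on its domain. *)
Lemma j_bv_eq σ τ : j (bv_eq P r σ τ) = bv_eq (j P) (j r) (j σ) (j τ).
Proof.
have [X [F [C [HX [HF HC]]]]] := attempt_cover (upair σ τ).
have [HF' _] := j_attempts HF HC.
have Hσ : σ ∈ X by apply: HX; rewrite in_upair; left.
have Hτ : τ ∈ X by apply: HX; rewrite in_upair; right.
rewrite -(eq_attemptE HF Hσ Hτ) (emb_appd E I I I) j_opair.
by apply: (eq_attemptE HF'); exact: (proj1 (emb_mem E I I)).
Qed.

Lemma j_bv_mem σ τ : j (bv_mem P r σ τ) = bv_mem (j P) (j r) (j σ) (j τ).
Proof.
have [X [F [C [HX [HF HC]]]]] := attempt_cover (upair σ τ).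
have [HF' _] := j_attempts HF HC.
have Hσ : σ ∈ X by apply: HX; rewrite in_upair; left.
have Hτ : τ ∈ X by apply: HX; rewrite in_upair; right.
have Hσ' := proj1 (emb_mem E I I) Hσ; have Hτ' := proj1 (emb_mem E I I) Hτ.
have Emem P' r' X' F' σ' τ' : eq_attempt P' r' X' F' -> σ' ∈ X' -> τ' ∈ X' ->
    bv_mem P' r' σ' τ' = bmem P' r' (fun a b => appd F' (opair a b)) σ' τ'.
  move=> H H1 H2; rewrite (bv_memE P' r' σ' τ'); apply: bmem_ext => ρ Hρ.
  by rewrite (eq_attemptE H H1) //; case: H => H _; exact: set_child Hρ.
rewrite (Emem _ _ _ _ _ _ HF Hσ Hτ) (Emem _ _ _ _ _ _ HF' Hσ' Hτ').
apply: (emb_simple (t := fun e => bmem (e 0) (e 1) (fun a b => appd (e 2) (opair a b)) (e 3) (e 4))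
    (e := P .: r .: F .: σ .: fun _ => τ) E) => //.
by rewrite /bmem /reg; bounded.
Qed.

Lemma j_check x : j (check P x) = check (j P) (j x).
Proof.
have [X [F [C [HX [HF HC]]]]] := attempt_cover (singleton x).
have [_ HC'] := j_attempts HF HC.
have Hx : x ∈ X by apply: HX; rewrite in_singleton.
rewrite -(check_attemptE HC Hx) (emb_appd E I I I).
by apply: (check_attemptE HC'); exact: (proj1 (emb_mem E I I)).
Qed.

Lemma j_name σ : is_name B σ -> is_name (j B) (j σ).
Proof.
move=> /name_closed_exists [Y [HY Hσ]].
have HQ : Delta0 (fun e : env => name_closed (e 0) (e 1)) by rewrite /name_closed; bounded.
have HY' := tr (e := B .: fun _ => Y) HQ HY.
by apply: (name_closed_name HY'); exact: (proj1 (emb_mem E I I)).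
Qed.

Let U b := b ∈ B /\ G (j b).

Lemma U_meets b : b ∈ B -> (U b <-> meets g (j b)).
Proof.
move=> Hb; have Hjb := proj1 (emb_mem E I I) Hb.
by rewrite -(G_meets Hjb) /U; tauto.
Qed.

Let truth_eq' σ τ := truth_bv_eq HN (Nj P) (Nj r) j_preorder Hg j_RO G_meets (σ := σ) (τ := τ).

Lemma U_bv_eq σ τ : is_name B σ -> is_name B τ -> (U (bv_eq P r σ τ) <-> val σ = val τ).
Proof.
move=> Hσ Hτ; rewrite (U_meets (bv_eq_RO Hr Hσ Hτ)) (j_bv_eq σ τ).
exact: (truth_eq' (Nj σ) (Nj τ) (j_name Hσ) (j_name Hτ)).
Qed.

Lemma U_bv_mem σ τ : is_name B σ -> is_name B τ -> (U (bv_mem P r σ τ) <-> val σ ∈ val τ).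
Proof.
move=> Hσ Hτ; rewrite (U_meets (bv_mem_RO Hr σ Hτ)) (j_bv_mem σ τ).
exact: (truth_bv_mem HN (Nj P) (Nj r) j_preorder Hg j_RO G_meets (Nj σ) (Nj τ)
  (j_name Hσ) (j_name Hτ)).
Qed.

(** [bv_ground] is a supremum over all of [V]. One witness for each condition shows that the sets in
    some [A] suffice, and in this form the value is bounded. [A] may be enlarged by any [a], in
    order to catch a given element of [N] in [j A]. *)
Lemma ground_reflection σ a : exists S A, a ⊆ A /\
  j (bv_ground P r σ) = reg (j P) (j r) (fun p => p ∈ j S) /\ j S ⊆ j P /\
  forall t, t ∈ j P ->
    (t ∈ j S <-> exists x, x ∈ j A /\ t ∈ bv_eq (j P) (j r) (j σ) (check (j P) x)).
Proof.
pose T := sep P (fun t => exists x, t ∈ bv_eq P r σ (check P x)).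
have [A0 HA0] := @small_choice V T (fun t x => t ∈ bv_eq P r σ (check P x))
  (fun t Ht => proj2 (proj1 (in_sep _ _ _) Ht)).
have [A [HA1 HA2]] := pair_cover A0 a.
pose S := sep P (fun t => exists x, x ∈ A /\ t ∈ bv_eq P r σ (check P x)).
have [K1 [HK1 HK2]] := pair_cover A (img A (check P)).
have [K [HK3 HK4]] := pair_cover K1 (singleton σ).
have [X [F [C [HX [HF HC]]]]] := attempt_cover K.
have HAX : A ⊆ X by move=> x Hx; exact/HX/HK3/HK1.
have HσX : σ ∈ X by apply/HX/HK4; rewrite in_singleton.
have HcX x : x ∈ A -> appd C x ∈ X.
  move=> Hx; rewrite (check_attemptE HC (HAX _ Hx)); apply/HX/HK3/HK2.
  by rewrite in_img; exists x.
have Hval x : x ∈ A -> appd F (opair σ (appd C x)) = bv_eq P r σ (check P x).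
  by move=> Hx; rewrite (eq_attemptE HF HσX (HcX x Hx)) (check_attemptE HC (HAX _ Hx)).
have Eb : bv_ground P r σ = reg P r (fun p => p ∈ S).
  apply: sep_ext => p Hp; split=> H q /H [t [Ht HtS]]; exists t; split=> //.
    case: HtS => x Hx; have [HtP _] := po_dom Hr Ht.
    have HtT : t ∈ T by rewrite in_sep; split=> //; exists x.
    have [y [Hy Hty]] := HA0 t HtT.
    by rewrite in_sep; split=> //; exists y; split=> //; exact: HA1.
  by move: HtS; rewrite in_sep => -[_ [x [_ Hx]]]; exists x.
exists S, A; split=> //.
have HQ : Delta0 (fun e : env => (e 0 ⊆ e 3) /\ e 2 = reg (e 3) (e 4) (fun p => p ∈ e 0) /\
   (forall x, x ∈ e 1 -> x ∈ e 5) /\ (forall x, x ∈ e 1 -> appd (e 7) x ∈ e 5) /\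
   forall t, t ∈ e 3 -> (t ∈ e 0 <-> exists x, x ∈ e 1 /\ t ∈ appd (e 6) (opair (e 8) (appd (e 7) x)))).
  by rewrite /reg; bounded.
have [|H1 [H2 [H3 [H4 H5]]]] := tr (e := S .: A .: bv_ground P r σ .: P .: r .: X .: F .: C .: fun _ => σ) HQ.
  split; first exact: sep_sub.
  do 3!split=> //.
  move=> t Ht; rewrite in_sep; split.
    by move=> [_ [x [Hx Hx']]]; exists x; rewrite /= Hval.
  by move=> [x [Hx Hx']]; split=> //; exists x; rewrite /= Hval in Hx'.
have [HF' HC'] := j_attempts HF HC.
have HσX' := proj1 (emb_mem E I I) HσX.
split; first exact: H2.
split; first exact: H1.
move=> t Ht; rewrite (H5 t Ht).
have Hval' x : x ∈ j A -> appd (j F) (opair (j σ) (appd (j C) x)) =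
    bv_eq (j P) (j r) (j σ) (check (j P) x).
  by move=> Hx; rewrite (eq_attemptE HF' HσX' (H4 x Hx)) (check_attemptE HC' (H3 x Hx)).
by split=> -[x [Hx Hx']]; exists x; split=> //; [rewrite -Hval'|rewrite /= Hval'].
Qed.

Lemma truth_check σ x : is_name B σ -> N x ->
  (meets g (bv_eq (j P) (j r) (j σ) (check (j P) x)) <-> val σ = x).
Proof.
move=> Hσ Nx.
rewrite -{2}(check_value x G_unit).
exact: (truth_eq' (Nj σ) (inner_check HN (Nj P) Nx) (j_name Hσ) (check_name x j_unit)).
Qed.

(** In one direction a condition of [g] in [j S] provides a witness in [j A], hence in [N]. In the
    other, [A] is chosen with the value of [σ] in [j A], and the truth lemma provides the
    condition. *)
Lemma U_ground σ : is_name B σ -> (U (bv_ground P r σ) <-> N (val σ)).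
Proof.
move=> Hσ; rewrite (U_meets (bv_ground_RO Hr σ)).
have Hopen S A : j S ⊆ j P -> (forall t, t ∈ j P -> (t ∈ j S <-> exists x, x ∈ j A /\
     t ∈ bv_eq (j P) (j r) (j σ) (check (j P) x))) ->
    (meets g (reg (j P) (j r) (fun p => p ∈ j S)) <-> meets g (j S)).
  move=> HS1 HS2; apply: (meets_reg HN (Nj P) (Nj r) j_preorder Hg (Nj S) HS1).
  move=> p q Hp Hq; have [HqP HpP] := po_dom j_preorder Hq.
  have [x [Hx Hpx]] := proj1 (HS2 p HpP) Hp.
  by apply/(HS2 q HqP); exists x; split=> //; exact: (bv_eq_open j_preorder Hpx Hq).
split.
  have [S [A [_ [-> [HS1 HS2]]]]] := ground_reflection σ emptyset.
  move=> /(Hopen S A HS1 HS2) [p [gp Hp]].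
  have [x [Hx Hpx]] := proj1 (HS2 p (HS1 _ Hp)) Hp.
  have Nx : N x := HNt (Nj A) Hx.
  have -> : val σ = x by apply/(truth_check Hσ Nx); exists p.
  exact: Nx.
move=> Ny; have [a [_ Hya]] := emb_cofinal E Ny.
have [S [A [HaA [-> [HS1 HS2]]]]] := ground_reflection σ a.
apply/(Hopen S A HS1 HS2).
have [p [gp Hp]] := proj2 (truth_check Hσ Ny) eq_refl.
exists p; split=> //; apply/(HS2 p (g_sub Hg gp)); exists (val σ); split=> //.
exact: (proj1 (emb_sub E I I) HaA).
Qed.

(** A name with a captured name [τ] as value is mixed from the values of the
    function capturing [τ]. *)
Lemma captured_name τ : N τ -> is_name (j B) τ -> captured j P r g τ ->
  exists σ, is_name B σ /\ val σ = name_value G τ.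
Proof.
move=> Nτ Hτ [h [Hh [p0 [gp0 Hp0]]]].
have [X [HX1 HX2]] := transitive_cover (singleton h).
have HhX : h ∈ X by apply: HX1; rewrite in_singleton.
(* [Y] replaces [is_name B] by a set. It contains each member of [X] whose entries come from [Y] and
   [B]; this is bounded, and by induction on names ([HXY]) puts every [j B]-name of [j X] into
   [j Y]. *)
pose Y := sep X (is_name B).
(* The mixture: for each [p] the entries of the name that [h] assigns to [p], with their values cut
   down to the part below [p]. *)
have [σ Hσ] : exists σ, forall z, z ∈ σ <-> exists p τ, opair p τ ∈ h /\ (τ ∈ Y /\
    exists ρ b, opair ρ b ∈ τ /\ z = opair ρ (inter b (below P r p))).
  apply: compr_exists.
  apply: (@small_sub V _ (fun z => exists p, p ∈ field h /\ exists τ, τ ∈ field h /\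
    exists ρ, ρ ∈ field τ /\ exists b, b ∈ field τ /\ z = opair ρ (inter b (below P r p)))).
    do 4!(apply: small_bind; [exact: small_set|move=> ? _]); exact: small_eq.
  move=> z [p [τ' [H [_ [ρ [b [Hb ->]]]]]]].
  exists p; split; first exact: field_l H.
  exists τ'; split; first exact: field_r H.
  exists ρ; split; first exact: field_l Hb.
  by exists b; split; first exact: field_r Hb.
have Nσ : is_name B σ.
  split=> [z /Hσ [p [τ' [_ [/in_sep [_ Hτ'] [ρ [b [Hb ->]]]]]]]|ρ' b' /Hσ].
    exists ρ, (inter b (below P r p)); split=> //.
    have [_ HbB] := name_child Hτ' Hb.
    apply: (inter_RO Hr) => //; apply: (reg_RO Hr) => q t H1 H2.
    exact: (po_trans Hr H2 H1).
  move=> [p [τ' [_ [/in_sep [_ Hτ'] [ρ [b [Hb /opair_inj [-> _]]]]]]]].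
  by case: (name_child Hτ' Hb).
exists σ; split=> //.
have HQ : Delta0 (fun e : env => dense_fun (e 0) (e 1) (e 2) /\
    (forall x, x ∈ e 3 -> forall y, y ∈ x -> y ∈ e 3) /\ e 2 ∈ e 3 /\
    (forall x, x ∈ e 3 -> (forall z, z ∈ x -> exists ρ, ρ ∈ e 4 /\ exists b, b ∈ e 5 /\ z = opair ρ b) ->
       x ∈ e 4) /\
    (forall z, z ∈ e 6 -> exists p τ, opair p τ ∈ e 2 /\ (τ ∈ e 4 /\
      exists ρ b, opair ρ b ∈ τ /\ z = opair ρ (inter b (below (e 0) (e 1) p)))) /\
    (forall p τ, opair p τ ∈ e 2 -> τ ∈ e 4 -> forall ρ b, opair ρ b ∈ τ ->
      opair ρ (inter b (below (e 0) (e 1) p)) ∈ e 6)).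
  by rewrite /dense_fun /below /reg; bounded.
have [|[D1 [D2 [D3 D4]]] [J2 [J3 [J4 [J5 J6]]]]] :=
  tr (e := P .: r .: h .: X .: Y .: B .: fun _ => σ) HQ.
  move=> /=; split; first exact: Hh.
  split; first by move=> x Hx y; exact: HX2 Hx.
  split; first exact: HhX.
  split.
    move=> x Hx Hcl; apply/in_sep; refine (conj Hx _); apply: IsName.
      by move=> z /Hcl [ρ [_ [b [Hb ->]]]]; exists ρ, b.
    by move=> ρ b /Hcl [ρ' [/in_sep [_ H] [b' [_ /opair_inj [-> _]]]]].
  split; first by move=> z /Hσ.
  by move=> p τ' H HY ρ b Hb; apply/Hσ; exists p, τ'; split=> //; split=> //; exists ρ, b.
move: D1 D2 D3 D4 J2 J3 J4 J5 J6 => /= D1 D2 D3 D4 J2 J3 J4 J5 J6.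
have HXY x : is_name (j B) x -> x ∈ j X -> x ∈ j Y.
  elim=> {}x H1 _ IH Hx; apply: J4 => // z Hz.
  have [ρ [b [Ez Hb]]] := H1 z Hz; exists ρ; split; last by exists b.
  rewrite Ez in Hz; apply: (IH ρ b Hz); apply: (set_child J2 Hx); by exists b.
have HτX : τ ∈ j X.
  have HjX : transitive_class (fun x => x ∈ j X) by move=> x y Hx; exact: J2.
  by case: (transitive_opair HjX J3 Hp0).
have HτY := HXY τ Hτ HτX.
have Hjσ := j_name Nσ.
apply: set_ext => z; rewrite !in_name_value; split.
  move=> [ρ [b' [Hb' [Gb' ->]]]].
  have [_ Hb'B] := name_child Hjσ Hb'.
  have [p [τ' [Hpτ' [_ [ρ1 [b [Hb /opair_inj [Eρ Eb']]]]]]]] := J5 _ Hb'.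
  rewrite -Eρ in Hb.
  have [q [gq]] := proj1 (G_meets Hb'B) Gb'.
  rewrite Eb' in_inter in_reg => -[Hqb [Hq Hqp]].
  have [t [gt [Htq Htp0]]] := g_directed Hg gq gp0.
  have [u [Hut Hup]] := Hqp t Htq.
  (* [u] extends both [p] and [p0], so [j h] takes both values at [u]. *)
  have Eτ : τ' = τ.
    apply: (D2 u) (D3 _ _ Hpτ' _ Hup) _ (D3 _ _ Hp0 _ _).
    exact: (po_trans j_preorder Hut Htp0).
  rewrite Eτ in Hb; have [_ HbB] := name_child Hτ Hb.
  by exists ρ, b; split=> //; split=> //; apply/(G_meets HbB); exists q.
move=> [ρ [b [Hb [Gb ->]]]].
have [_ HbB] := name_child Hτ Hb.
have Hb' := J6 _ _ Hp0 HτY _ _ Hb.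
have [_ Hb'B] := name_child Hjσ Hb'.
exists ρ, (inter b (below (j P) (j r) p0)); split=> //; split=> //.
apply/(G_meets Hb'B).
have [q [gq Hqb]] := proj1 (G_meets HbB) Gb.
have [t [gt [Htq Htp0]]] := g_directed Hg gq gp0.
exists t; split=> //; rewrite in_inter; split.
  exact: (RO_open j_preorder (j_RO HbB) Hqb Htq).
apply: (open_reg j_preorder); first exact: (g_sub Hg gt).
by move=> s Hs; exact: (po_trans j_preorder Hs Htp0).
Qed.

Hypothesis Hcap : forall x, N x -> captured j P r g x.

Lemma bclass_eq (σ τ : name P r) :
  bultra_class U σ = bultra_class U τ <-> val (proj1_sig σ) = val (proj1_sig τ).
Proof.
have Hv (ρ ρ' : name P r) : bclass U ρ ρ' <-> val (proj1_sig ρ) = val (proj1_sig ρ').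
  exact: (U_bv_eq (proj2_sig ρ) (proj2_sig ρ')).
split=> H.
  have Hc : bclass U σ = bclass U τ by case: H.
  by apply/Hv; rewrite Hc; apply/Hv.
have Hc : bclass U σ = bclass U τ.
  by extensionality ρ; apply: propositional_extensionality; rewrite !Hv H.
rewrite /bultra_class; move: (ex_intro _ σ _) (ex_intro _ τ _) => H1 H2.
move: H1 H2; rewrite Hc => H1 H2; congr exist; exact: proof_irrelevance.
Qed.

Lemma bultra_surj (C : bultrapower P r U) : exists σ : name P r, C = bultra_class U σ.
Proof.
case: C => c H; case: (H) => σ Ec; exists σ.
rewrite /bultra_class; move: (ex_intro _ σ _) => H2.
by subst c; congr exist; exact: proof_irrelevance.
Qed.

(** [Hcap] is applied to arbitrary names in [N] for the extension and to canonical names for the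
    ground model. Transitivity of the range rests on surjectivity too: a member of a value is the
    value of a name in [N] that need not be an image under [j]. *)
Theorem boolean_ultrapower_collapse : exists c : bultrapower P r U -> V,
  transitive_collapse (@bultra_mem V P r U) c /\
  (forall x : V, exists σ : name P r,
     proj1_sig σ = check P x /\ c (bultra_class U σ) = j x) /\
  (forall y : V, N y <-> exists C : bultrapower P r U, bultra_ground C /\ y = c C) /\
  (forall y : V, generic_extension N (j B) G y <-> exists C : bultrapower P r U, y = c C).
Proof.
pose rep (C : bultrapower P r U) := proj1_sig (constructive_indefinite_description _ (bultra_surj C)).
pose c (C : bultrapower P r U) := val (proj1_sig (rep C)).
have Hc (σ : name P r) : c (bultra_class U σ) = val (proj1_sig σ).
  apply/bclass_eq; symmetry.
  exact: (proj2_sig (constructive_indefinite_description _ (bultra_surj (bultra_class U σ)))).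
have Hext y : generic_extension N (j B) G y <-> exists C : bultrapower P r U, y = c C.
  split.
    move=> [τ [Nτ [Hτ ->]]]; have [σ [Hσ Eσ]] := captured_name Nτ Hτ (Hcap Nτ).
    by exists (bultra_class U (exist _ σ Hσ)); rewrite Hc.
  move=> [C ->]; have [[σ Hσ] ->] := bultra_surj C; rewrite Hc.
  exists (j σ); exact: (conj (Nj σ) (conj (j_name Hσ) eq_refl)).
exists c; split; [|split; [|split; [|exact: Hext]]].
- split; [|split].
  + move=> C C'; have [σ ->] := bultra_surj C; have [τ ->] := bultra_surj C'.
    by rewrite !Hc => /bclass_eq.
  + move=> C C'; split.
      have [σ ->] := bultra_surj C; have [τ ->] := bultra_surj C'.
      rewrite !Hc => H; exists σ, τ; split; [reflexivity|split; [reflexivity|]].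
      exact: (proj2 (U_bv_mem (proj2_sig σ) (proj2_sig τ)) H).
    move=> [σ [τ [-> [-> H]]]]; rewrite !Hc.
    exact: (proj1 (U_bv_mem (proj2_sig σ) (proj2_sig τ)) H).
  + move=> x y [C ->]; have [[σ Hσ] ->] := bultra_surj C; rewrite Hc.
    move=> /in_name_value [ρ [b [Hb [_ ->]]]].
    have [Hρ _] := name_child (j_name Hσ) Hb.
    have [Nρ _] := class_opair HNt (HNt (Nj σ) Hb).
    by apply/Hext; exists ρ; exact: (conj Nρ (conj Hρ eq_refl)).
- move=> x; have Hx := check_name x (unit_RO Hr).
  exists (exist _ (check P x) Hx); split; first reflexivity.
  by rewrite Hc /= j_check; exact: check_value G_unit.
- move=> y; split; last first.
    move=> [C [[σ [-> HU]] ->]]; rewrite Hc.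
    exact: (proj1 (U_ground (proj2_sig σ)) HU).
  move=> Ny.
  have Nc := inner_check HN (Nj P) Ny.
  have [σ [Hσ Eσ]] := captured_name Nc (check_name y j_unit) (Hcap Nc).
  rewrite (check_value y G_unit) in Eσ.
  exists (bultra_class U (exist _ σ Hσ)); split; last by rewrite Hc.
  exists (exist _ σ Hσ); split; first reflexivity.
  by apply/(U_ground Hσ); rewrite Eσ.
Qed.

End BooleanUltrapower.

(** * Prikry forcing *)

Section Prikry.
Context {V : zfc_universe}.
Implicit Types (a b c d f h i k m p q s t x y z ξ S T : V).
Local Notation env := (@env V).

Variables (D α κ Us : V).
Hypothesis HD : monotone_enumeration D α κ.
Hypothesis Hdiscrete : discrete D.
Hypothesis Hmeasurable : forall d, d ∈ D -> measurable d.
Hypothesis HUs : fun_on Us α.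
Hypothesis Hnormal : forall i, i ∈ α -> normal_ultrafilter (app κ i) (app Us i).

Local Notation P := (prikry α κ Us).
Local Notation r := (prikry_order α κ Us).

Lemma prikry_stem p : p ∈ P -> is_function (fst p) /\
  forall i, in_dom (fst p) i -> i ∈ α.
Proof.
move=> /in_prikry [s [T [-> [Hs [_ [Hd _]]]]]]; rewrite fst_opair; split=> // i Hi.
by case: (Hd i Hi).
Qed.

Lemma prikry_stem_mono q p : opair q p ∈ r -> fst p ⊆ fst q.
Proof.
move=> /in_prikry_order [_ [_ [s' [T' [s [T [-> [-> [H _]]]]]]]]].
by rewrite !fst_opair.
Qed.

Lemma prikry_preorder : preorder P r.
Proof.
split.
- by move=> q p /in_prikry_order [Hq [Hp _]].
- move=> p Hp; apply/in_prikry_order; do 2!split=> //.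
  move: (Hp) => /in_prikry [s [T [-> _]]].
  by exists s, T, s, T; do 4!split=> //; move=> i // _ z.
- move=> t q p /in_prikry_order [Ht [Hq [s2 [T2 [s1' [T1' [E2 [E1' [H1 [H2 H3]]]]]]]]]].
  move=> /in_prikry_order [_ [Hp [s1 [T1 [s [T [E1 [E [H4 [H5 H6]]]]]]]]]].
  rewrite E1 in E1'; have [? ?] := opair_inj E1'; subst s1' T1'.
  apply/in_prikry_order; do 2!split=> //; exists s2, T2, s, T; do 2!split=> //.
  move: Ht Hq; rewrite E2 E1.
  move=> /in_prikry [s2' [T2' [/opair_inj [<- <-] [F2 [_ [d2 [_ [dT2 _]]]]]]]].
  move=> /in_prikry [s1' [T1' [/opair_inj [<- <-] [F1 [_ [d1 [_ [dT1 _]]]]]]]].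
  split; first by move=> z /H4 /H1.
  split.
    move=> i Hi2 Hi; case: (classic (in_dom s1 i)) => Hi1.
      have Hin := in_dom_app F1 Hi1.
      by rewrite (appE F2 (H1 _ Hin)); exact: H5.
    have HT1 : in_dom T1 i by apply/dT1; split=> //; case: (d2 i Hi2).
    by apply: (H6 i HT1); exact: H2.
  move=> i HT2 z Hz.
  have [Hi Hn2] := proj1 (dT2 i) HT2.
  have HT1 : in_dom T1 i.
    by apply/dT1; split=> // -[y Hy]; apply: Hn2; exists y; exact: H1.
  by apply: (H6 i HT1); exact: (H3 i HT2).
Qed.

(** The value at [ξ] is taken from the measure one set and above a bound of the earlier cardinals;
    discreteness gives the bound, and sets in the ultrafilter are unbounded. *)
Lemma prikry_extend p ξ : p ∈ P -> ξ ∈ α ->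
  exists q, opair q p ∈ r /\ in_dom (fst q) ξ.
Proof.
move=> Hp Hξ; case: (classic (in_dom (fst p) ξ)) => Hdom.
  by exists p; split=> //; exact: (po_refl prikry_preorder).
move: (Hp) => /in_prikry [s [T [Ep [Fs [[l Hl] [Hs [FT [dT HT]]]]]]]].
rewrite Ep fst_opair in Hdom.
have HTξ : in_dom T ξ by apply/dT.
have [b [Hb Hsup]] := kappa_discrete HD Hdiscrete Hmeasurable Hnormal Hξ.
have Hko := kappa_ord HD Hmeasurable Hξ.
have [u [Hu Hbu]] := uf_unbounded Hko (Hnormal Hξ) Hb (HT ξ HTξ).
have Huk : u ∈ app κ ξ.
  by case: (Hnormal Hξ) => [[H _] _]; exact: (H _ (HT ξ HTξ)).
pose s' := Un (upair s (singleton (opair ξ u))).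
pose T' := sep T (fun z => fst z <> ξ).
have in_s' z : z ∈ s' <-> z ∈ s \/ z = opair ξ u.
  rewrite in_Un; split.
    by move=> [y []]; rewrite in_upair => -[->|->]; rewrite ?in_singleton; auto.
  by move=> [Hz|->]; [exists s|exists (singleton (opair ξ u))]; rewrite in_upair ?in_singleton; auto.
have in_T' i y : opair i y ∈ T' <-> opair i y ∈ T /\ i <> ξ by rewrite in_sep fst_opair.
have dom_s' i : in_dom s' i <-> in_dom s i \/ i = ξ.
  split; first by move=> [y /in_s' [H|/opair_inj [-> _]]]; [left; exists y|right].
  by move=> [[y Hy]|->]; [exists y|exists u]; apply/in_s'; auto.
have Fs' : is_function s'.
  split.
    by move=> z /in_s' [/(proj1 Fs)//|->]; exists ξ, u.
  move=> x y y' /in_s' [H|/opair_inj [Ex Ey]] /in_s' [H'|/opair_inj [Ex' Ey']].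
    exact: (proj2 Fs) H H'.
    by case: Hdom; exists y; rewrite -Ex'.
    by case: Hdom; exists y'; rewrite -Ex.
    by rewrite Ey Ey'.
have FT' : is_function T'.
  split; first by move=> z /in_sep [/(proj1 FT)].
  by move=> x y y' /in_T' [H _] /in_T' [H' _]; exact: (proj2 FT) H H'.
have app_s i : in_dom s i -> app s' i = app s i.
  by move=> Hi; apply: (appE Fs'); apply/in_s'; left; exact: in_dom_app.
have app_ξ : app s' ξ = u by apply: (appE Fs'); apply/in_s'; right.
have dom_T' i : in_dom T' i <-> in_dom T i /\ i <> ξ.
  split; first by move=> [y /in_T' [Hy Hi]]; split=> //; exists y.
  by move=> [[y Hy] Hi]; exists y; apply/in_T'.
have app_T i : in_dom T' i -> app T' i = app T i.
  move=> /dom_T' [Hi Hne]; apply: (appE FT'); apply/in_T'; split=> //; exact: in_dom_app.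
exists (opair s' T'); split; last by rewrite fst_opair; apply/dom_s'; right.
apply/in_prikry_order; split; last first.
  split=> //; exists s', T', s, T; do 2!split=> //.
  split; first by move=> z Hz; apply/in_s'; left.
  split; last by move=> i Hi; rewrite app_T.
  by move=> i /dom_s' [//|->] _; rewrite app_ξ.
apply/in_prikry; exists s', T'; do 2!split=> //.
split; first by exists (ξ :: l) => i /dom_s' [/Hl|->]; [right|left].
split.
  move=> i /dom_s' [Hi|->]; first by rewrite app_s //; exact: Hs.
  rewrite app_ξ; do 2!split=> //; move=> k /Hsup Hk z /Hk Hz.
  exact: ord_trans (ord_mem Hko Huk) Hbu Hz.
split=> //; split.
  move=> i; rewrite dom_T' dT dom_s'; tauto.
by move=> i Hi; rewrite app_T //; apply: HT; case/dom_T': Hi.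
Qed.

(** * Capturing the elements of the last model *)

Variables (αt : V) (M : V -> V -> Prop) (π : V -> V -> V -> V).
Hypothesis Hiter : imitation_iteration α κ Us αt M π.

Local Notation j := (π emptyset αt).
Local Notation N := (M αt).
Local Notation lam := (critical_point κ π).
Local Notation g := (sequence_filter (j P) αt lam).

Hypothesis Hg : generic_filter N (j P) (j r) g.

Let Hstage i := stages HD Hmeasurable HUs Hnormal Hiter (k := i).
Let Hαt : ordinal αt := ord_at Hiter.
Let SN : stage α M π αt := Hstage (or_intror eq_refl).
Let NT : transitive_class N := st_trans SN.
Let E : embedding (fun _ => True) N j := stage_emb0 Hiter SN Hαt.
Let HN : inner_model N := inner_model_of_embedding NT E.
Let Hr' : preorder (j P) (j r) := j_preorder E prikry_preorder.

Lemma D0_dense_fun : Delta0 (fun e : env => dense_fun (e 0) (e 1) (e 2)).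
Proof. by rewrite /dense_fun; bounded. Qed.

Lemma j_dense_fun h : dense_fun P r h -> dense_fun (j P) (j r) (j h).
Proof.
exact: (proj1 (emb_D0 (e := P .: r .: fun _ => h) E D0_dense_fun (fun _ => I))).
Qed.

(** The domain of [j h] is a dense set lying in [N], so genericity applies. *)
Lemma dense_fun_meets h : dense_fun P r h -> exists p x, g p /\ opair p x ∈ j h.
Proof.
move=> /j_dense_fun [_ [_ [_ H]]].
pose S := sep (j P) (fun p => in_dom (j h) p).
have NS : N S.
  apply: (im_simple HN (t := fun e => sep (e 0) (fun p => in_dom (e 1) p)) (e := j P .: fun _ => j h)).
    by bounded.
  by case=> [|n]; exact: (emb_maps E I).
have [|p [/in_sep [_ [x Hx]] gp]] := g_dense Hg NS (@sep_sub _ _ _); last by exists p, x.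
move=> p /H [q [Hq Hd]]; exists q; split=> //; rewrite in_sep; split=> //.
by case: (po_dom Hr' Hq).
Qed.

Lemma dense_fun_unique h p q x y : dense_fun P r h -> g p -> g q ->
  opair p x ∈ j h -> opair q y ∈ j h -> x = y.
Proof.
move=> /j_dense_fun [_ [H1 [H2 _]]] gp gq Hp Hq.
have [t [gt [Htp Htq]]] := g_directed Hg gp gq.
exact: H1 (H2 _ _ Hp _ Htp) _ (H2 _ _ Hq _ Htq).
Qed.

Lemma captured_const x : captured j P r g (j x).
Proof.
exists (mkfun P (fun _ => x)).
have Hh : dense_fun P r (mkfun P (fun _ => x)).
  split; first by move=> p y /in_mkfun [].
  split; first by move=> p y /in_mkfun [_ ->] y' /in_mkfun [_ ->].
  split.
    move=> p y /in_mkfun [_ ->] q Hq; apply/in_mkfun; split=> //.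
    by case: (po_dom prikry_preorder Hq).
  move=> p Hp; exists p; split; first exact: (po_refl prikry_preorder).
  by exists x; apply/in_mkfun.
split=> //; have [p [gp _]] : exists p, g p /\ True by case: Hg => _ [[p gp] _]; exists p.
exists p; split=> //.
have -> : j (mkfun P (fun _ => x)) = mkfun (j P) (fun _ => j x).
  apply: (emb_simple (t := fun e => mkfun (e 0) (fun _ => e 1)) (e := P .: fun _ => x) E) => //.
  by bounded.
by apply/in_mkfun; split=> //; exact: (g_sub Hg gp).
Qed.

Lemma filter_stem p i : g p -> in_dom (fst p) i -> appd (fst p) i = lam i.
Proof.
move=> [Hp [s [T [Ep [Hs _]]]]]; subst p; rewrite fst_opair => Hi.
have HQ : Delta0 (fun e : env => forall p, p ∈ e 0 -> is_function (fst p)) by bounded.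
have Hstem := proj1 (emb_D0 (e := fun _ => P) E HQ (fun _ => I))
  (fun p Hp => proj1 (prikry_stem Hp)).
have Fs : is_function s by have := Hstem _ Hp; rewrite /= fst_opair.
by rewrite -(app_appd Fs Hi); exact: Hs.
Qed.

(** If [p] decides [f] and [ξ], and [ξ] is in the domain of the stem of [p], then [p]
    decides [f(lam ξ)], since [lam ξ] is the value of the stem at [ξ]. *)
Lemma captured_app f ξ : ξ ∈ αt -> captured j P r g f -> captured j P r g ξ ->
  captured j P r g (appd f (lam ξ)).
Proof.
move=> Hξ [h1 [Hh1 [p1 [gp1 Hp1]]]] [h2 [Hh2 [p2 [gp2 Hp2]]]].
(* The value [emptyset] for [i ∉ α] is a default that keeps the domain of [h] dense where [h2] does
   not decide an index. At [ξ] itself it is excluded, since [αt] is the image of [α]. *)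
pose R p v f i := (in_dom (fst p) i /\ v = appd f (appd (fst p) i)) \/ (i ∉ α /\ v = emptyset).
have [h Hh] : exists h, forall z, z ∈ h <-> exists p v, z = opair p v /\
    exists f, opair p f ∈ h1 /\ exists i, opair p i ∈ h2 /\ R p v f i.
  apply: compr_exists.
  apply: (@small_sub V _ (fun z => exists p, p ∈ field h1 /\ exists f, f ∈ field h1 /\
    exists i, i ∈ field h2 /\ exists v, (v = appd f (appd (fst p) i) \/ v = emptyset) /\
      z = opair p v)).
    apply: small_bind => [|p _]; first exact: small_set.
    apply: small_bind => [|f' _]; first exact: small_set.
    apply: small_bind => [|i _]; first exact: small_set.
    apply: small_bind => [|v _]; last exact: small_eq.
    exists (upair (appd f' (appd (fst p) i)) emptyset) => v Hv; exact/in_upair.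
  move=> z [p [v [-> [f' [Hf [i [Hi Hv]]]]]]].
  exists p; split; first exact: field_l Hf.
  exists f'; split; first exact: field_r Hf.
  exists i; split; first exact: field_r Hi.
  by exists v; split=> //; case: Hv => -[_ ->]; auto.
have {}Hh p v : opair p v ∈ h <->
    exists f, opair p f ∈ h1 /\ exists i, opair p i ∈ h2 /\ R p v f i.
  rewrite Hh; split; first by move=> [p' [v' [/opair_inj [-> ->]]]].
  by move=> H; exists p, v.
have [A1 [A2 [A3 A4]]] := Hh1; have [B1 [B2 [B3 B4]]] := Hh2.
have Hdense : dense_fun P r h.
  split; first by move=> p v /Hh [f' [Hf _]]; exact: A1 Hf.
  split.
    move=> p v /Hh [f1 [Hf1 [i1 [Hi1 H1]]]] w /Hh [f2 [Hf2 [i2 [Hi2 H2]]]].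
    move: H1 H2; rewrite (A2 _ _ Hf1 _ Hf2) (B2 _ _ Hi1 _ Hi2).
    have [_ Hdom] := prikry_stem (A1 _ _ Hf1).
    by move=> [[H1 ->]|[H1 ->]] [[H2 ->]|[H2 ->]] //; [case: H2|case: H1]; exact: Hdom.
  split.
    move=> p v /Hh [f1 [Hf1 [i1 [Hi1 H1]]]] q Hq; apply/Hh.
    exists f1; split; first exact: A3 Hf1 _ Hq.
    exists i1; split; first exact: B3 Hi1 _ Hq.
    case: H1 => [[H1 ->]|H1]; [left|by right].
    have Hsub := prikry_stem_mono Hq.
    have [HqP HpP] := po_dom prikry_preorder Hq.
    have [Fp _] := prikry_stem HpP; have [Fq _] := prikry_stem HqP.
    case: H1 => y Hy; have Hy' := Hsub _ Hy.
    by split; [exists y|rewrite (appd_fun Fp Hy) (appd_fun Fq Hy')].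
  move=> p Hp.
  have [q1 [Hq1 [f' Hf]]] := A4 p Hp.
  have [q2 [Hq2 [i Hi]]] := B4 q1 (A1 _ _ Hf).
  have Hq2P := B1 _ _ Hi.
  have Htr := po_trans prikry_preorder.
  have Hf2 := A3 _ _ Hf _ Hq2.
  case: (classic (i ∈ α)) => Hiα; last first.
    exists q2; split; first exact: Htr Hq2 Hq1.
    exists emptyset; apply/Hh; exists f'; split=> //; exists i; split=> //; by right.
  (* Once the decided index is in the stem, the argument of [f'] can be read off the condition. *)
  have [q3 [Hq3 Hdom]] := prikry_extend Hq2P Hiα.
  exists q3; split; first exact: Htr Hq3 (Htr _ _ _ Hq2 Hq1).
  exists (appd f' (appd (fst q3) i)); apply/Hh.
  exists f'; split; first exact: A3 Hf2 _ Hq3.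
  by exists i; split; [exact: B3 Hi _ Hq3|left].
have HQ : Delta0 (fun e : env => forall p v, opair p v ∈ e 0 ->
    exists f, opair p f ∈ e 1 /\ exists i, opair p i ∈ e 2 /\
      ((in_dom (fst p) i /\ v = appd f (appd (fst p) i)) \/ (i ∉ e 3 /\ v = emptyset))).
  by bounded.
have Hjh := proj1 (emb_D0 (e := h .: h1 .: h2 .: fun _ => α) E HQ (fun _ => I))
  (fun p v H => proj1 (Hh p v) H).
have [p [v [gp Hpv]]] := dense_fun_meets Hdense.
exists h; split=> //; exists p; split=> //.
have [f' [Hf' [i [Hi Hv]]]] := Hjh p v Hpv.
move: Hf' Hi Hv => /= Hf' Hi Hv.
rewrite (dense_fun_unique Hh1 gp gp1 Hf' Hp1) (dense_fun_unique Hh2 gp gp2 Hi Hp2) in Hv.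
case: Hv => [[Hdom Ev]|[Hn _]]; last by case: Hn; rewrite (it_stop Hiter).
by rewrite -(filter_stem gp Hdom) -Ev.
Qed.

Theorem captured_stage i x : ole i αt -> M i x -> captured j P r g (π i αt x).
Proof.
elim/(well_founded_induction (mem_wf (V := V))): i x => i IH x Hi Mx.
have Hio := ole_ord Hαt Hi.
case: (ord_cases Hio) => [Ei|[[k [Hk Ei]]|Hlim]].
- by rewrite Ei; exact: captured_const.
- have Hkt : k ∈ αt by exact: ole_mem Hαt Hi Hk.
  have Hkt' : ole k αt by left.
  have HS := Hstage Hkt'; have HSi := Hstage Hi.
  have Hki : ole k i by left.
  rewrite Ei in Mx.
  have [f [Mf [Ff Ex]]] := succ_rep HD Hmeasurable HUs Hnormal Hiter Hkt HS Mx.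
  have Ek : embedding (M k) (M i) (π k i) := st_emb HSi Hki.
  have Eit : embedding (M i) N (π i αt) := st_emb SN Hi.
  have Mlam : M i (lam k).
    have Hmv := succ_moves HD Hmeasurable HUs Hnormal Hiter Hkt HS; rewrite -Ei in Hmv.
    apply: (st_trans HSi _ Hmv); apply: (emb_maps Ek).
    exact: (M_lam HD Hmeasurable HUs Hnormal Hiter Hkt).
  have Hlam := lam_fix HD Hdiscrete Hmeasurable HUs Hnormal Hiter Hkt.
  rewrite -Ei in Hlam Ex Mx.
  have Mkf : M i (π k i f) := emb_maps Ek Mf.
  have Mapp : M i (appd (π k i f) (lam k)) by rewrite -Ex.
  have -> : π i αt x = appd (π k αt f) (lam k).
    rewrite Ex (emb_appd Eit Mkf Mlam Mapp) Hlam.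
    have -> // : π k αt f = π i αt (π k i f).
    exact: (it_comp Hiter Hki Hi (or_intror eq_refl) Mf).
  apply: captured_app => //; first exact: IH.
  (* The index [k] is an element of [M k] and equals its own image, so the induction hypothesis
     captures it as well. *)
  have Habove := lam_above HD Hdiscrete Hmeasurable Hnormal Hiter Hkt HS.
  have Hfix := below_lam_fix HD Hdiscrete Hmeasurable HUs Hnormal Hiter Hkt Hkt'
    (or_intror eq_refl) Habove.
  rewrite -Hfix; apply: IH => //.
  exact: (M_below_lam HD Hmeasurable HUs Hnormal Hiter Hkt Habove).
- have [_ [_ HL]] := it_lim Hiter Hi Hlim.
  have [m [y [Hm [My Ex]]]] := proj1 (HL x) Mx.
  have Hmi : ole m i by left.
  rewrite Ex -(it_comp Hiter Hmi Hi (or_intror eq_refl) My).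
  by apply: IH => //; left; exact: ole_mem Hαt Hi Hm.
Qed.

Lemma captured_all x : N x -> captured j P r g x.
Proof.
move=> Nx; have Hαα : ole αt αt by right.
by rewrite -(it_id Hiter Hαα Nx); exact: captured_stage.
Qed.

End Prikry.

(** The three identities hold after identification with the transitive collapse, so they are stated
    for a single collapse map [c]. The extension by the critical sequence is the extension by the
    filter [G] generated from it, whose genericity is the known fact assumed as [Hgeneric]. *)
Theorem theorem2p13 :
  forall (V : zfc_universe) (D α κ Us : V)
    (HD : monotone_enumeration D α κ)
    (Hdiscrete : discrete D)
    (Hmeasurable : forall d, d ∈ D -> measurable d)
    (HUs : fun_on Us α)
    (Hnormal : forall i, i ∈ α -> normal_ultrafilter (app κ i) (app Us i))
    (αt : V) (M : V -> V -> Prop) (π : V -> V -> V -> V)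
    (Hiter : imitation_iteration α κ Us αt M π),
  let P := prikry α κ Us in
  let r := prikry_order α κ Us in
  let B := RO P r in
  let lam := critical_point κ π in
  let j0 := π emptyset αt in
  let g := sequence_filter (j0 P) αt lam in
  let G := generated_filter (j0 B) (j0 (RO_embedding P r)) g in
  let U := fun b : V => b ∈ B /\ G (j0 b) in
  forall (Hgeneric : generic_filter (M αt) (j0 P) (j0 r) g),
  exists c : bultrapower P r U -> V,
    transitive_collapse (@bultra_mem V P r U) c /\
    (forall x : V, exists σ : name P r,
       proj1_sig σ = check P x /\ c (bultra_class U σ) = j0 x) /\
    (forall y : V, M αt y <-> exists C, bultra_ground C /\ y = c C) /\
    (forall y : V, generic_extension (M αt) (j0 B) G y <-> exists C, y = c C).
Proof.
move=> V D α κ Us HD Hdiscrete Hmeasurable HUs Hnormal αt M π Hiter P r B lam j0 g G U Hg.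
have Hord := ord_at Hiter.
have S := stages HD Hmeasurable HUs Hnormal Hiter (or_intror eq_refl : ole αt αt).
exact: (boolean_ultrapower_collapse (st_trans S) (stage_emb0 Hiter S Hord)
  (prikry_preorder α κ Us) Hg
  (captured_all HD Hdiscrete Hmeasurable HUs Hnormal Hiter Hg)).
Qed.
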